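(* Let $E\subset\mathbb{C}$ be an arbitrary compact set of positive capacity, and let $\phi:\mathbb{C}\to\mathbb{R}$ be a continuous function with compact support such that $D[\phi]<\infty$. If $Z_n=\{z_{k,n}\}_{k=1}^n\subset\mathbb{C}$, $n\ge2$, then for any $r>0$ we have $$\left|\frac1n\sum_{k=1}^n\phi(z_{k,n})-\int\phi\,d\mu_E\right|\le\omega_\phi(r)+\sqrt{\frac{D[\phi]}{2\pi}}\,\sqrt{I},$$ where $$I=2m_E(Z_n)+\frac{n-1}{n}\hat I[\tau(Z_n)]-V_E-\frac{\log r}{n}+2\max_{d_E(z)\le2r}g_E(z,\infty).$$
   Context: For a Borel measure $\mu$ with compact support in $\mathbb{C}$, its energy is $I[\mu]=\iint\log\frac{1}{|z-t|}\,d\mu(t)\,d\mu(z)$. For compact $E\subset\mathbb{C}$, let $\mathcal{M}(E)$ be the set of all Borel probability measures supported on $E$; Robin's constant is $V_E=\inf_{\mu\in\mathcal{M}(E)}I[\mu]$ and the capacity is $\mathrm{cap}(E)=e^{-V_E}$. If $\mathrm{cap}(E)>0$, the infimum is attained by a unique measure $\mu_E\in\mathcal{M}(E)$, the equilibrium measure of $E$. $\Omega_E$ is the unbounded connected component of $\overline{\mathbb{C}}\setminus E$, and $g_E(z,\infty)$ is the Green function of $\Omega_E$ with pole at $\infty$, extended from $\Omega_E$ to all of $\mathbb{C}$ by the formula $g_E(z,\infty)=V_E-\int\log\frac{1}{|z-t|}\,d\mu_E(t)$, $z\in\mathbb{C}$. For a set of $n$ points $Z_n=\{z_{k,n}\}_{k=1}^n$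 (points listed with possible repetition), the counting measure is $\tau(Z_n)=\frac1n\sum_{k=1}^n\delta_{z_{k,n}}$, where $\delta_z$ is the unit point mass at $z$. The discrete energy is $$\hat I[\tau(Z_n)]=\frac{2}{n(n-1)}\sum_{1\le j<k\le n}\log\frac{1}{|z_{j,n}-z_{k,n}|},$$ which is finite if and only if the points are distinct (and is $+\infty$ otherwise). Also $$m_E(Z_n)=\frac1n\sum_{z_{k,n}\in\Omega_E}g_E(z_{k,n},\infty),$$ with $m_E(Z_n)=0$ if $Z_n\cap\Omega_E=\emptyset$. The modulus of continuity of $\phi$ is $\omega_\phi(r)=\sup_{|z-\zeta|\le r}|\phi(z)-\phi(\zeta)|$ ($z,\zeta\in\mathbb{C}$). The Dirichlet integral is $D[\phi]=\iint_{\mathbb{R}^2}(\phi_x^2+\phi_y^2)\,dx\,dy$, where it is assumed that the partial derivatives $\phi_x,\phi_y$ exist a.e. on $\mathbb{R}^2=\mathbb{C}$ with respect to area measure. The distance to $E$ is $d_E(z)=\min_{t\in E}|z-t|$.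
   Formalization: φ is additionally assumed absolutely continuous on bounded intervals of almost every horizontal and vertical line; if the partial derivatives merely exist a.e., the claim fails, e.g. for φ(x,y)=c(x)c(y) with c a Cantor-staircase bump, where D[φ]=0. *)

(* Defs.v *)
From HB Require Import structures.
From mathcomp Require Import all_boot all_order all_algebra.
From mathcomp Require Import all_classical all_reals all_analysis.

Set Implicit Arguments.
Unset Strict Implicit.
Unset Printing Implicit Defensive.

Import Order.TTheory GRing.Theory Num.Theory.
Import numFieldNormedType.Exports.

Local Open Scope classical_set_scope.
Local Open Scope ring_scope.

(* The complex plane is R * R, with its product topology and product
   (= Borel) sigma-algebra. The default norm on a product is the sup norm,
   hence the explicit Euclidean modulus. *)
Definition cdist (R : realType) (z w : R * R) : R :=
  Num.sqrt ((z.1 - w.1) ^+ 2 + (z.2 - w.2) ^+ 2).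

(* log (1 / |z - w|), equal to +oo when z = w since lne 0 = -oo *)
Definition log_kernel (R : realType) (z w : R * R) : \bar R :=
  (- lne (cdist z w)%:E)%E.

Definition log_potential (R : realType) (mu : probability (R * R)%type R)
    (z : R * R) : \bar R :=
  \int[mu]_t log_kernel z t.

Definition log_energy (R : realType) (mu : probability (R * R)%type R) :
    \bar R :=
  \int[mu]_z \int[mu]_t log_kernel z t.

(* Since E is compact, being supported on E amounts to not charging ~` E. *)
Definition supported_on (R : realType) (E : set (R * R))
    (mu : probability (R * R)%type R) : Prop :=
  mu (~` E) = 0%E.

Definition robin_constant (R : realType) (E : set (R * R)) : \bar R :=
  ereal_inf [set log_energy mu | mu in supported_on E].

Definition capacity (R : realType) (E : set (R * R)) : \bar R :=
  expeR (- robin_constant E)%E.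

Definition is_equilibrium_measure (R : realType) (E : set (R * R))
    (mu : probability (R * R)%type R) : Prop :=
  supported_on E mu /\ log_energy mu = robin_constant E.

(* The component of the Riemann sphere minus E that contains infinity;
   [None] is the point at infinity of the one-point compactification. *)
Definition Omega_sphere (R : realType) (E : set (R * R)) :
    set (one_point_compactification (R * R)%type) :=
  connected_component
    (~` [set (Some z : one_point_compactification (R * R)%type) | z in E])
    (None : one_point_compactification (R * R)%type).

Definition Omega (R : realType) (E : set (R * R)) : set (R * R) :=
  [set z | Omega_sphere E (Some z)].

(* g_E(z, oo) on the whole plane, given the equilibrium measure mu of E *)
Definition green (R : realType) (E : set (R * R))
    (mu : probability (R * R)%type R) (z : R * R) : \bar R :=
  (robin_constant E - log_potential mu z)%E.

Definition discrete_energy (R : realType) (n : nat) (Z : 'I_n -> R * R) :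
    \bar R :=
  ((2 / (n%:R * (n%:R - 1)))%:E *
    \sum_(j < n) \sum_(k < n | (j < k)%N) log_kernel (Z j) (Z k))%E.

Definition m_green (R : realType) (E : set (R * R))
    (mu : probability (R * R)%type R) (n : nat) (Z : 'I_n -> R * R) : \bar R :=
  ((n%:R^-1)%:E * \sum_(k < n | Z k \in Omega E) green E mu (Z k))%E.

Definition modulus_of_continuity (R : realType) (phi : R * R -> R) (r : R) :
    \bar R :=
  ereal_sup [set `|phi p.1 - phi p.2|%:E |
    p in [set p : (R * R) * (R * R) | cdist p.1 p.2 <= r]].

Definition horizontal_slice (R : realType) (phi : R * R -> R) (y : R) : R -> R :=
  fun x => phi (x, y).

Definition vertical_slice (R : realType) (phi : R * R -> R) (x : R) : R -> R :=
  fun y => phi (x, y).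

Definition partial_x (R : realType) (phi : R * R -> R) (p : R * R) : R :=
  derive1 (horizontal_slice phi p.2) p.1.

Definition partial_y (R : realType) (phi : R * R -> R) (p : R * R) : R :=
  derive1 (vertical_slice phi p.1) p.2.

Definition partials_exist_ae (R : realType) (phi : R * R -> R) : Prop :=
  {ae (@lebesgue_measure R \x @lebesgue_measure R)%E, forall p : R * R,
    derivable (horizontal_slice phi p.2) p.1 1 /\
    derivable (vertical_slice phi p.1) p.2 1}.

Definition dirichlet_integral (R : realType) (phi : R * R -> R) : \bar R :=
  (\int[(@lebesgue_measure R \x @lebesgue_measure R)%E]_p
    (partial_x phi p ^+ 2 + partial_y phi p ^+ 2)%:E)%E.

Definition absolutely_continuous_on (R : realType) (a b : R) (f : R -> R) :
    Prop :=
  forall e : R, 0 < e -> exists2 d : R, 0 < d &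
    forall (m : nat) (s t : 'I_m -> R),
      (forall i, [/\ a <= s i, s i <= t i & t i <= b]) ->
      (forall i j, i != j -> t i <= s j \/ t j <= s i) ->
      \sum_(i < m) (t i - s i) < d ->
      \sum_(i < m) `|f (t i) - f (s i)| < e.

(* Absolute continuity on lines (Tonelli): this is what makes a finite
   Dirichlet integral, computed from the a.e. partial derivatives, control phi.
   Without it phi (x, y) = c x * c y, with c a compactly supported Cantor-type
   bump, would be nonzero with dirichlet_integral phi = 0. *)
Definition absolutely_continuous_on_lines (R : realType) (phi : R * R -> R) :
    Prop :=
  {ae @lebesgue_measure R, forall y : R, forall a b : R,
    absolutely_continuous_on a b (horizontal_slice phi y)} /\
  {ae @lebesgue_measure R, forall x : R, forall a b : R,
    absolutely_continuous_on a b (vertical_slice phi x)}.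

Definition dist_to (R : realType) (E : set (R * R)) (z : R * R) : R :=
  inf [set cdist z t | t in E].

(* green E mu is upper semicontinuous, so the maximum over this compact set is
   attained and equals the supremum. *)
Definition max_green (R : realType) (E : set (R * R))
    (mu : probability (R * R)%type R) (s : R) : \bar R :=
  ereal_sup [set green E mu z | z in [set z | dist_to E z <= s]].

(* Main.v *)
(** Replace every point z_k by the uniform measure on the vertices of a regular
    2^m-gon of radius r about z_k, with average nu, and log 1/|z - w| by
    - log (|z - w|^2 + c) / 2. The energy of nu - mu_E for this kernel is, up to
    changing c to 4 c in the mixed terms, (2 pi)^-1 times the squared L^2 norm
    of the difference of the fields u |-> \int (u - z) / (|u - z|^2 + c), so
    pairing that difference with the gradient of phi and applying
    Cauchy-Schwarz bounds \int phi d(nu - mu_E) by sqrt (D[phi] / (2 pi)) times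
    the square root of the energy, after a smoothing of phi that disappears as
    c tends to 0.

    In the energy, the product of the distances from w to the vertices of a
    polygon is explicit enough to show that distinct points interact at most as
    log 1/|z_j - z_k| and that each polygon has self-energy about - log r. The
    energy of mu_E is V_E. In the mixed terms, the mean of the equilibrium
    potential U over a polygon about z_k is nearly U(z_k) if z_k is at distance
    more than r from E, and otherwise at least V_E minus the maximum of the
    Green function within 2 r of E. By the maximum principle that lower bound
    also holds for U(z_k) when z_k lies outside Omega, while Frostman's
    inequality U <= V_E makes the Green function nonnegative on Omega. *)

Require Import Defs.
From HB Require Import structures.
From mathcomp Require Import all_boot all_order all_algebra.
From mathcomp Require Import all_classical all_reals all_analysis.
From mathcomp Require Import measurable_realfun ring lra.

Set Implicit Arguments.
Unset Strict Implicit.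
Unset Printing Implicit Defensive.

Import Order.TTheory GRing.Theory Num.Theory.
Import numFieldNormedType.Exports.

Local Open Scope classical_set_scope.
Local Open Scope ring_scope.

(** * Averages of the logarithm over the vertices of a polygon *)

(** The field of a point mass is not square integrable near the point without [c], and at infinity
    it decays only like 1/|u|, so single fields are never square integrable. The identity is
    therefore organised around [interaction], which is nonnegative and integrable over the plane, so
    that Tonelli's theorem asks for no finiteness. Its integral is not exactly a logarithm but, up
    to [2 * pi], lies between [ln (1 + s / c)] and [ln (4 + s / c)] with [s = |z - w|^2]: this is
    the origin of [4 * c]. The additive [ln c] cancels because both measures have mass 1.

    The constant [2 * pi] is the mass of [2 * c / (|u - z|^2 + c)^2], the divergence of the field.
    Polygons keep [nu] a finite sum of point masses, with errors divided by the number of vertices;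
    these errors blow up as [c] tends to 0, so [m] is chosen after [c]. Coinciding points make the
    right-hand side infinite unless [D[phi] = 0], a case argued separately since 0 times infinity is
    0. The maximum principles compare a value with those at four neighbours, after adding a small
    multiple of |z|^2. *)

Definition sqdist (R : realType) (z w : R * R) : R :=
  (z.1 - w.1) ^+ 2 + (z.2 - w.2) ^+ 2.

Definition smooth_log (R : realType) (c : R) (z w : R * R) : R :=
  - (ln (sqdist z w + c) / 2).

Definition polygon_angle (R : realType) (m i : nat) : R :=
  i%:R * (pi *+ 2 / 2 ^+ m).

Definition vertex (R : realType) (z : R * R) (r : R) (m i : nat) : R * R :=
  (z.1 + r * cos (polygon_angle R m i), z.2 + r * sin (polygon_angle R m i)).

Section polygon.
Variable R : realType.
Implicit Types (A B Q S r c : R) (z w : R * R).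

Lemma polygon_angleS m i : polygon_angle R m.+1 i *+ 2 = polygon_angle R m i.
Proof.
rewrite /polygon_angle exprS; field.
by rewrite expf_neq0.
Qed.

Lemma polygon_angle_half m i :
  polygon_angle R m.+1 (2 ^ m + i) = polygon_angle R m.+1 i + pi.
Proof.
rewrite /polygon_angle exprS natrD natrX; field.
by rewrite expf_neq0.
Qed.

(* Opposite vertices are paired, which halves the number of sides while
   squaring A and B. *)
Lemma prod_polygon m A B Q S : 0 <= B <= A ->
  Q ^+ 2 + S ^+ 2 = (2 * A * B) ^+ 2 ->
  (A ^+ (2 ^ m) - B ^+ (2 ^ m)) ^+ 2
  <= \prod_(0 <= i < 2 ^ m) (A ^+ 2 + B ^+ 2
       - Q * cos (polygon_angle R m i) - S * sin (polygon_angle R m i))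
  <= (A ^+ (2 ^ m) + B ^+ (2 ^ m)) ^+ 2.
Proof.
elim: m A B Q S => [|m IH] A B Q S /andP[B0 BA] QS.
  rewrite expn0 big_nat1 !expr1 /polygon_angle !mul0r cos0 sin0 mulr0 subr0 mulr1.
  have A0 : 0 <= A by lra.
  have QAB : `|Q| <= 2 * A * B.
    rewrite -(@ler_pXn2r _ 2) ?nnegrE ?mulr_ge0// real_normK ?num_real// -QS.
    by rewrite lerDl sqr_ge0.
  by move: QAB; rewrite ler_norml => /andP[h1 h2]; apply/andP; split; nra.
have A0 : 0 <= A by lra.
have BA2 : 0 <= B ^+ 2 <= A ^+ 2 by rewrite sqr_ge0/= ler_pXn2r ?nnegrE.
(* The factors of opposite vertices multiply to (A^2 + B^2)^2 - (Q cos t + S sin t)^2. By the double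
   angle formulas this is A^4 + B^4 - Q' cos 2t - S' sin 2t with Q' = (Q^2 - S^2) / 2 and S' = Q
   S. *)
have /IH : ((Q ^+ 2 - S ^+ 2) / 2) ^+ 2 + (Q * S) ^+ 2 = (2 * A ^+ 2 * B ^+ 2) ^+ 2.
  have -> : (2 * A ^+ 2 * B ^+ 2) ^+ 2 = ((2 * A * B) ^+ 2) ^+ 2 / 4.
    by field.
  by rewrite -QS; field.
have D (F : nat -> R) : \prod_(0 <= i < 2 ^ m.+1) F i =
    \prod_(0 <= i < 2 ^ m) (F i * F (2 ^ m + i)%N).
  rewrite expnS mul2n -addnn (@big_cat_nat _ _ _ (2 ^ m)%N) ?leq_addr//=.
  rewrite -{2}(add0n (2 ^ m)%N) big_addn addnK -big_split/=.
  by apply: eq_bigr => i _; rewrite addnC.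
move=> /(_ BA2); rewrite -!exprM -!expnS D.
set L := \prod_(0 <= i < 2 ^ m) _; set P := \prod_(0 <= i < _) _.
suff -> : P = L by [].
apply: eq_bigr => i _.
rewrite polygon_angle_half cosDpi sinDpi -(polygon_angleS m i).
rewrite cos_mulr2n sin_mulr2n.
set x := cos _; set y := sin _.
have xy : x ^+ 2 + y ^+ 2 = 1 by exact: cos2Dsin2.
apply/subr0_eq; transitivity
  (((2 * A * B) ^+ 2 - (Q ^+ 2 + S ^+ 2)) / 2 + S ^+ 2 * (1 - (x ^+ 2 + y ^+ 2))).
  by field.
by rewrite QS xy !subrr mul0r mulr0 addr0.
Qed.

Lemma sqdist_ge0 z w : 0 <= sqdist z w.
Proof. by rewrite addr_ge0 ?sqr_ge0. Qed.

Lemma sqdistC z w : sqdist z w = sqdist w z.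
Proof. by rewrite /sqdist -(sqrrN (z.1 - _)) -(sqrrN (z.2 - _)) !opprB. Qed.

Lemma cdistE z w : cdist z w = Num.sqrt (sqdist z w).
Proof. by []. Qed.

Lemma cdistC z w : cdist z w = cdist w z.
Proof. by rewrite !cdistE sqdistC. Qed.

Lemma cdist_ge0 z w : 0 <= cdist z w.
Proof. exact: sqrtr_ge0. Qed.

Lemma sqr_cdist z w : cdist z w ^+ 2 = sqdist z w.
Proof. by rewrite cdistE sqr_sqrtr// sqdist_ge0. Qed.

Lemma sqdist_eq0 z w : (sqdist z w == 0) = (z == w).
Proof.
rewrite paddr_eq0 ?sqr_ge0// !sqrf_eq0 !subr_eq0.
by case: z w => [? ?] [? ?]; rewrite xpair_eqE.
Qed.

Lemma cdist_gt0 z w : (0 < cdist z w) = (z != w).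
Proof. by rewrite sqrtr_gt0 lt_neqAle sqdist_ge0 eq_sym sqdist_eq0 andbT. Qed.

Lemma sqdist_vertex z r m i w : sqdist (vertex z r m i) w =
  sqdist z w + r ^+ 2 - (- 2 * r * (z.1 - w.1)) * cos (polygon_angle R m i)
                      - (- 2 * r * (z.2 - w.2)) * sin (polygon_angle R m i).
Proof.
rewrite /sqdist /vertex/=; set x := cos _; set y := sin _.
have xy : x ^+ 2 + y ^+ 2 = 1 by exact: cos2Dsin2.
apply/subr0_eq; transitivity (r ^+ 2 * (x ^+ 2 + y ^+ 2 - 1)); first by ring.
by rewrite xy subrr mulr0.
Qed.

Lemma cdist_vertex z r m i : 0 <= r -> cdist (vertex z r m i) z = r.
Proof.
move=> r0; rewrite cdistE sqdist_vertex !subrr !mulr0 !mul0r !subr0.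
have -> : sqdist z z = 0 by apply/eqP; rewrite sqdist_eq0.
by rewrite add0r sqrtr_sqr ger0_norm.
Qed.

(* The semi-axes of the ellipse with foci at distance r from the centre:
   [A ^+ 2 + B ^+ 2 - 2 * A * B * cos t] is the squared distance of a point of
   modulus a to the point of polar coordinates (r, t), plus c. *)
Lemma semi_axes (a r c : R) : 0 <= a -> 0 < r -> 0 <= c ->
  exists A, exists B, [/\ 0 <= B <= A, A ^+ 2 + B ^+ 2 = a ^+ 2 + r ^+ 2 + c,
    A * B = a * r, Num.max a r <= A <= Num.max a r + Num.sqrt c &
    Num.sqrt c <= A - B].
Proof.
move=> a0 r0 c0.
(* [u] and [v] are to be [A + B] and [A - B], since the two required equations amount to (A + B)^2 =
   (a + r)^2 + c and (A - B)^2 = (a - r)^2 + c. *)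
pose u := Num.sqrt ((a + r) ^+ 2 + c); pose v := Num.sqrt ((a - r) ^+ 2 + c).
have u2 : u ^+ 2 = (a + r) ^+ 2 + c by rewrite sqr_sqrtr// addr_ge0 ?sqr_ge0.
have v2 : v ^+ 2 = (a - r) ^+ 2 + c by rewrite sqr_sqrtr// addr_ge0 ?sqr_ge0.
have u0 : 0 <= u by exact: sqrtr_ge0.
have v0 : 0 <= v by exact: sqrtr_ge0.
have s0 := sqrtr_ge0 c; have s2 := sqr_sqrtr c0.
set s := Num.sqrt c in s0 s2 *.
have vu : v <= u by apply: ler_wsqrtr; nra.
have sv : s <= v by apply: ler_wsqrtr; rewrite lerDr sqr_ge0.
have uar : a + r <= u.
  by rewrite -(@ler_pXn2r _ 2) ?nnegrE ?u2 ?lerDl// addr_ge0// ltW.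
have us : u <= a + r + s.
  rewrite -(@ler_pXn2r _ 2) ?nnegrE ?u2 ?addr_ge0// ?(ltW r0)//.
  rewrite -s2 (sqrrD (a + r)) -addrA lerD2l lerDr mulrn_wge0// mulr_ge0//.
  by rewrite addr_ge0// ltW.
have vmr : `|a - r| <= v.
  by rewrite -(@ler_pXn2r _ 2) ?nnegrE ?v2 ?real_normK ?num_real ?lerDl.
have vs : v <= `|a - r| + s.
  rewrite -(@ler_pXn2r _ 2) ?nnegrE ?v2 ?addr_ge0// -s2 (sqrrD `|_|) real_normK ?num_real//.
  by rewrite -addrA lerD2l lerDr mulrn_wge0// mulr_ge0.
exists ((u + v) / 2), ((u - v) / 2); split.
- by apply/andP; split; lra.
- transitivity ((u ^+ 2 + v ^+ 2) / 2); first by field.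
  by rewrite u2 v2; field.
- transitivity ((u ^+ 2 - v ^+ 2) / 4); first by field.
  by rewrite u2 v2; field.
- have -> : Num.max a r = (a + r + `|a - r|) / 2 by rewrite maxr_absE.
  by apply/andP; split; lra.
- lra.
Qed.

(** Logarithm of [prod_polygon]: the squares in its bounds cancel the halving in [smooth_log], and
    the strict [B < A] keeps the lower bound of the product positive. *)
Lemma sum_smooth_log_vertex m z w r c A B : 0 <= B < A ->
  A ^+ 2 + B ^+ 2 = sqdist z w + r ^+ 2 + c ->
  A * B = cdist z w * r ->
  - ln (A ^+ (2 ^ m) + B ^+ (2 ^ m))
  <= \sum_(0 <= i < 2 ^ m) smooth_log c (vertex z r m i) w
  <= - ln (A ^+ (2 ^ m) - B ^+ (2 ^ m)).
Proof.
move=> /andP[B0 BA] AB2 AB; have A0 : 0 < A by lra.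
have BAle : 0 <= B <= A by rewrite B0 ltW.
pose f i := sqdist (vertex z r m i) w + c.
have QS : (- 2 * r * (z.1 - w.1)) ^+ 2 + (- 2 * r * (z.2 - w.2)) ^+ 2 =
    (2 * A * B) ^+ 2.
  rewrite -(mulrA 2) AB !exprMn sqr_cdist /sqdist; ring.
have N0 : (0 < 2 ^ m)%N by rewrite expn_gt0.
have BAN : B ^+ (2 ^ m) < A ^+ (2 ^ m) by rewrite ltr_pXn2r// nnegrE ltW.
have BN0 : 0 <= B ^+ (2 ^ m) by rewrite exprn_ge0.
have fE : \prod_(0 <= i < 2 ^ m) f i = \prod_(0 <= i < 2 ^ m)
    (A ^+ 2 + B ^+ 2 - - 2 * r * (z.1 - w.1) * cos (polygon_angle R m i) -
     - 2 * r * (z.2 - w.2) * sin (polygon_angle R m i)).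
  by apply: eq_bigr => i _; rewrite /f sqdist_vertex AB2; ring.
have f0 i : 0 < f i.
  rewrite /f sqdist_vertex.
  set x := cos _; set y := sin _.
  have xy : x ^+ 2 + y ^+ 2 = 1 by exact: cos2Dsin2.
  have h : `|- 2 * r * (z.1 - w.1) * x + - 2 * r * (z.2 - w.2) * y| <= 2 * A * B.
    rewrite -(@ler_pXn2r _ 2) ?nnegrE ?mulr_ge0 ?(ltW A0)// real_normK ?num_real//.
    rewrite -QS; set q := _ * (z.1 - w.1); set s := _ * (z.2 - w.2).
    rewrite -[leRHS]mulr1 -xy -subr_ge0.
    rewrite [leRHS](_ : _ = (q * y - s * x) ^+ 2) ?sqr_ge0//; ring.
  have : 0 < (A - B) ^+ 2 by rewrite exprn_gt0// subr_gt0.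
  move: h; rewrite ler_norml => /andP[_]; move: AB2; nra.
have sumE : \sum_(0 <= i < 2 ^ m) smooth_log c (vertex z r m i) w =
    - (ln (\prod_(0 <= i < 2 ^ m) f i) / 2).
  have : ln (\prod_(0 <= i < 2 ^ m) f i) = \sum_(0 <= i < 2 ^ m) ln (f i) /\
      0 < \prod_(0 <= i < 2 ^ m) f i.
    elim: (2 ^ m)%N => [|k [IH1 IH2]]; first by rewrite !big_nil ln1.
    by rewrite !big_nat_recr//= lnM ?posrE// IH1 mulr_gt0.
  by move=> [-> _]; rewrite mulr_suml -sumrN.
have ln2 (x : R) : 0 < x -> ln (x ^+ 2) / 2 = ln x.
  by move=> x0; rewrite lnXn// -(mulr_natr (ln x)) mulfK.
have /andP[h1 h2] := prod_polygon m BAle QS.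
have d0 : 0 < A ^+ (2 ^ m) - B ^+ (2 ^ m) by rewrite subr_gt0.
have p0 : 0 < \prod_(0 <= i < 2 ^ m) f i.
  by rewrite fE (lt_le_trans _ h1)// exprn_gt0.
have q0 : 0 < A ^+ (2 ^ m) + B ^+ (2 ^ m) by rewrite ltr_pwDl ?exprn_gt0.
rewrite sumE !lerN2 -(ln2 _ q0) -(ln2 _ d0).
by rewrite !ler_pM2r// !ler_ln ?posrE ?exprn_gt0// fE h1 h2.
Qed.

Definition polygon_mean m (f : nat -> R) : R :=
  (\sum_(0 <= i < 2 ^ m) f i) / 2 ^+ m.

(** [- ln (max |z - w| r)] is the potential of the uniform measure on the circle. With N = 2^m, the
    defect comes from A^N - B^N >= A^N (A - B) / A, where A - B >= sqrt c; the N-th root divides its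
    logarithm by 2^m. *)
Lemma polygon_mean_smooth_log_le m z w r c : 0 < r -> 0 < c ->
  polygon_mean m (fun i => smooth_log c (vertex z r m i) w)
  <= - ln (Num.max (cdist z w) r) +
     ln ((cdist z w + r + Num.sqrt c) / Num.sqrt c) / 2 ^+ m.
Proof.
move=> r0 c0; have a0 := cdist_ge0 z w.
have [A [B [BA AB2 AB /andP[A1 A2] AmB]]] := semi_axes a0 r0 (ltW c0).
have s0 : 0 < Num.sqrt c by rewrite sqrtr_gt0.
have B0 : 0 <= B < A by case/andP: BA => -> _; lra.
have A0 : 0 < A by case/andP: B0; lra.
have N0 : (0 : R) < 2 ^+ m by rewrite exprn_gt0.
have m0 : 0 < Num.max (cdist z w) r by rewrite lt_max r0 orbT.
rewrite sqr_cdist in AB2.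
have /andP[_ h] := sum_smooth_log_vertex m B0 AB2 AB.
rewrite /polygon_mean ler_pdivrMr// (le_trans h)// mulrDl divfK ?gt_eqF//.
have -> : 2 ^+ m = (2 ^ m)%:R :> R by rewrite natrX.
have : A ^+ (2 ^ m) * ((A - B) / A) <= A ^+ (2 ^ m) - B ^+ (2 ^ m).
  have [k ->] : exists k, (2 ^ m)%N = k.+1 by exists (2 ^ m).-1; rewrite prednK ?expn_gt0.
  case/andP: B0 => B0 BA'.
  have : B * B ^+ k <= B * A ^+ k by rewrite ler_wpM2l// lerXn2r ?nnegrE// ltW.
  have -> : A ^+ k.+1 * ((A - B) / A) = A ^+ k * (A - B).
    by rewrite exprS; field; rewrite gt_eqF.
  by rewrite !exprS; lra.
rewrite -ler_ln ?posrE; last 2 first.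
- by rewrite mulr_gt0 ?exprn_gt0// divr_gt0// subr_gt0; case/andP: B0.
- by rewrite subr_gt0 ltr_pXn2r ?nnegrE ?expn_gt0//; case/andP: B0 => // ? _; lra.
rewrite lnM ?posrE ?exprn_gt0//; last by rewrite divr_gt0// subr_gt0; case/andP: B0.
rewrite lnXn// -(mulr_natr (ln A)).
have h1 : ln (Num.max (cdist z w) r) <= ln A by rewrite ler_ln ?posrE.
have h2 : - ln ((cdist z w + r + Num.sqrt c) / Num.sqrt c) <= ln ((A - B) / A).
  have T0 : 0 < cdist z w + r + Num.sqrt c by rewrite -addrA ltr_wpDl// addr_gt0.
  have AB0 : 0 < A - B by rewrite (lt_le_trans s0).
  rewrite -lnV ?posrE ?divr_gt0// invf_div ler_ln ?posrE ?divr_gt0//.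
  apply: ler_pM => //; first by rewrite invr_ge0 ltW.
  rewrite lef_pV2 ?posrE// (le_trans A2)// lerD2r ge_max lerDl lerDr a0.
  by rewrite ltW.
have N1 : (0 : R) <= (2 ^ m)%:R by [].
by have := ler_wpM2r N1 h1; lra.
Qed.

(** Here A^N + B^N <= 2 A^N costs [ln 2 / 2 ^+ m], and A exceeds the maximum by at most sqrt c. *)
Lemma polygon_mean_smooth_log_ge m z w r c : 0 < r -> 0 < c ->
  - ln (Num.max (cdist z w) r + Num.sqrt c) - ln 2 / 2 ^+ m
  <= polygon_mean m (fun i => smooth_log c (vertex z r m i) w).
Proof.
move=> r0 c0; have a0 := cdist_ge0 z w.
have [A [B [BA AB2 AB /andP[A1 A2] AmB]]] := semi_axes a0 r0 (ltW c0).
have s0 : 0 < Num.sqrt c by rewrite sqrtr_gt0.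
have B0 : 0 <= B < A by case/andP: BA => -> _; lra.
have A0 : 0 < A by case/andP: B0; lra.
have N0 : (0 : R) < 2 ^+ m by rewrite exprn_gt0.
rewrite sqr_cdist in AB2.
have /andP[h _] := sum_smooth_log_vertex m B0 AB2 AB.
rewrite /polygon_mean ler_pdivlMr// (le_trans _ h)// mulrBl divfK ?gt_eqF//.
have -> : 2 ^+ m = (2 ^ m)%:R :> R by rewrite natrX.
have BAN : B ^+ (2 ^ m) <= A ^+ (2 ^ m).
  by rewrite lerXn2r ?nnegrE// ?(ltW A0)//; case/andP: BA.
have : A ^+ (2 ^ m) + B ^+ (2 ^ m) <= 2 * A ^+ (2 ^ m) by lra.
rewrite -ler_ln ?posrE ?mulr_gt0 ?exprn_gt0//; last first.
  by rewrite ltr_pwDl ?exprn_gt0 ?exprn_ge0//; case/andP: BA.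
rewrite lnM ?posrE ?exprn_gt0// lnXn// -mulr_natr.
have h1 : ln A <= ln (Num.max (cdist z w) r + Num.sqrt c).
  by rewrite ler_ln ?posrE// (lt_le_trans A0).
have N1 : (0 : R) <= (2 ^ m)%:R by [].
by have := ler_wpM2r N1 h1; lra.
Qed.

End polygon.

(** * The fundamental theorem of calculus for absolutely continuous functions *)

Section absolutely_continuous.
Variable R : realType.
Local Notation mu := (@lebesgue_measure R).
Implicit Types (f psi : R -> R) (a b : R).

Let partition_step_good (a c u v e hva hvc huc hua S I J : R) :
  hva <= hvc + huc + hua -> hvc <= e * (v - c) -> huc <= e * (c - u) ->
  hua <= e * (u - a) + S + I -> I <= J -> hva <= e * (v - a) + S + J.
Proof. by move=> *; lra. Qed.

Let partition_step_bad (hva hvu hua f S I J eu ev : R) :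
  hva <= hvu + hua -> hvu <= f + J -> hua <= eu + S + I ->
  eu <= ev -> hva <= ev + (f + S) + (I + J).
Proof. by move=> *; lra. Qed.

Lemma is_derive1_derive1 f (x l : R) :
  derivable f x 1 -> derive1 f x = l -> is_derive x (1 : R) f l.
Proof. by move=> df <-; apply: DeriveDef => //; rewrite derive1E. Qed.

Lemma is_derive1_cvg f (x l : R) : is_derive x (1 : R) f l ->
  (fun t => t^-1 *: (f (t + x) - f x)) @ 0^' --> l.
Proof.
move=> [df <-].
have -> : (fun t => t^-1 *: (f (t + x) - f x)) =
    (fun t => t^-1 *: ((f \o shift x) (t *: (1 : R)) - f x)).
  by apply/funext => t; rewrite /= [t%:A]mulr1.
exact: df.
Qed.

(** Form for ordered lists of intervals, because the partition argument adds its intervals one at a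
    time at the head of a list. *)
Lemma absolutely_continuous_onP a b f (e : R) : absolutely_continuous_on a b f ->
  0 < e -> exists2 d : R, 0 < d & forall l : seq (R * R),
    all (fun p => (a <= p.1) && (p.1 <= p.2) && (p.2 <= b)) l ->
    pairwise (fun p q => q.2 <= p.1) l ->
    \sum_(p <- l) (p.2 - p.1) < d -> \sum_(p <- l) `|f p.2 - f p.1| < e.
Proof.
move=> fAC e0; have [d d0 fd] := fAC e e0; exists d => // l lab lpw.
rewrite !(big_nth (0, 0)) !big_mkord => ld.
apply: (fd (size l) (fun i => (nth (0, 0) l i).1) (fun i => (nth (0, 0) l i).2)) => //.
- move=> i; have /(all_nthP (0, 0))/(_ i (ltn_ord i))/andP[/andP[? ?] ?] := lab.
  by split.
- move=> i j ij; have /(pairwiseP (0, 0)) H := lpw.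
  have := ij; rewrite neq_lt => /orP[] h; [right|left].
    by apply: H; rewrite ?inE.
  by apply: H; rewrite ?inE.
Qed.

Lemma le_Rintegral_subset psi (A B : set R) : measurable A -> measurable B ->
  A `<=` B -> mu.-integrable setT (EFin \o psi) ->
  (\int[mu]_(t in A) `|psi t| <= \int[mu]_(t in B) `|psi t|)%R.
Proof.
move=> mA mB AB ipsi.
have iA D : measurable D -> mu.-integrable D (EFin \o (fun t => `|psi t|)).
  move=> mD; apply: integrable_norm => //; exact: integrableS ipsi.
rewrite /Rintegral fine_le//; [exact: integrable_fin_num (iA _ _)..|].
apply: ge0_subset_integral => //.
by have /integrableP[] := iA _ mB.
Qed.

(* A partition argument in the style of Henstock and Kurzweil: the points where
   h := f - \int psi has derivative 0 contribute at most e * (b - a); the other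
   ones lie in an open set U of small measure, where absolute continuity of f
   and of the integral apply. *)
Lemma absolutely_continuous_FTC a b f psi : a < b ->
  absolutely_continuous_on a b f ->
  mu.-integrable setT (EFin \o psi) ->
  {ae mu, forall x : R, is_derive x (1 : R) f (psi x)} ->
  f b - f a = (\int[mu]_(t in `]a, b]) psi t)%R.
Proof.
move=> ab fAC ipsi fd.
pose F (x : R) := (\int[mu]_(t in `]-oo, x]) psi t)%R.
have isub (D : set R) : measurable D -> mu.-integrable D (EFin \o psi).
  by move=> mD; exact: integrableS ipsi.
have FE u v : u <= v -> F v - F u = (\int[mu]_(t in `]u, v]) psi t)%R.
  by move=> uv; rewrite /F Rintegral_itvB//; exact: isub.
have locpsi : locally_integrable setT psi.
  split; [|exact: openT|].
    by have /integrableP[/measurable_EFinP] := ipsi.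
  move=> K _ cK.
  have /integrableP[_] := isub _ (compact_measurable cK).
  by apply: le_lt_trans; rewrite le_eqVlt; apply/orP; left; apply/eqP.
(* Lebesgue differentiation: [F] has derivative [psi] almost everywhere, hence [h] has derivative 0
   almost everywhere. *)
have FT := FTC1Ny (fun y => isub `]-oo, y]%classic (measurable_itv _)) locpsi.
pose h x := f x - F x.
have hd : {ae mu, forall x : R, is_derive x (1 : R) h 0}.
  have aeF := ae_filter_ringOfSetsType mu.
  apply: filterS2 fd FT => x fx [dF F'].
  have dF' := is_derive1_derive1 dF F'.
  by have := is_deriveB fx dF'; rewrite subrr.
apply/eqP; rewrite -FE ?ltW// -subr_eq0.
have -> : f b - f a - (F b - F a) = h b - h a by rewrite /h; ring.
rewrite -normr_le0; apply/ler_addgt0Pr => e0 e0_gt0; rewrite add0r.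
(* The three terms are the contributions of the points where [h] has derivative 0, of the increments
   of [f] over intervals in [U], and of the integral of [|psi|] over [U]. *)
have [e [e_gt0 eb]] : exists e : R, 0 < e /\ e * (b - a) + e + e <= e0.
  exists (e0 / (b - a + 2)); split; first by rewrite divr_gt0//; lra.
  by rewrite le_eqVlt; apply/orP; left; apply/eqP; field; lra.
have [d1 d1_gt0 fd1] := absolutely_continuous_onP fAC e_gt0.
have [d2 [d2_gt0 pd2]] := integral_normr_continuous ipsi e_gt0.
have [N [mN N0 hN]] := hd.
pose N' := N `|` [set a; b].
have mN' : measurable N' by apply: measurableU => //; exact: measurableU.
have N'0 : mu N' = 0%E.
  have ab0 : mu [set a; b] = 0%E.
    by rewrite measureU0//; exact: lebesgue_measure_set1.
  by rewrite measureU0//; exact: measurableU.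
have d_gt0 : 0 < Num.min d1 d2 by rewrite lt_min d1_gt0.
have [|U [oU NU Ud]] := lebesgue_regularity_outer mN' _ d_gt0.
  by rewrite [X in (X < _)%E]N'0.
have mU : measurable U by exact: open_measurable.
have {}Ud : (mu U < (Num.min d1 d2)%:E)%E.
  rewrite (le_lt_trans _ Ud)// -{1}(setDUK NU) setUC measureU0//.
  exact: measurableD.
(* [l] records the partition intervals contained in [U]. Their total length is controlled by the
   measure of [U], so absolute continuity applies to [l] as soon as [P b] is known. *)
pose P (x : R) := a <= x <= b /\ exists l : seq (R * R),
  [/\ all (fun p => (a <= p.1) && (p.1 <= p.2) && (p.2 <= x)) l,
    pairwise (fun p q => q.2 <= p.1) l,
    ((\sum_(p <- l) (p.2 - p.1))%:E <= mu (U `&` `]a, x]))%E &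
    `|h x - h a| <= e * (x - a) + \sum_(p <- l) `|f p.2 - f p.1|
                    + (\int[mu]_(t in U `&` `]a, x]) `|psi t|)%R].
have Pa : P a.
  split; first by rewrite lexx ltW.
  exists [::]; split => //; rewrite ?big_nil// ?subrr ?normr0 ?mulr0 ?add0r ?addr0.
  exact: Rintegral_ge0.
have Pstep c u v : P u -> u <= c <= v -> v <= b ->
    ((forall x, x \in `[u, v] -> `|h x - h c| <= e * `|x - c|) \/ `[u, v] `<=` U) ->
    P v.
  move=> [/andP[au ub] [l [l1 l2 l3 l4]]] /andP[uc cv] vb.
  have uv : u <= v by exact: le_trans cv.
  have av : a <= v by exact: le_trans uv.
  move=> [good|bad]; (split; first by rewrite av).
    exists l; split => //.
    - apply: sub_all l1 => p /andP[-> pu]; exact: le_trans uv.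
    - rewrite (le_trans l3)// le_measure ?inE//; [exact: measurableI..|].
      by apply: setIS; apply: subset_itvl; rewrite bnd_simp.
    - have g1 := good u; have g2 := good v.
      have huc : `|h u - h c| <= e * (c - u).
        by rewrite -(ger0_norm (_ : 0 <= c - u)) ?subr_ge0// distrC (distrC c)
          distrC; apply: g1; rewrite in_itv/= lexx.
      have hvc : `|h v - h c| <= e * (v - c).
        by rewrite -(ger0_norm (_ : 0 <= v - c)) ?subr_ge0//; apply: g2; rewrite in_itv/= lexx andbT.
      have hva : `|h v - h a| <= `|h v - h c| + `|h u - h c| + `|h u - h a|.
        rewrite (distrC (h u) (h c)) (le_trans _ (lerD (ler_normD _ _) (lexx _)))//.
        rewrite (le_trans _ (ler_normD _ _))//.
        by have -> : h v - h c + (h c - h u) + (h u - h a) = h v - h a by ring.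
      have : (\int[mu]_(t in U `&` `]a, u]) `|psi t| <=
              \int[mu]_(t in U `&` `]a, v]) `|psi t|)%R.
        apply: le_Rintegral_subset => //; [exact: measurableI..|].
        by apply: setIS; apply: subset_itvl; rewrite bnd_simp.
      exact: (partition_step_good hva hvc huc l4).
  have UE : U `&` `]a, v]%classic = (U `&` `]a, u]) `|` `]u, v].
    apply/seteqP; split => [x [Ux]|x].
      rewrite /= !in_itv/= => /andP[ax xv].
      by case: (leP x u) => xu; [left; rewrite ax|right].
    move=> [[Ux]|]; rewrite /= !in_itv/= => /andP[ax xu].
      by split => //; rewrite ax (le_trans xu).
    split; last by rewrite xu (le_lt_trans au).
    by apply: bad; rewrite /= in_itv/= xu ltW.
  have dj : [disjoint (U `&` `]a, u]) & `]u, v]].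
    apply/disj_setPS => x [[_]] /=; rewrite !in_itv/= => /andP[_ xu] /andP[ux _].
    by move: (lt_le_trans ux xu); rewrite ltxx.
  exists ((u, v) :: l); split => //=.
  - by rewrite au uv lexx/=; apply: sub_all l1 => p /andP[-> pu]; exact: le_trans uv.
  - by rewrite l2 andbT; apply: sub_all l1 => p /andP[_ pu].
  - rewrite big_cons/= UE measureU//; [|exact: measurableI|exact/disj_set2P].
    rewrite EFinD addeC; apply: leeD => //.
    have -> : ((v - u)%:E = mu `]u, v]%classic)%E.
      rewrite lebesgue_measure_itv/= lte_fin.
      by case: ltP => // vu; rewrite (@le_anti _ _ u v) ?uv ?vu// subrr.
    exact: lexx.
  - rewrite big_cons UE/= Rintegral_setU//; last 2 first.
    + exact: measurableI.
    + apply: integrable_norm; apply: isub; apply: measurableU => //.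
      exact: measurableI.
    have huv : `|h v - h u| <= `|f v - f u| + (\int[mu]_(t in `]u, v]) `|psi t|)%R.
      have -> : h v - h u = (f v - f u) - (F v - F u) by rewrite /h; ring.
      rewrite (le_trans (ler_normB _ _))// lerD2l FE//.
      by apply: le_normr_Rintegral => //; exact: isub.
    have hva : `|h v - h a| <= `|h v - h u| + `|h u - h a|.
      rewrite (le_trans _ (ler_normD _ _))//.
      by have -> : h v - h u + (h u - h a) = h v - h a by ring.
    have euv : e * (u - a) <= e * (v - a) by rewrite ler_pM2l// lerD2r.
    exact: (partition_step_bad hva huv l4).
(* Induction along the segment: at the supremum [c] of the points satisfying [P], one of the two
   alternatives of [Pstep] holds on a neighbourhood of [c], which carries [P] beyond [c] unless [b]
   is reached. *)
have Pb : P b.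
  have Sub : has_sup [set x | P x].
    by split; [exists a|exists b => x [/andP[]]].
  pose c := sup [set x | P x].
  have ac : a <= c by apply: ub_le_sup => //; exact: Sub.2.
  have cb : c <= b by apply: ge_sup; [exists a|move=> x [/andP[]]].
  suff [g g0 gc] : exists2 g : R, 0 < g &
      (forall x, `|x - c| < g -> `|h x - h c| <= e * `|x - c|) \/
      (forall x, `|x - c| < g -> U x).
    have [u Pu cu] := sup_adherent g0 Sub.
    have uc : u <= c by apply: ub_le_sup => //; exact: Sub.2.
    pose v := Num.min b (c + g / 2).
    have cv : c <= v by rewrite le_min cb lerDl divr_ge0// ltW.
    have uvc x : x \in `[u, v] -> `|x - c| < g.
      rewrite in_itv/= le_min => /andP[ux /andP[_ xc]].
      rewrite -/c in cu; move: g0 cu ux xc; clear.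
      by move=> *; rewrite ltr_norml; apply/andP; split; lra.
    have Pv : P v.
      apply: (Pstep c u v) => //; [by rewrite uc|by rewrite ge_min lexx|].
      by case: gc => gc; [left|right] => x xuv; apply: gc; exact: uvc.
    have : v <= c by apply: ub_le_sup => //; exact: Sub.2.
    rewrite /v ge_min => /orP[bc|]; last by rewrite gerDl leNgt divr_gt0.
    suff <- : v = b by [].
    by apply/min_idPl; rewrite (le_trans bc)// lerDl divr_ge0// ltW.
  have [cN|cN] := pselect (N' c).
    have Uc : U c by exact: NU.
    have /nbhs_ballP[g g0 gU] := open_nbhs_nbhs (conj oU Uc).
    exists g => //; right => x xc; apply: gU.
    by rewrite /ball/= distrC.
  have hc : is_derive c (1 : R) h 0.
    apply: contrapT => nh; apply: cN; left; exact: hN.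
  have := is_derive1_cvg hc.
  move=> /cvgrPdist_lt/(_ _ e_gt0); rewrite near_withinE => /nbhs_ballP[g g0 gh].
  exists g => //; left => x xc.
  have [->|xNc] := eqVneq x c; first by rewrite !subrr normr0 mulr0.
  have := gh (x - c); rewrite /ball/= sub0r normrN => /(_ xc).
  rewrite subr_eq0 => /(_ xNc); rewrite subrK sub0r normrN normrZ normfV.
  by rewrite mulrC ltr_pdivrMr ?normr_gt0 ?subr_eq0// => /ltW.
have [_ [l [l1 l2 l3 l4]]] := Pb.
have Uab : (mu (U `&` `]a, b]) < (Num.min d1 d2)%:E)%E.
  rewrite (le_lt_trans _ Ud)// le_measure ?inE//; exact: measurableI.
have s1 : \sum_(p <- l) `|f p.2 - f p.1| < e.
  apply: fd1 => //; rewrite -lte_fin (le_lt_trans l3)// (lt_le_trans Uab)//.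
  by rewrite lee_fin ge_min lexx.
have s2 : (\int[mu]_(t in U `&` `]a, b]) `|psi t| < e)%R.
  apply: pd2; first exact: measurableI.
  by rewrite (lt_le_trans Uab)// lee_fin ge_min lexx orbT.
rewrite (le_trans l4)// (le_trans _ eb)//.
by apply: lerD; [apply: lerD => //; exact: ltW|exact: ltW].
Qed.

End absolutely_continuous.

(** * Integrals of rational functions over the plane *)

Section calculus.
Variable R : realType.
Local Notation mu := (@lebesgue_measure R).
Implicit Types (f g F : R -> R) (x c : R).

(** The differentiation rules are restated for explicit functions of a point, so that a derivative
    can be assembled as a term and its value compared with the expected one by [field]. *)
Lemma is_derive1_add f g x (df dg : R) :
  is_derive x (1 : R) f df -> is_derive x (1 : R) g dg ->
  is_derive x (1 : R) (fun y => f y + g y) (df + dg).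
Proof. by move=> hf hg; exact: is_deriveD. Qed.

Lemma is_derive1_mul f g x (df dg : R) :
  is_derive x (1 : R) f df -> is_derive x (1 : R) g dg ->
  is_derive x (1 : R) (fun y => f y * g y) (df * g x + f x * dg).
Proof.
move=> hf hg; have := is_deriveM hf hg; rewrite addrC.
by rewrite /GRing.scale/= (mulrC (g x)).
Qed.

Lemma is_derive1_inv f x (df : R) : f x != 0 ->
  is_derive x (1 : R) f df ->
  is_derive x (1 : R) (fun y => (f y)^-1) (- df / f x ^+ 2).
Proof.
move=> f0 hf; have := is_deriveV f0 hf.
by rewrite /GRing.scale/= mulNr mulNr mulrC.
Qed.

Lemma is_derive1_o f g x (df dg : R) :
  is_derive (g x) (1 : R) f df -> is_derive x (1 : R) g dg ->
  is_derive x (1 : R) (fun y => f (g y)) (df * dg).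
Proof. by move=> hf hg; exact: is_derive1_comp. Qed.

Lemma is_derive1_const x c : is_derive x (1 : R) (fun=> c) 0.
Proof. exact: is_derive_cst. Qed.

Lemma is_derive1_ident x : is_derive x (1 : R) (fun y => y) 1.
Proof. exact: is_derive_id. Qed.

Lemma is_derive1_subr x c : is_derive x (1 : R) (fun y => y - c) 1.
Proof.
rewrite -[X in is_derive _ _ _ X]addr0.
exact: is_derive1_add (is_derive1_ident x) (is_derive1_const x (- c)).
Qed.

Lemma is_derive1_sqrp x c : is_derive x (1 : R) (fun y => y ^+ 2 + c) (2 * x).
Proof.
have := is_derive1_add (is_derive1_mul (is_derive1_ident x) (is_derive1_ident x))
  (is_derive1_const x c).
by rewrite mul1r mulr1 addr0 -mulr2n mulr_natl.
Qed.

Lemma is_derive1_continuous f x (df : R) :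
  is_derive x (1 : R) f df -> {for x, continuous f}.
Proof.
move=> fd; apply: differentiable_continuous; apply/derivable1_diffP.
exact: (@ex_derive _ _ _ _ _ _ _ fd).
Qed.

Lemma is_derive1_cont f (df : R -> R) :
  (forall x, is_derive x (1 : R) f (df x)) -> continuous f.
Proof.
by move=> fd x; exact: is_derive1_continuous (fd x).
Qed.

Lemma FTC_segment f F a b : a <= b ->
  (forall x, a <= x <= b -> {for x, continuous f}) ->
  (forall x, a <= x <= b -> is_derive x (1 : R) F (f x)) ->
  (\int[mu]_(x in `[a, b]) (f x)%:E = (F b - F a)%:E)%E.
Proof.
rewrite le_eqVlt => /predU1P[<- _ _|ab cf Fd].
  by rewrite set_itv1 integral_set1 subrr.
have Fc x : a <= x <= b -> {for x, continuous F}.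
  move=> xab; apply: differentiable_continuous; apply/derivable1_diffP.
  exact: (@ex_derive _ _ _ _ _ _ _ (Fd x xab)).
rewrite (@continuous_FTC2 _ _ F)// ?EFinB//.
- by apply: continuous_in_subspaceT => x; rewrite inE/= in_itv/=; exact: cf.
- split.
  + move=> x; rewrite in_itv/= => /andP[/ltW ax /ltW xb].
    by apply: (@ex_derive _ _ _ _ _ _ _ (Fd x _)); rewrite ax.
  + by apply: cvg_at_right_filter; apply: Fc; rewrite lexx ltW.
  + by apply: cvg_at_left_filter; apply: Fc; rewrite lexx ltW.
- move=> x; rewrite in_itv/= => /andP[/ltW ax /ltW xb].
  by rewrite derive1E; apply: (@derive_val _ _ _ _ _ _ _ (Fd x _)); rewrite ax.
Qed.

Lemma FTC_line f F (l l' : R) : (forall x, 0 <= f x) -> continuous f ->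
  (forall x, is_derive x (1 : R) F (f x)) ->
  F x @[x --> +oo%R] --> l -> F x @[x --> -oo%R] --> l' ->
  (\int[mu]_x (f x)%:E = (l - l')%:E)%E.
Proof.
move=> f0 cf Fd Fl Fl'.
have mf : measurable_fun setT (EFin \o f).
  by apply/measurable_EFinP; exact: continuous_measurable_fun.
have half (h H : R -> R) (m : R) : (forall x, 0 <= h x) -> continuous h ->
    (forall x, is_derive x (1 : R) H (h x)) -> H x @[x --> +oo%R] --> m ->
    (\int[mu]_(x in `[0%R, +oo[) (h x)%:E = (m - H 0)%:E)%E.
  move=> h0 ch Hd Hm.
  rewrite (@ge0_continuous_FTC2y _ _ H _ m)// ?EFinB//.
  - exact: continuous_subspaceT.
  - by apply: cvg_at_right_filter; exact: (is_derive1_cont Hd).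
  - by move=> x _; rewrite derive1E; exact: (@derive_val _ _ _ _ _ _ _ (Hd x)).
have -> : [set: R] = `]-oo, 0%R[ `|` `[0%R, +oo[.
  by apply/seteqP; split=> x //= _; rewrite !in_itv/= andbT; case: ltP; [left|right].
rewrite ge0_integral_setU//=.
- have -> : (\int[mu]_(x in `]-oo, 0%R[) (f x)%:E = \int[mu]_(x in `]-oo, 0%R]) (f x)%:E)%E.
    by rewrite integral_itv_bndo_bndc//; exact: measurable_funTS.
  have -> : (\int[mu]_(x in `]-oo, 0%R]) (f x)%:E =
      \int[mu]_(x in `[0%R, +oo[) (f (- x))%:E)%E.
    rewrite (ge0_integration_by_substitution0 (f := fun x => (f (- x))%:E)).
    - by apply: eq_integral => x _; rewrite opprK.
    - by apply: (@measurableT_comp _ _ _ _ _ _ (EFin \o f)) => //; exact: oppr_measurable.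
    - by move=> r; rewrite lee_fin.
  have hN : (\int[mu]_(x in `[0%R, +oo[) (f (- x))%:E = (- l' - - F (- 0))%:E)%E.
    apply: (half (fun x => f (- x)) (fun x => - F (- x))) => [//|||].
    - by move=> x; apply: continuous_comp; [exact: opp_continuous|exact: cf].
    - move=> x; have := is_deriveN (is_derive1_o (Fd (- x)) (is_deriveNid x (1 : R))).
      by rewrite mulrN1 opprK.
    - by apply: cvgN; apply/(cvgNy_compNP F).
  rewrite hN (half f F l)// -EFinD oppr0; congr EFin; ring.
- by apply: measurable_funTS.
- by move=> x _; rewrite lee_fin.
- apply/disj_setPS => x [] /=; rewrite !in_itv/= andbT => x0 x1.
  by move: (lt_le_trans x0 x1); rewrite ltxx.
Qed.

End calculus.

Section line_integrals.
Variable R : realType.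
Local Notation mu := (@lebesgue_measure R).
Implicit Types (f F : R -> R) (m c l : R).

Lemma cvgy_subr m : x - m @[x --> +oo%R] --> +oo%R.
Proof.
apply/cvgryPge => A; near=> x; rewrite lerBrDr; near: x.
by apply: nbhs_pinfty_ge; exact: num_real.
Unshelve. all: by end_near. Qed.

Lemma cvgy_inv c : c * x^-1 @[x --> +oo%R] --> (0 : R).
Proof.
rewrite -[X in _ --> X](mulr0 c); apply: cvgM; first exact: cvg_cst.
by apply/gtr0_cvgV0 => //; near=> x; near: x; apply: nbhs_pinfty_gt; exact: num_real.
Unshelve. all: by end_near. Qed.

(** An odd antiderivative has opposite limits at the two infinities, so a single limit has to be
    computed. *)
Lemma FTC_line_odd f F l m : (forall x, 0 <= f x) -> continuous f ->
  (forall x, is_derive x (1 : R) F (f x)) -> (forall x, F (- x) = - F x) ->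
  F x @[x --> +oo%R] --> l ->
  (\int[mu]_x (f (x - m))%:E = (l *+ 2)%:E)%E.
Proof.
move=> f0 cf Fd Fodd Fl.
have -> : l *+ 2 = l - - l by rewrite opprK.
apply: (@FTC_line _ _ (fun x => F (x - m))) => //.
- move=> x; apply: continuous_comp; last exact: cf.
  by apply: (is_derive1_cont (df := fun=> 1)) => y; exact: is_derive1_subr.
- move=> x; rewrite -[f _]mulr1.
  exact: (is_derive1_o (Fd _) (is_derive1_subr x m)).
- exact: (cvg_comp (fun x => x - m) F (cvgy_subr m) Fl).
- apply/(cvgNy_compNP (fun x => F (x - m))).
  have -> : (fun x => F (x - m)) \o -%R = (fun x => - F (x - (- m))).
    by apply/funext => x /=; rewrite -Fodd; congr F; ring.
  by apply: cvgN; exact: (cvg_comp (fun x => x - - m) F (cvgy_subr (- m)) Fl).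
Qed.

Lemma continuous_sqrp_inv (k : R -> R) c : 0 < c -> continuous k ->
  (forall x, 0 < x -> 0 < k x) ->
  continuous (fun x : R => (k (x ^+ 2 + c))^-1).
Proof.
move=> c0 ck k0 x; apply: continuousV.
  by rewrite gt_eqF// k0// ltr_wpDl// sqr_ge0.
apply: continuous_comp; last exact: ck.
exact: (is_derive1_cont (fun y => is_derive1_sqrp y c)).
Qed.

Lemma integral_inv_sqr m c : 0 < c ->
  (\int[mu]_x ((((x - m) ^+ 2 + c) ^+ 2)^-1)%:E =
     (pi / (2 * (c * Num.sqrt c)))%:E)%E.
Proof.
move=> c0; pose s := Num.sqrt c.
have s0 : 0 < s by rewrite sqrtr_gt0.
have s2 : s ^+ 2 = c by rewrite sqr_sqrtr// ltW.
have p0 (x : R) : 0 < x ^+ 2 + c by rewrite ltr_wpDl// sqr_ge0.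
have p_neq0 (x : R) : x ^+ 2 + c != 0 by rewrite gt_eqF.
pose F (x : R) := x * (2 * c * (x ^+ 2 + c))^-1 + atan (x * s^-1) * (2 * c * s)^-1.
have -> : pi / (2 * (c * s)) = pi / 2 / (2 * c * s) *+ 2.
  by rewrite mulr2n; field; rewrite !gt_eqF.
apply: (@FTC_line_odd (fun x => ((x ^+ 2 + c) ^+ 2)^-1) F).
- by move=> x; rewrite invr_ge0 sqr_ge0.
- apply: (@continuous_sqrp_inv (fun x => x ^+ 2)) => //.
    exact: exprn_continuous.
  by move=> x x0; rewrite exprn_gt0.
- move=> x; apply: (@is_derive_eq _ _ _ _ _ _ _ _ (is_derive1_add
    (is_derive1_mul (is_derive1_ident x) (is_derive1_inv _
      (is_derive1_mul (is_derive1_const x (2 * c)) (is_derive1_sqrp x c))))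
    (is_derive1_mul (is_derive1_o (is_derive1_atan _)
       (is_derive1_mul (is_derive1_ident x) (is_derive1_const x s^-1)))
       (is_derive1_const x (2 * c * s)^-1)))).
    by rewrite mulf_neq0// ?gt_eqF// mulr_gt0.
  clear F; clearbody s; move: (p_neq0 x) (gt_eqF s0) (gt_eqF (p0 x)); rewrite -{}s2 => h1 h2 h3.
  by field; rewrite h1 h2 ?h3 ?addrC ?h1 ?h3.
- by move=> x; rewrite /F sqrrN !mulNr atanN mulNr opprD.
- rewrite -[X in _ --> X]add0r; apply: cvgD.
    apply: (@squeeze_cvgr _ _ _ _ (fun=> 0) (fun x => (2 * c)^-1 * x^-1)).
    + near=> x; have x0 : 0 < x by near: x; apply: nbhs_pinfty_gt; exact: num_real.
      apply/andP; split; first by rewrite mulr_ge0 ?invr_ge0// ?mulr_ge0// ltW// p0.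
      rewrite -subr_ge0 [leRHS](_ : _ = (2 * x * (x ^+ 2 + c))^-1).
        by rewrite invr_ge0 !mulr_ge0// ltW// p0.
      by field; rewrite !gt_eqF ?mulr_gt0// p0.
    + exact: cvg_cst.
    + exact: cvgy_inv.
  apply: cvgM; last exact: cvg_cst.
  apply: (cvg_comp (fun x => x * s^-1) atan _ (@cvgy_atan R)).
  apply: gt0_cvgMly; [|exact: cvg_id].
  by rewrite invr_gt0.
Unshelve. all: by end_near. Qed.

Lemma integral_inv_sqrt m c : 0 < c ->
  (\int[mu]_x ((((x - m) ^+ 2 + c) * Num.sqrt ((x - m) ^+ 2 + c))^-1)%:E =
     (2 / c)%:E)%E.
Proof.
move=> c0.
have p0 (x : R) : 0 < x ^+ 2 + c by rewrite ltr_wpDl// sqr_ge0.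
have q0 (x : R) : 0 < Num.sqrt (x ^+ 2 + c) by rewrite sqrtr_gt0.
have q2 (x : R) : Num.sqrt (x ^+ 2 + c) ^+ 2 = x ^+ 2 + c by rewrite sqr_sqrtr// ltW.
pose F (x : R) := c^-1 * (x * (Num.sqrt (x ^+ 2 + c))^-1).
have -> : 2 / c = c^-1 * 1 *+ 2 by rewrite mulr2n; field; rewrite gt_eqF.
apply: (@FTC_line_odd (fun x => ((x ^+ 2 + c) * Num.sqrt (x ^+ 2 + c))^-1) F).
- by move=> x; rewrite invr_ge0 mulr_ge0 ?sqrtr_ge0// ltW.
- apply: (@continuous_sqrp_inv (fun x => x * Num.sqrt x)) => //.
    by move=> x; apply: cvgM; [exact: cvg_id|exact: sqrt_continuous].
  by move=> x x0; rewrite mulr_gt0 ?sqrtr_gt0.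
- move=> x; have h : Num.sqrt (x ^+ 2 + c) != 0 by rewrite gt_eqF.
  have dsqrt : is_derive x (1 : R) (fun y => Num.sqrt (y ^+ 2 + c))
      ((2 * Num.sqrt (x ^+ 2 + c))^-1 * (2 * x)).
    by apply: is_derive1_o (is_derive1_sqrp x c); exact: is_derive1_sqrt.
  apply: (@is_derive_eq _ _ _ _ _ _ _ _ (is_derive1_mul (is_derive1_const x c^-1)
    (is_derive1_mul (is_derive1_ident x) (is_derive1_inv (f := fun y => Num.sqrt (y ^+ 2 + c)) h dsqrt)))).
  clear dsqrt; move: (q2 x) h; set q := Num.sqrt _ => q2x h.
  transitivity (c^-1 * ((q ^+ 2 - x ^+ 2) / (q ^+ 2 * q))).
    by field; rewrite h gt_eqF.
  by rewrite q2x addrAC subrr add0r -q2x; field; rewrite h gt_eqF.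
- by move=> x; rewrite /F sqrrN mulNr mulrN.
- apply: cvgM; first exact: cvg_cst.
  apply: (@squeeze_cvgr _ _ _ _ (fun x => 1 - c * x^-1) (fun=> 1)).
  + near=> x; have x1 : 1 < x by near: x; apply: nbhs_pinfty_gt; exact: num_real.
    have x0 : 0 < x by rewrite (lt_trans _ x1).
    have xq : x <= Num.sqrt (x ^+ 2 + c).
      by rewrite -(@ler_pXn2r _ 2) ?nnegrE ?(ltW x0) ?(ltW (q0 x))// q2 lerDl ltW.
    have v1 : x * (Num.sqrt (x ^+ 2 + c))^-1 <= 1 by rewrite ler_pdivrMr ?mul1r.
    have v0 : 0 <= x * (Num.sqrt (x ^+ 2 + c))^-1 by rewrite divr_ge0 ?ltW.
    rewrite v1 andbT.
    apply: (@le_trans _ _ ((x * (Num.sqrt (x ^+ 2 + c))^-1) ^+ 2)).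
      rewrite exprMn exprVn q2 -subr_ge0.
      rewrite [leRHS](_ : _ = c * (x ^+ 2 - x + c) / (x * (x ^+ 2 + c))).
        rewrite divr_ge0 ?mulr_ge0 ?ltW// addr_gt0// subr_gt0 expr2.
        by rewrite ltr_pMl.
      by field; rewrite !gt_eqF.
    by rewrite expr2 ler_piMr.
  + rewrite -[X in _ --> X]subr0; apply: cvgB; first exact: cvg_cst.
    exact: cvgy_inv.
  + exact: cvg_cst.
Unshelve. all: by end_near. Qed.

End line_integrals.

(** * Measurability and Lebesgue measure on the plane *)

Section plane_measurability.
Variable R : realType.

(** The sigma-algebra is generated by boxes, so [U] is exhibited as the countable union of the
    squares with rational centre and radius that it contains. *)
Lemma open_measurable_plane (U : set (R * R)) : open U -> measurable U.
Proof.
move=> oU.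
have -> : U = \bigcup_(a : rat) \bigcup_(b : rat) \bigcup_(e : rat)
    (if pselect (ball (ratr a : R) (ratr e) `*` ball (ratr b : R) (ratr e) `<=` U)
     then ball (ratr a : R) (ratr e) `*` ball (ratr b : R) (ratr e) else set0).
  apply/seteqP; split => [x Ux|x [a _ [b _ [e _]]]]; last first.
    by case: pselect => // abe; exact: abe.
  have /nbhs_ballP[e /= e0 eU] := open_nbhs_nbhs (conj oU Ux).
  (* A radius between e/4 and e/2 with a centre within e/4 of [x] gives a square that contains [x]
     and stays within 3e/4 of it. *)
  have [q3 /andP[]] := @rat_in_itvoo R (e / 4) (e / 2) ltac:(lra).
  have [q1 /andP[]] := @rat_in_itvoo R (x.1 - e / 4) (x.1 + e / 4) ltac:(lra).
  have [q2 /andP[]] := @rat_in_itvoo R (x.2 - e / 4) (x.2 + e / 4) ltac:(lra).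
  rewrite !bnd_simp => h1 h2 h3 h4 h5 h6.
  exists q1 => //; exists q2 => //; exists q3 => //.
  case: pselect => [inU|ninU]; last (exfalso; apply: ninU).
    by split; rewrite /ball/= ltr_norml; apply/andP; split; lra.
  move=> y [] /=; rewrite /ball/= !ltr_norml => /andP[k1 k2] /andP[k3 k4].
  by apply: eU; split; rewrite /ball/= ltr_norml; apply/andP; split; lra.
apply: bigcupT_measurable_rat => a; apply: bigcupT_measurable_rat => b.
apply: bigcupT_measurable_rat => e; case: pselect => [inU|ninU]; last exact: measurable0.
by apply: measurableX; exact: measurable_ball.
Qed.

Lemma continuous_measurable_plane (f : R * R -> R) :
  continuous f -> measurable_fun setT f.
Proof.
move=> cf; apply: (measurability _ (RGenOInfty.measurableE R)) => //.
move=> _ [_ [a ->] <-]; rewrite setTI; apply: open_measurable_plane.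
by move/continuousP : cf; apply; exact: interval_open.
Qed.

Context d (T : measurableType d).
Implicit Types (f g : T -> R * R).

Lemma measurable_sqdist f g : measurable_fun setT f -> measurable_fun setT g ->
  measurable_fun setT (fun x => sqdist (f x) (g x)).
Proof.
move=> mf mg; apply: measurable_funD; apply: measurable_funX;
  by apply: measurable_funB; apply: measurableT_comp.
Qed.

Lemma measurable_inv_gt0 (h : T -> R) : (forall x, 0 < h x) ->
  measurable_fun setT h -> measurable_fun setT (fun x => (h x)^-1).
Proof.
move=> h0 mh; have -> : (fun x => (h x)^-1) = (fun x => expR (- ln (h x))).
  by apply/funext => x; rewrite expRN lnK// posrE.
apply: measurableT_comp => //; apply: measurable_funN.
by apply: measurableT_comp => //; exact: measurable_ln.
Qed.

End plane_measurability.

(* The canonical sigma-finite structure of a product of measures is shadowed by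
   the one for products of subprobabilities, hence this alias. *)
Definition plane_measure (R : realType) :=
  (@lebesgue_measure R \x @lebesgue_measure R)%E.
Arguments plane_measure R : clear implicits.

HB.instance Definition _ (R : realType) := Measure.on (plane_measure R).

Lemma plane_measure_sigma_finite (R : realType) :
  sigma_finite setT (plane_measure R).
Proof.
have /sigma_finiteP[F [TF ndF Foo]] := sigma_finiteT (@lebesgue_measure R).
exists (fun n => F n `*` F n).
  rewrite -setXTT {1 2}TF predeqE => -[x y]; split.
    move=> [/= [n _ Fnx] [k _ Gky]]; exists (maxn n k) => //; split.
    - by move: x Fnx; exact/subsetPset/ndF/leq_maxl.
    - by move: y Gky; exact/subsetPset/ndF/leq_maxr.
  by move=> [n _ []/= ? ?]; split; exists n.
move=> k; have [? Fk] := Foo k.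
split; first exact: measurableX.
by rewrite /plane_measure product_measure1E// lte_mul_pinfty// ge0_fin_numE.
Qed.

HB.instance Definition _ (R : realType) :=
  Measure_isSigmaFinite.Build _ _ _ (plane_measure R)
    (@plane_measure_sigma_finite R).

(** * Integrals over the plane that define the energy kernel *)

Section energy_kernel.
Variable R : realType.
Local Notation mu := (@lebesgue_measure R).
Local Notation mu2 := (plane_measure R).
Implicit Types (z w m u : R * R) (c s : R).

(** Tonelli, one variable after the other. Consequently [2 * c / (|u - m|^2 + c)^2] has mass
    [2 * pi] for every [c], which makes it an approximate identity up to that factor. *)
Lemma integral_inv_sqdist m c : 0 < c ->
  (\int[mu2]_u (((sqdist u m + c) ^+ 2)^-1)%:E = (pi / c)%:E)%E.
Proof.
move=> c0.
have p0 u : 0 < (sqdist u m + c) ^+ 2.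
  by rewrite exprn_gt0// ltr_wpDl// sqdist_ge0.
rewrite /plane_measure fubini_tonelli1; last 2 first.
- apply/measurable_EFinP; apply: measurable_inv_gt0 => //.
  by apply: measurable_funX; apply: measurable_funD => //; exact: measurable_sqdist.
- by move=> u; rewrite lee_fin invr_ge0 ltW.
transitivity (\int[mu]_x ((pi / 2)%:E *
    (((x - m.1) ^+ 2 + c) * Num.sqrt ((x - m.1) ^+ 2 + c))^-1%:E))%E.
  apply: eq_integral => x _; rewrite /fubini_F.
  have q0 : 0 < (x - m.1) ^+ 2 + c by rewrite ltr_wpDl// sqr_ge0.
  transitivity (\int[mu]_y ((((y - m.2) ^+ 2 + ((x - m.1) ^+ 2 + c)) ^+ 2)^-1)%:E)%E.
    by apply: eq_integral => y _; rewrite /sqdist/= addrAC addrC.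
  rewrite integral_inv_sqr// -EFinM; congr EFin; field.
  by rewrite !gt_eqF// sqrtr_gt0.
rewrite ge0_integralZl//.
- by rewrite integral_inv_sqrt// -EFinM; congr EFin; field; rewrite gt_eqF.
- apply/measurable_EFinP; apply: measurable_inv_gt0.
    move=> x; have q0 : 0 < (x - m.1) ^+ 2 + c by rewrite ltr_wpDl// sqr_ge0.
    by rewrite mulr_gt0// sqrtr_gt0.
  have mq : measurable_fun setT (fun x : R => (x - m.1) ^+ 2 + c).
    by apply: measurable_funD => //; apply: measurable_funX; exact: measurable_funB.
  apply: measurable_funM => //; apply: measurableT_comp => //.
  by apply: continuous_measurable_fun; exact: sqrt_continuous.
- by move=> x _; rewrite lee_fin invr_ge0 mulr_ge0 ?sqrtr_ge0// addr_ge0 ?sqr_ge0 ?ltW.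
- by rewrite lee_fin divr_ge0// pi_ge0.
Qed.

(* Feynman's parametrization of 1 / (A B). *)
Lemma integral_feynman (A B : R) : 0 < A -> 0 < B ->
  (\int[mu]_(t in `[0%R, 1%R]) (((t * A + (1 - t) * B) ^+ 2)^-1)%:E = ((A * B)^-1)%:E)%E.
Proof.
move=> A0 B0.
have q0 (t : R) : 0 <= t <= 1 -> 0 < t * A + (1 - t) * B.
  move=> /andP[t0 t1]; have [->|tn0] := eqVneq t 0; first by rewrite mul0r add0r subr0 mul1r.
  by rewrite ltr_pwDl// ?mulr_gt0// ?lt_neqAle 1?eq_sym ?tn0// mulr_ge0 ?subr_ge0// ltW.
have dq (t : R) : is_derive t (1 : R) (fun t => t * A + (1 - t) * B) (A - B).
  have := is_derive1_add (is_derive1_mul (is_derive1_ident t) (is_derive1_const t A))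
    (is_derive1_mul (is_derive1_add (is_derive1_const t 1)
       (is_deriveN (is_derive1_ident t))) (is_derive1_const t B)).
  by rewrite mul1r !mulr0 !addr0 add0r mulN1r.
pose F (t : R) := t * (B * (t * A + (1 - t) * B))^-1.
have -> : (A * B)^-1 = F 1 - F 0.
  by rewrite /F mul0r !subr0 subrr mul0r addr0 !mul1r mulrC.
apply: (FTC_segment (f := fun t => ((t * A + (1 - t) * B) ^+ 2)^-1)) => //.
- move=> t /q0 qt; have q2 : (t * A + (1 - t) * B) ^+ 2 != 0 by rewrite gt_eqF// exprn_gt0.
  exact: is_derive1_continuous (is_derive1_inv
    (f := fun t => (t * A + (1 - t) * B) ^+ 2) q2 (is_derive1_mul (dq t) (dq t))).
- move=> t /q0 qt.
  have h : B * (t * A + (1 - t) * B) != 0 by rewrite gt_eqF// mulr_gt0.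
  apply: (@is_derive_eq _ _ _ _ _ _ _ _ (is_derive1_mul (is_derive1_ident t)
    (is_derive1_inv (f := fun t => B * (t * A + (1 - t) * B)) h
       (is_derive1_mul (is_derive1_const t B) (dq t))))).
  by field; rewrite !gt_eqF.
Qed.

(** For [s = |z - w|^2], this is 1/pi times the integral over [u] of the product of 1/(|u - z|^2 +
    c) and 1/(|u - w|^2 + c), after Feynman's parametrization. *)
Definition energy_param c s : R :=
  fine (\int[mu]_(t in `[0%R, 1%R]) ((t * (1 - t) * s + c)^-1)%:E)%E.

Lemma ln_le_subr1 (x : R) : 0 < x -> ln x <= x - 1.
Proof.
move=> x0; have -> : ln x = ln (1 + (x - 1)) by congr ln; ring.
by rewrite le_ln1Dx//; lra.
Qed.

(** Partial fractions: [(1 - r) / 2] and [(1 + r) / 2] are the roots in t of t (1 - t) s + c, and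
    both lie outside [0, 1]. *)
Let integral_energy_param c s : 0 < c -> 0 < s ->
  let r := Num.sqrt (1 + 4 * c / s) in
  (\int[mu]_(t in `[0%R, 1%R]) ((t * (1 - t) * s + c)^-1)%:E =
   (2 / (s * r) * ln ((r + 1) / (r - 1)))%:E)%E.
Proof.
move=> c0 s0 r.
have r2 : r ^+ 2 = 1 + 4 * c / s.
  by rewrite sqr_sqrtr// addr_ge0// divr_ge0 ?mulr_ge0// ltW.
have r1 : 1 < r.
  have : 1 < r ^+ 2 by rewrite r2 ltrDl divr_gt0// mulr_gt0.
  by rewrite -{1}(expr1n R 2) ltr_pXn2r ?nnegrE ?sqrtr_ge0.
have cE : c = s * (r ^+ 2 - 1) / 4 by rewrite r2; field; rewrite gt_eqF.
clearbody r.
pose F (t : R) := (s * r)^-1 * (ln (t - (1 - r) / 2) - ln ((1 + r) / 2 - t)).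
have -> : 2 / (s * r) * ln ((r + 1) / (r - 1)) = F 1 - F 0.
  rewrite /F.
  have -> : 1 - (1 - r) / 2 = (r + 1) / 2 by field.
  have -> : (1 + r) / 2 - 1 = (r - 1) / 2 by field.
  have -> : 0 - (1 - r) / 2 = (r - 1) / 2 by field.
  have -> : (1 + r) / 2 - 0 = (r + 1) / 2 by field.
  by rewrite !ln_div ?posrE//; lra.
have pos (t : R) : 0 <= t <= 1 -> 0 < t - (1 - r) / 2 /\ 0 < (1 + r) / 2 - t.
  by move=> /andP[t0 t1]; split; lra.
have qE (t : R) : t * (1 - t) * s + c = s * ((t - (1 - r) / 2) * ((1 + r) / 2 - t)).
  by rewrite cE; field.
apply: (FTC_segment (f := fun t => (t * (1 - t) * s + c)^-1)) => // t /pos[t1 t2].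
  have qt : t * (1 - t) * s + c != 0 by rewrite qE gt_eqF// !mulr_gt0.
  exact: is_derive1_continuous (is_derive1_inv (f := fun t => t * (1 - t) * s + c) qt
    (is_derive1_add (is_derive1_mul (is_derive1_mul (is_derive1_ident t)
      (is_derive1_add (is_derive1_const t 1) (is_deriveN (is_derive1_ident t))))
      (is_derive1_const t s)) (is_derive1_const t c))).
have d1 : is_derive t (1 : R) (fun t => ln (t - (1 - r) / 2)) ((t - (1 - r) / 2)^-1 * 1).
  apply: (is_derive1_o _ (is_derive1_subr t _)); exact: is_derive1_ln.
have d2 : is_derive t (1 : R) (fun t => ln ((1 + r) / 2 - t))
    (((1 + r) / 2 - t)^-1 * (0 + - 1)).
  apply: (is_derive1_o _ (is_derive1_add (is_derive1_const t _)
    (is_deriveN (is_derive1_ident t)))); exact: is_derive1_ln.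
apply: (@is_derive_eq _ _ _ _ _ _ _ _ (is_derive1_mul (is_derive1_const t _)
  (is_derive1_add d1 (is_deriveN d2)))).
rewrite qE mul0r add0r.
have : r = (t - (1 - r) / 2) + ((1 + r) / 2 - t) by field.
move: t1 t2; set u := t - _; set v := _ - t; move: u v => u v u0 v0 ->.
by field; rewrite !gt_eqF//; lra.
Qed.

(** In terms of X = (r + 1) / (r - 1) the three members are ln (X - 1 + 1/X), (X^2 + 1) / (X^2 - 1)
    ln X and ln ((X + 1)^2 / X). The first is at most ln X; the last comparison follows from ln X <=
    X - 1 and ln (X + 1) - ln X >= 1 / (X + 1). *)
Let energy_param_bound (r : R) : 1 < r ->
  ln (1 + 4 / (r ^+ 2 - 1)) <= (r ^+ 2 + 1) / (2 * r) * ln ((r + 1) / (r - 1))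
  <= ln (4 + 4 / (r ^+ 2 - 1)).
Proof.
move=> r1; have r0 : 0 < r - 1 by rewrite subr_gt0.
pose X := (r + 1) / (r - 1).
have X1 : 1 < X by rewrite /X ltr_pdivlMr// mul1r; lra.
have X0 : 0 < X by lra.
have rE : r = (X + 1) / (X - 1).
  by rewrite /X; field; rewrite gt_eqF//=; apply/eqP; lra.
have h1 : X - 1 != 0 by rewrite gt_eqF// subr_gt0.
have h2 : X != 0 by rewrite gt_eqF.
have h3 : X + 1 != 0 by rewrite gt_eqF//; lra.
have h4 : X ^+ 2 - 1 != 0 by rewrite subr_sqr_1 mulf_neq0.
have h5 : (r ^+ 2 - 1) != 0 by rewrite subr_sqr_1 mulf_neq0// gt_eqF//; lra.
have EE : 4 / (r ^+ 2 - 1) = X - 2 + X^-1.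
  by rewrite /X; field; rewrite !gt_eqF//; nra.
have KE : (r ^+ 2 + 1) / (2 * r) = (X ^+ 2 + 1) / (X ^+ 2 - 1).
  by rewrite /X; field; rewrite !gt_eqF//; nra.
rewrite -/X EE KE {EE KE rE h5}; clearbody X; clear r r1 r0.
have L0 : 0 < ln X by exact: ln_gt0.
have XX : 0 < X ^+ 2 - 1 by rewrite subr_gt0 exprn_egt1.
apply/andP; split.
  apply: (@le_trans _ _ (ln X)).
    have V1 : X^-1 < 1 by rewrite invf_lt1.
    have V0 : 0 < X^-1 by rewrite invr_gt0.
    by rewrite ler_ln ?posrE//; lra.
  by rewrite ler_peMl ?(ltW L0)// ler_pdivlMr// mul1r; lra.
have -> : 4 + (X - 2 + X^-1) = (X + 1) ^+ 2 / X by field.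
rewrite ln_div ?posrE ?exprn_gt0//; last lra.
rewrite lnXn; last lra.
have M1 : (X + 1)^-1 <= ln (X + 1) - ln X.
  have := @ln_le_subr1 (X / (X + 1)).
  rewrite divr_gt0//; last lra.
  rewrite ln_div ?posrE//; last lra.
  have -> : X / (X + 1) - 1 = - (X + 1)^-1 by field.
  by move=> /(_ isT); lra.
have L1 : ln X <= X - 1 by exact: ln_le_subr1.
rewrite mulrAC ler_pdivrMr//.
have : (X ^+ 2 - 1) * (X + 1)^-1 <= (X ^+ 2 - 1) * (ln (X + 1) - ln X).
  by rewrite ler_pM2l.
have -> : (X ^+ 2 - 1) / (X + 1) = X - 1 by field.
rewrite -mulr_natr; lra.
Qed.

(** The two logarithms are what confines the exact energy kernel between the smooth logarithms of
    parameters [c] and [4 * c]. *)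
Lemma energy_paramE c s : 0 < c -> 0 <= s ->
  (\int[mu]_(t in `[0%R, 1%R]) ((t * (1 - t) * s + c)^-1)%:E =
   (energy_param c s)%:E)%E /\
  ln (1 + s / c) <= (s + 2 * c) / 2 * energy_param c s <= ln (4 + s / c).
Proof.
move=> c0; rewrite le_eqVlt => /predU1P[<-|s0].
  have I : (\int[mu]_(t in `[0%R, 1%R]) ((t * (1 - t) * 0 + c)^-1)%:E = (c^-1)%:E)%E.
    under eq_integral do rewrite mulr0 add0r.
    have -> : c^-1 = 1 * c^-1 - 0 * c^-1 by rewrite mul1r mul0r subr0.
    apply: (FTC_segment (f := fun=> 1 * c^-1 - 0 * c^-1) (F := fun t => t * c^-1)) => //.
    - by move=> t _; exact: cvg_cst.
    - move=> t _; have := is_derive1_mul (is_derive1_ident t) (is_derive1_const t c^-1).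
      by rewrite !mul1r mulr0 mul0r addr0 subr0.
  rewrite /energy_param I/=; split => //.
  rewrite mul0r !addr0 ln1 add0r; have -> : 2 * c / 2 / c = 1 :> R.
    by field; rewrite gt_eqF.
  (* For s = 0 the middle member is 1, and 1 <= ln 4 follows from ln (1/2) <= - 1/2. *)
  rewrite ler01/=; have -> : 4 = 2^-1 ^- 2 :> R by field.
  rewrite lnV ?posrE ?exprn_gt0// lnXn//.
  have : ln 2^-1 <= 2^-1 - 1 :> R by apply: ln_le_subr1; rewrite invr_gt0.
  by rewrite -(mulr_natr (ln _)); lra.
have I := integral_energy_param c0 s0; rewrite /= in I.
rewrite /energy_param I/=; split => //.
set r := Num.sqrt _.
have r2 : r ^+ 2 = 1 + 4 * c / s.
  by rewrite sqr_sqrtr// addr_ge0// divr_ge0 ?mulr_ge0// ltW.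
have r1 : 1 < r.
  have : 1 < r ^+ 2 by rewrite r2 ltrDl divr_gt0// mulr_gt0.
  by rewrite -{1}(expr1n R 2) ltr_pXn2r ?nnegrE ?sqrtr_ge0.
have h := energy_param_bound r1; clearbody r.
have scE : s / c = 4 / (r ^+ 2 - 1).
  by rewrite r2 addrAC subrr add0r; field; rewrite !gt_eqF.
have -> : (s + 2 * c) / 2 * (2 / (s * r) * ln ((r + 1) / (r - 1))) =
    (r ^+ 2 + 1) / (2 * r) * ln ((r + 1) / (r - 1)).
  by rewrite r2; field; rewrite !gt_eqF//; lra.
by rewrite scE.
Qed.

(** Completing the square, t |u - z|^2 + (1 - t) |u - w|^2 = |u - m|^2 + t (1 - t) |z - w|^2 with m
    = t z + (1 - t) w. After an exchange of integrals the one over [u] is thus given by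
    [integral_inv_sqdist]. *)
Lemma integral_energy_kernel z w c : 0 < c ->
  (\int[mu2]_u (((sqdist u z + c) * (sqdist u w + c))^-1)%:E =
   (pi * energy_param c (sqdist z w))%:E)%E.
Proof.
move=> c0.
(* The maximum with [c] changes nothing for t in [0, 1] but keeps the denominator positive for all
   t, so that the integrand is measurable on the whole product. *)
pose Q (p : (R * R) * R) := Num.max c
  (p.2 * (sqdist p.1 z + c) + (1 - p.2) * (sqdist p.1 w + c)).
pose f (p : (R * R) * R) : \bar R := ((Q p ^+ 2)^-1 * \1_(`[0%R, 1%R]) p.2)%:E.
have mf : measurable_fun setT f.
  apply/measurable_EFinP; apply: measurable_funM.
    apply: measurable_inv_gt0.
      by move=> p; rewrite exprn_gt0// lt_max c0.
    apply: measurable_funX; apply: measurable_maxr => //.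
    apply: measurable_funD; apply: measurable_funM => //.
    + by apply: measurable_funD => //; exact: measurable_sqdist.
    + exact: measurable_funB.
    + by apply: measurable_funD => //; exact: measurable_sqdist.
  by apply: measurableT_comp => //; exact: measurable_indic.
have f0 p : (0 <= f p)%E.
  by rewrite lee_fin mulr_ge0// ?indicE// invr_ge0 sqr_ge0.
have p0 u v : 0 < sqdist u v + c by rewrite ltr_wpDl// sqdist_ge0.
have fE (g : R -> R) : (\int[mu]_(t in `[0%R, 1%R]) (g t)%:E =
    \int[mu]_t (g t * \1_(`[0%R, 1%R]) t)%:E)%E.
  rewrite integral_mkcond; apply: eq_integral => t _.
  by rewrite patchE indicE; case: ifP; rewrite ?mulr1 ?mulr0.
have QE u t : 0 <= t <= 1 -> Q (u, t) = t * (sqdist u z + c) + (1 - t) * (sqdist u w + c).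
  move=> /andP[t0 t1]; apply/max_idPr => /=.
  have := mulr_ge0 t0 (sqdist_ge0 u z).
  have := mulr_ge0 (_ : 0 <= 1 - t) (sqdist_ge0 u w).
  by rewrite subr_ge0 => /(_ t1); lra.
transitivity (\int[mu2]_u \int[mu]_t f (u, t))%E.
  apply: eq_integral => u _; rewrite -integral_feynman// fE.
  apply: eq_integral => t _; rewrite /f/= !indicE.
  have [|_] := boolP (t \in _); last by rewrite !mulr0.
  by rewrite inE/= in_itv/= => /QE ->.
rewrite (fubini_tonelli (m1 := mu2) (m2 := mu) f)//.
transitivity (\int[mu]_(t in `[0%R, 1%R]) (pi%:E * ((t * (1 - t) * sqdist z w + c)^-1)%:E))%E.
  under [RHS]eq_integral do rewrite -EFinM.
  rewrite fE; apply: eq_integral => t _.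
  rewrite /f/= indicE; have [|_] := boolP (t \in _); last first.
    by rewrite mulr0; under eq_integral do rewrite mulr0; rewrite integral0.
  rewrite inE/= in_itv/= => t01; rewrite mulr1.
  have k0 : 0 < t * (1 - t) * sqdist z w + c.
    rewrite ltr_wpDl// mulr_ge0 ?sqdist_ge0//.
    by case/andP: t01 => ? ?; rewrite mulr_ge0// subr_ge0.
  rewrite -(integral_inv_sqdist (t * z.1 + (1 - t) * w.1, t * z.2 + (1 - t) * w.2) k0).
  apply: eq_integral => u _; rewrite mulr1 QE//; congr (EFin (_ ^- 2)).
  by rewrite /sqdist/=; ring.
have [I _] := energy_paramE c0 (sqdist_ge0 z w).
rewrite ge0_integralZl//.
- by rewrite I -EFinM.
- apply: (eq_measurable_fun
    (fun t : R => ((Num.max c (t * (1 - t) * sqdist z w + c))^-1)%:E)).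
    move=> t; rewrite inE/= in_itv/= => /andP[t0 t1]; congr (EFin _^-1).
    apply/max_idPr; rewrite lerDr !mulr_ge0 ?sqdist_ge0// subr_ge0//.
  apply: measurable_funTS; apply/measurable_EFinP; apply: measurable_inv_gt0.
    by move=> t; rewrite lt_max c0.
  apply: measurable_maxr => //; apply: measurable_funD => //.
  apply: measurable_funM => //; apply: measurable_funM => //; exact: measurable_funB.
- move=> t /=; rewrite in_itv/= => /andP[t0 t1].
  by rewrite lee_fin invr_ge0 addr_ge0 ?(ltW c0)// !mulr_ge0 ?sqdist_ge0// subr_ge0.
- by rewrite lee_fin pi_ge0.
Qed.

End energy_kernel.

(** * Integration by parts for functions absolutely continuous on lines *)

Lemma integrable_mul_bounded d (T : measurableType d) (R : realType)
    (m : {measure set T -> \bar R}) (f g : T -> R) (M : R) :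
  m.-integrable setT (EFin \o f) -> measurable_fun setT g ->
  (forall x, `|g x| <= M) -> m.-integrable setT (fun x => (f x * g x)%:E).
Proof.
move=> fi mg gM.
have M0 : 0 <= M by rewrite (le_trans _ (gM point)).
apply: (le_integrable measurableT _ _ (integrableZl measurableT M fi)).
  apply/measurable_EFinP; apply: measurable_funM => //.
  by have /integrableP[/measurable_EFinP] := fi.
move=> x _; rewrite -EFinM !abse_EFin lee_fin !normrM mulrC.
by rewrite ler_wpM2r// (le_trans (gM x))// ler_norm.
Qed.

Section integration_by_parts_on_lines.
Variable R : realType.
Local Notation mu := (@lebesgue_measure R).
Implicit Types (f g psi : R -> R).

Lemma is_derive_bounded_lipschitz g (dg : R -> R) (L : R) :
  (forall x, is_derive x (1 : R) g (dg x)) -> (forall x, `|dg x| <= L) ->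
  forall x y, `|g y - g x| <= L * `|y - x|.
Proof.
move=> gd gL x y; wlog xy : x y / x <= y.
  move=> H; have [|/ltW] := leP x y; first exact: H.
  by move=> /H; rewrite distrC (distrC x).
have [] := @MVT_segment R g dg x y xy.
- by apply: continuous_subspaceT; exact: is_derive1_cont gd.
- by move=> t _ ->; rewrite normrM ler_wpM2r.
Qed.

Lemma absolutely_continuous_mul_lipschitz a b f g (M L : R) :
  absolutely_continuous_on a b f -> (forall x, `|f x| <= M) ->
  (forall x, `|g x| <= M) -> (forall x y, `|g y - g x| <= L * `|y - x|) ->
  absolutely_continuous_on a b (fun x => f x * g x).
Proof.
move=> fAC fM gM gL e e0.
have M0 : 0 <= M by rewrite (le_trans _ (fM 0)).
have L0 : 0 <= L.
  by have := gL 0 1; rewrite subr0 normr1 mulr1; apply: le_trans.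
have e1 : 0 < e / (2 * (M + 1)) by rewrite divr_gt0// mulr_gt0// ltr_wpDl.
have [d d0 fd] := fAC _ e1.
have d1 : 0 < e / (2 * (M * L + 1)) by rewrite divr_gt0// mulr_gt0// ltr_wpDl// mulr_ge0.
exists (Num.min d (e / (2 * (M * L + 1)))); first by rewrite lt_min d0.
move=> m s t st stD; rewrite lt_min => /andP[/(fd _ s t st stD) s1 s2].
have h i : `|f (t i) * g (t i) - f (s i) * g (s i)| <=
    M * `|f (t i) - f (s i)| + M * L * (t i - s i).
  have [_ sti _] := st i.
  have -> : f (t i) * g (t i) - f (s i) * g (s i) =
    (f (t i) - f (s i)) * g (t i) + f (s i) * (g (t i) - g (s i)) by ring.
  rewrite (le_trans (ler_normD _ _))// !normrM lerD//.
    by rewrite mulrC ler_wpM2r.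
  rewrite -mulrA ler_pM//.
  by rewrite (le_trans (gL _ _))// ger0_norm// subr_ge0.
apply: le_lt_trans (ler_sum _ (fun i _ => h i)) _.
rewrite big_split/= -!mulr_sumr.
have E1 : M * \sum_(i < m) `|f (t i) - f (s i)| <= e / 2.
  have : (M + 1) * \sum_(i < m) `|f (t i) - f (s i)| < e / 2.
    rewrite -ltr_pdivlMl ?ltr_wpDl//.
    by have -> : (M + 1)^-1 * (e / 2) = e / (2 * (M + 1)) by
      field; rewrite gt_eqF// ltr_wpDl.
  have : 0 <= \sum_(i < m) `|f (t i) - f (s i)| by rewrite sumr_ge0.
  nra.
have E2 : M * L * \sum_(i < m) (t i - s i) < e / 2.
  have ML := mulr_ge0 M0 L0.
  have : (M * L + 1) * \sum_(i < m) (t i - s i) < e / 2.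
    rewrite -ltr_pdivlMl ?ltr_wpDl//.
    by have -> : (M * L + 1)^-1 * (e / 2) = e / (2 * (M * L + 1)) by
      field; rewrite gt_eqF// ltr_wpDl.
  have : 0 <= \sum_(i < m) (t i - s i).
    by rewrite sumr_ge0// => i _; have [_ ? _] := st i; rewrite subr_ge0.
  nra.
lra.
Qed.

(** The product f g is absolutely continuous with almost everywhere derivative psi g + f dg, and it
    vanishes at both ends of a segment that contains the support. *)
Lemma integration_by_parts_line f g psi dg (B M : R) :
  continuous f -> (forall a b, absolutely_continuous_on a b f) ->
  (forall x, B <= `|x| -> f x = 0) -> (forall x, B <= `|x| -> psi x = 0) ->
  mu.-integrable setT (EFin \o psi) ->
  {ae mu, forall x : R, is_derive x (1 : R) f (psi x)} ->
  (forall x, is_derive x (1 : R) g (dg x)) -> continuous dg ->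
  (forall x, `|f x| <= M) -> (forall x, `|g x| <= M) -> (forall x, `|dg x| <= M) ->
  (\int[mu]_x (psi x * g x + f x * dg x)%:E = 0)%E.
Proof.
move=> cf fAC fB psiB ipsi fd gd cdg fM gM dgM.
have cg := is_derive1_cont gd.
pose h x := psi x * g x + f x * dg x.
pose B1 := `|B| + 1.
have BB1 (x : R) : B1 <= `|x| -> B <= `|x|.
  by apply: le_trans; rewrite (le_trans (ler_norm B))// lerDl.
have M0 : 0 <= M by rewrite (le_trans _ (fM 0)).
have ih : mu.-integrable setT (EFin \o h).
  have -> : EFin \o h = (fun x => (psi x * g x)%:E + (f x * dg x)%:E)%E.
    by apply/funext => x; rewrite /h /= EFinD.
  apply: integrableD => //.
    exact: integrable_mul_bounded ipsi (continuous_measurable_fun cg) gM.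
  have -> : (fun x => (f x * dg x)%:E) = EFin \o ((fun x => f x * dg x) \_ `[(- B1), B1]).
    apply/funext => x /=; rewrite patchE; case: ifPn => //.
    rewrite notin_setE/= in_itv/= => /negP; rewrite -ler_norml -ltNge => /ltW xB.
    by rewrite fB ?mul0r//; exact: BB1.
  rewrite -restrict_EFin; apply/integrable_restrict => //; rewrite setTI.
  apply: continuous_compact_integrable; first exact: segment_compact.
  by apply: continuous_subspaceT => x; apply: cvgM; [exact: cf|exact: cdg].
have hd : {ae mu, forall x : R, is_derive x (1 : R) (fun x => f x * g x) (h x)}.
  have aeF := ae_filter_ringOfSetsType mu.
  by apply: filterS fd => x fx; exact: is_derive1_mul fx (gd x).
have gL := is_derive_bounded_lipschitz gd dgM.
have fgAC := absolutely_continuous_mul_lipschitz (fAC (- B1) B1) fM gM gL.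
have B1_gt0 : 0 < B1 by rewrite /B1 ltr_wpDl.
have NB1 : - B1 < B1 by rewrite gtrN.
have := absolutely_continuous_FTC NB1 fgAC ih hd.
rewrite !fB ?mul0r ?subr0; last 2 first.
- by apply: BB1; rewrite normrN ger0_norm// ltW.
- by apply: BB1; rewrite ger0_norm// ltW.
rewrite /Rintegral => I0.
have -> : (\int[mu]_x (psi x * g x + f x * dg x)%:E =
    \int[mu]_(x in `](- B1)%R, B1]) (h x)%:E)%E.
  rewrite [RHS]integral_mkcond; apply: eq_integral => x _.
  rewrite patchE; case: ifPn => //; rewrite notin_setE/= in_itv/= => /negP xB.
  have Bx : B <= `|x|.
    apply: BB1; rewrite leNgt; apply: contra xB.
    by rewrite ltr_norml => /andP[-> /ltW].
  by rewrite fB// psiB// !mul0r addr0.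
rewrite -[LHS]fineK -?I0//; apply: integrable_fin_num => //.
exact: integrableS ih.
Qed.

End integration_by_parts_on_lines.

Section almost_everywhere_sections.
Context d1 d2 (T1 : measurableType d1) (T2 : measurableType d2) (R : realType).
Variables (m1 : {sigma_finite_measure set T1 -> \bar R})
  (m2 : {sigma_finite_measure set T2 -> \bar R}).

Let ae_sections (d d' : measure_display) (T : measurableType d)
    (T' : measurableType d') (m : {sigma_finite_measure set T -> \bar R})
    (m' : {measure set T' -> \bar R}) (N : T -> set T') :
  (forall x, measurable (N x)) -> measurable_fun setT (fun x => m' (N x)) ->
  (\int[m]_x m' (N x) = 0)%E ->
  {ae m, forall x, m'.-negligible (N x)}.
Proof.
move=> mN mf i0.
have /(ae_eq_integral_abs _ measurableT mf) : (\int[m]_x `|m' (N x)| = 0)%E.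
  by rewrite -[RHS]i0; apply: eq_integral => x _; rewrite gee0_abs.
have aeF := ae_filter_ringOfSetsType m.
by apply: filterS => x /(_ I) h; apply/negligibleP.
Qed.

Lemma ae_xsection (P : T1 * T2 -> Prop) :
  {ae (m1 \x m2)%E, forall p, P p} ->
  {ae m1, forall x, {ae m2, forall y, P (x, y)}}.
Proof.
move=> [N [mN N0 PN]].
have aeF := ae_filter_ringOfSetsType m1.
have : {ae m1, forall x, m2.-negligible (xsection N x)}.
  apply: (ae_sections (fun x => measurable_xsection x mN)).
    exact: measurable_fun_xsection.
  exact: N0.
apply: filterS => x; apply: negligibleS => y /= nP.
by apply/xsectionP/PN.
Qed.

Lemma ae_ysection (P : T1 * T2 -> Prop) :
  {ae (m1 \x m2)%E, forall p, P p} ->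
  {ae m2, forall y, {ae m1, forall x, P (x, y)}}.
Proof.
move=> [N [mN N0 PN]].
have aeF := ae_filter_ringOfSetsType m2.
have : {ae m2, forall y, m1.-negligible (ysection N y)}.
  apply: (ae_sections (fun y => measurable_ysection y mN)).
    exact: measurable_fun_ysection.
  rewrite -[RHS]N0; apply/esym.
  rewrite (@product_measure_unique _ _ _ _ _ m1 m2 (m1 \x^ m2)%E)// => A B mA mB.
  exact: product_measure2E.
apply: filterS => y; apply: negligibleS => x /= nP.
by apply/ysectionP/PN.
Qed.

End almost_everywhere_sections.

(** The integral of a nonnegative function is a supremum over the simple functions below it, so
    monotonicity requires no measurability. This matters for [dirichlet_integral], whose integrand
    is not known to be measurable. *)
Lemma le_lower_integral d (T : measurableType d) (R : realType)
    (m : {measure set T -> \bar R}) (f g : T -> \bar R) :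
  (forall x, 0 <= f x)%E -> (forall x, f x <= g x)%E ->
  (\int[m]_x f x <= \int[m]_x g x)%E.
Proof.
move=> f0 fg; have g0 x : (0 <= g x)%E by exact: le_trans (fg x).
rewrite !ge0_integralTE//; apply: le_ereal_sup => _ [h hf <-].
by exists h => // x; exact: le_trans (fg x).
Qed.

(** * Measurable partial derivatives and integration by parts in the plane *)

Section weak_partial_derivatives.
Variable R : realType.
Local Notation mu := (@lebesgue_measure R).
Local Notation mu2 := (plane_measure R).
Implicit Types (phi : R * R -> R) (e p : R * R).

Lemma plane_measure_square (b : R) : (mu2 (`[(- b)%R, b] `*` `[(- b)%R, b])%classic < +oo)%E.
Proof.
have -> : mu2 (`[(- b)%R, b] `*` `[(- b)%R, b])%classic = (mu `[(- b)%R, b] * mu `[(- b)%R, b])%E.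
  by apply: product_measure1E; exact: measurable_itv.
have mlt : (mu `[(- b)%R, b] < +oo)%E.
  by rewrite lebesgue_measure_itv/=; case: ifP; rewrite ?ltry.
by rewrite lte_mul_pinfty// ge0_fin_numE.
Qed.

(* A measurable function that equals the directional derivative wherever the
   latter exists: the partial derivatives of the statement are defined through
   [lim] and need not be measurable. *)
Definition limsup_quotient phi e p : R :=
  fine (limn_esup (fun n : nat => (n.+1%:R *
    (phi (p.1 + e.1 * n.+1%:R^-1, p.2 + e.2 * n.+1%:R^-1) - phi p))%:E)).

Lemma measurable_limsup_quotient phi e :
  measurable_fun setT phi -> measurable_fun setT (limsup_quotient phi e).
Proof.
move=> mphi.
apply: (@measurableT_comp _ _ _ _ _ _ (@fine R)) => //.
apply: measurable_fun_limn_esup => n; apply/measurable_EFinP.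
apply: measurable_funM => //; apply: measurable_funB => //.
apply: measurableT_comp => //.
apply: measurable_fun_pair.
  by apply: measurable_funD => //; exact: measurable_fst.
by apply: measurable_funD => //; exact: measurable_snd.
Qed.

Let limsup_quotient_line (h : R -> R) (x : R) : derivable h x 1 ->
  fine (limn_esup (fun n : nat =>
    (n.+1%:R * (h (x + n.+1%:R^-1) - h x))%:E)) = derive1 h x.
Proof.
move=> dh; have hd := is_derive1_derive1 dh erefl.
have := is_derive1_cvg hd.
set q := (fun t => _); move=> qd.
have hq : (fun n : nat => n.+1%:R * (h (x + n.+1%:R^-1) - h x)) @ \oo --> derive1 h x.
  have -> : (fun n : nat => n.+1%:R * (h (x + n.+1%:R^-1) - h x)) =
      q \o (fun n : nat => n.+1%:R^-1).
    by apply/funext => n; rewrite /q /= invrK [x + _]addrC.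
  apply: (cvg_comp (fun n : nat => n.+1%:R^-1 : R) q _ qd).
  move=> A; rewrite /nbhs/= /dnbhs/= => -[e /= e0 eA].
  have /cvgrPdist_lt/(_ _ e0) := @cvg_harmonic R.
  apply: filterS => n; rewrite sub0r normrN/= => ne.
  apply: eA; rewrite /ball_/=; first by rewrite sub0r normrN.
  by rewrite invr_eq0.
have : (fun n : nat => (n.+1%:R * (h (x + n.+1%:R^-1) - h x))%:E) @ \oo -->
    (derive1 h x)%:E by apply/cvg_EFin => //; exact: nearW.
by move=> /cvg_limn_einf_sup[_ ->].
Qed.

Lemma limsup_quotient_x phi p : derivable (horizontal_slice phi p.2) p.1 1 ->
  limsup_quotient phi (1, 0) p = partial_x phi p.
Proof.
rewrite /partial_x/partial_y => /limsup_quotient_line <-; rewrite /limsup_quotient/=; congr (fine (limn_esup _)).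
by apply/funext => n; rewrite mul1r mul0r addr0 /horizontal_slice -surjective_pairing.
Qed.

Lemma limsup_quotient_y phi p : derivable (vertical_slice phi p.1) p.2 1 ->
  limsup_quotient phi (0, 1) p = partial_y phi p.
Proof.
rewrite /partial_x/partial_y => /limsup_quotient_line <-; rewrite /limsup_quotient/=; congr (fine (limn_esup _)).
by apply/funext => n; rewrite mul1r mul0r addr0 /vertical_slice -surjective_pairing.
Qed.

Lemma limsup_quotient_eq0 phi e p :
  (forall t : R, 0 <= t <= 1 -> phi (p.1 + e.1 * t, p.2 + e.2 * t) = 0) ->
  limsup_quotient phi e p = 0.
Proof.
move=> phi0; rewrite /limsup_quotient.
have -> : (fun n : nat => (n.+1%:R *
    (phi (p.1 + e.1 * n.+1%:R^-1, p.2 + e.2 * n.+1%:R^-1) - phi p))%:E) =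
    fun=> 0%E.
  apply/funext => n; rewrite phi0; last by rewrite invr_ge0 invf_le1// ?ler1n ler0n.
  have := phi0 0; rewrite lexx ler01 !mulr0 !addr0 -surjective_pairing => -> //.
  by rewrite subrr mulr0.
have := @cvg_limn_einf_sup R (fun=> 0%E) 0%E.
by move=> [|_ ->//]; exact: cvg_cst.
Qed.

Lemma plane_integral_eq0_x (h : R * R -> R) :
  mu2.-integrable setT (EFin \o h) ->
  {ae mu, forall y : R, (\int[mu]_x (h (x, y))%:E = 0)%E} ->
  (\int[mu2]_p (h p)%:E = 0)%E.
Proof.
move=> ih h0.
rewrite -(@integral21_prod_meas1 _ _ _ _ _ mu mu (EFin \o h))//.
rewrite (@ae_eq_integral _ _ _ _ setT (cst 0%E))//.
- by rewrite integral0.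
- exact: (@measurable_fubini_G _ _ _ _ _ mu mu (EFin \o h)).
- have aeF := ae_filter_ringOfSetsType mu.
  by apply: filterS h0 => y h0 _.
Qed.

Lemma plane_integral_eq0_y (h : R * R -> R) :
  mu2.-integrable setT (EFin \o h) ->
  {ae mu, forall x : R, (\int[mu]_y (h (x, y))%:E = 0)%E} ->
  (\int[mu2]_p (h p)%:E = 0)%E.
Proof.
move=> ih h0.
rewrite -(@integral12_prod_meas1 _ _ _ _ _ mu mu (EFin \o h))//.
rewrite (@ae_eq_integral _ _ _ _ setT (cst 0%E))//.
- by rewrite integral0.
- exact: (@measurable_fubini_F _ _ _ _ _ mu mu (EFin \o h)).
- have aeF := ae_filter_ringOfSetsType mu.
  by apply: filterS h0 => y h0 _.
Qed.

Section test_function.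
Variables (phi : R * R -> R) (B M : R).
Hypotheses (cphi : continuous phi) (phiM : forall p, `|phi p| <= M)
  (phiB : forall p, B <= `|p.1| \/ B <= `|p.2| -> phi p = 0)
  (phi_partials : partials_exist_ae phi)
  (phi_acl : absolutely_continuous_on_lines phi)
  (phi_dirichlet : (dirichlet_integral phi < +oo)%E).
Local Notation psi1 := (limsup_quotient phi (1, 0)).
Local Notation psi2 := (limsup_quotient phi (0, 1)).

Let mphi : measurable_fun setT phi.
Proof. exact: continuous_measurable_plane. Qed.

Let mpsi1 : measurable_fun setT psi1.
Proof. exact: measurable_limsup_quotient. Qed.

Let mpsi2 : measurable_fun setT psi2.
Proof. exact: measurable_limsup_quotient. Qed.

(** The difference quotients use steps of length at most 1, hence the margin 1 around the
    support. *)
Let psi1B p : B + 1 <= `|p.1| \/ B + 1 <= `|p.2| -> psi1 p = 0.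
Proof.
move=> pB; apply: limsup_quotient_eq0 => t /andP[t0 t1] /=.
rewrite mul1r mul0r addr0; apply: phiB => /=; case: pB => pB; [left|right]; last lra.
have := lerB_normD p.1 t; rewrite (ger0_norm t0); lra.
Qed.

Let psi2B p : B + 1 <= `|p.1| \/ B + 1 <= `|p.2| -> psi2 p = 0.
Proof.
move=> pB; apply: limsup_quotient_eq0 => t /andP[t0 t1] /=.
rewrite mul1r mul0r addr0; apply: phiB => /=; case: pB => pB; [left|right]; first lra.
have := lerB_normD p.2 t; rewrite (ger0_norm t0); lra.
Qed.

(** The integrands agree off a measurable null set [N]. The left one is measurable, so dropping [N]
    does not change its integral; for the right one only monotonicity is available, which gives an
    inequality. *)
Lemma integral_sqr_limsup_quotient :
  (\int[mu2]_p (psi1 p ^+ 2 + psi2 p ^+ 2)%:E <= dirichlet_integral phi)%E.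
Proof.
have [N [mN N0 PN]] := phi_partials.
rewrite (ge0_negligible_integral mN)//; last 2 first.
- by apply/measurable_EFinP; apply: measurable_funD; exact: measurable_funX.
- by move=> p _; rewrite lee_fin addr_ge0 ?sqr_ge0.
rewrite integral_mkcond; apply: le_lower_integral => p.
  by rewrite patchE; case: ifP => // _; rewrite lee_fin addr_ge0 ?sqr_ge0.
rewrite patchE; case: ifPn => [|_]; last by rewrite lee_fin addr_ge0 ?sqr_ge0.
rewrite inE /= => -[_ Np].
have [] : derivable (horizontal_slice phi p.2) p.1 1 /\
    derivable (vertical_slice phi p.1) p.2 1 by apply: contrapT => /PN.
by move=> /limsup_quotient_x -> /limsup_quotient_y ->.
Qed.

(** [|psi|] is bounded by [1 + psi ^+ 2], and the 1 is needed only on a square, which has finite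
    measure. *)
Let integrable_sqr (psi : R * R -> R) : measurable_fun setT psi ->
  (forall p, B + 1 <= `|p.1| \/ B + 1 <= `|p.2| -> psi p = 0) ->
  (\int[mu2]_p (psi p ^+ 2)%:E < +oo)%E ->
  mu2.-integrable setT (EFin \o psi).
Proof.
move=> mpsi psiB psi2; pose I := `[- (`|B| + 1), `|B| + 1]%classic : set R.
have mI : measurable (I `*` I) by apply: measurableX; exact: measurable_itv.
have Ifin : (mu2 (I `*` I) < +oo)%E by exact: plane_measure_square.
have ig : mu2.-integrable setT (fun p => (\1_(I `*` I) p + psi p ^+ 2)%:E).
  under eq_fun do rewrite EFinD.
  apply: integrableD => //.
    apply/integrableP; split.
      by apply/measurable_EFinP; exact: measurable_indic.
    under eq_integral do rewrite gee0_abs ?lee_fin//.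
    by rewrite integral_indic// setIT.
  apply/integrableP; split.
    by apply/measurable_EFinP; exact: measurable_funX.
  by under eq_integral do rewrite gee0_abs ?lee_fin ?sqr_ge0//.
apply: le_integrable ig => //; first exact/measurable_EFinP.
move=> p _; rewrite /= lee_fin [leRHS]ger0_norm ?addr_ge0 ?sqr_ge0//.
have [pI|pI] := boolP (p \in I `*` I).
  rewrite indicE pI; have := sqr_ge0 (`|psi p| - 1).
  by rewrite sqrrB1 real_normK ?num_real// -(mulr_natl `|_|) /= mulr1n; have := sqr_ge0 (psi p); lra.
rewrite psiB ?normr0 ?addr_ge0 ?sqr_ge0//.
move: pI; rewrite notin_setE /= => /not_andP[] /negP; rewrite in_itv/= -ler_norml -ltNge => h;
  [left|right]; by rewrite (le_trans _ (ltW h))// lerD2r ler_norm.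
Qed.

Lemma integrable_limsup_quotient :
  mu2.-integrable setT (EFin \o psi1) /\ mu2.-integrable setT (EFin \o psi2).
Proof.
have h := le_lt_trans integral_sqr_limsup_quotient phi_dirichlet.
split; apply: integrable_sqr => //; apply: le_lt_trans h;
  apply: le_lower_integral => p; rewrite lee_fin ?sqr_ge0// ?lerDl ?lerDr ?sqr_ge0//.
Qed.

Lemma integrable_test_mul (g : R * R -> R) (L : R) : measurable_fun setT g ->
  (forall p, `|g p| <= L) -> mu2.-integrable setT (fun p => (phi p * g p)%:E).
Proof.
move=> mg gL; suff iphi : mu2.-integrable setT (EFin \o phi).
  exact: (integrable_mul_bounded iphi mg gL).
apply: integrable_sqr => //.
  by move=> p [] pB; apply: phiB; [left|right]; lra.
pose I := `[- (`|B| + 1), `|B| + 1]%classic : set R.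
have mI : measurable (I `*` I) by apply: measurableX; exact: measurable_itv.
apply: (@le_lt_trans _ _ (\int[mu2]_p ((M ^+ 2)%:E * (\1_(I `*` I) p)%:E))%E).
  apply: le_lower_integral => p; first by rewrite lee_fin sqr_ge0.
  have M0 : 0 <= M by rewrite (le_trans _ (phiM p)).
  rewrite -EFinM lee_fin; have [pI|pI] := boolP (p \in I `*` I).
    rewrite indicE pI mulr1 -(real_normK (num_real (phi p))).
    by rewrite lerXn2r ?nnegrE.
  rewrite phiB ?expr0n ?mulr_ge0 ?sqr_ge0//.
  move: pI; rewrite notin_setE /= => /not_andP[] /negP; rewrite in_itv/= -ler_norml -ltNge => h;
    [left|right]; by rewrite (le_trans _ (ltW h))// (le_trans (ler_norm B))// lerDl.
rewrite ge0_integralZl//; last 2 first.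
- by apply/measurable_EFinP; exact: measurable_indic.
- by rewrite lee_fin sqr_ge0.
rewrite integral_indic// setIT lte_mul_pinfty ?lee_fin ?sqr_ge0//.
exact: plane_measure_square.
Qed.

Let continuous_slice (y : R) : continuous (fun x => phi (x, y)).
Proof.
move=> x; apply: (continuous_comp (f := fun x => (x, y)) (g := phi)); last exact: cphi.
exact: (cvg_pair (f := fun x : R => x) (g := fun=> y) cvg_id (cvg_cst y)).
Qed.

Let continuous_vslice (x : R) : continuous (fun y => phi (x, y)).
Proof.
move=> y; apply: (continuous_comp (f := fun y => (x, y)) (g := phi)); last exact: cphi.
exact: (cvg_pair (f := fun=> x) (g := fun y : R => y) (cvg_cst x) cvg_id).
Qed.

Variables (g dg : R * R -> R) (L : R).
Hypotheses (mg : measurable_fun setT g) (mdg : measurable_fun setT dg)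
  (gL : forall p, `|g p| <= L) (dgL : forall p, `|dg p| <= L).

(** Almost every horizontal line satisfies three conditions at once: absolute continuity,
    integrability of [psi1], and almost everywhere differentiability; the last two come from
    sections in the product measure. *)
Lemma integration_by_parts_x :
  (forall y x, is_derive x (1 : R) (fun x => g (x, y)) (dg (x, y))) ->
  (forall y, continuous (fun x => dg (x, y))) ->
  (\int[mu2]_p (psi1 p * g p + phi p * dg p)%:E = 0)%E.
Proof.
move=> gd cdg; have [ipsi _] := integrable_limsup_quotient.
apply: plane_integral_eq0_x.
  have -> : EFin \o (fun p => psi1 p * g p + phi p * dg p) =
      (fun p => (psi1 p * g p)%:E + (phi p * dg p)%:E)%E by apply/funext.
  apply: integrableD => //; [exact: integrable_mul_bounded ipsi mg gL|].
  exact: integrable_test_mul mdg dgL.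
have aeF := ae_filter_ringOfSetsType mu.
have := @ae_ysection _ _ _ _ R mu mu _ phi_partials.
have := @ae_integrable2 _ _ _ _ R mu mu _ ipsi.
have [+ _] := phi_acl.
apply: filterS3 => y phiAC ipsiy phid.
apply: (@integration_by_parts_line R (fun x => phi (x, y)) (fun x => g (x, y))
  (fun x => psi1 (x, y)) (fun x => dg (x, y)) (B + 1) (Num.max M L)) => //.
- by move=> x xB; apply: phiB; left; lra.
- by move=> x xB; apply: psi1B; left.
- apply: filterS phid => x [dx _].
  by rewrite (limsup_quotient_x (p := (x, y)) dx); exact: is_derive1_derive1.
- by move=> x; rewrite le_max phiM.
- by move=> x; rewrite le_max gL orbT.
- by move=> x; rewrite le_max dgL orbT.
Qed.

Lemma integration_by_parts_y :
  (forall x y, is_derive y (1 : R) (fun y => g (x, y)) (dg (x, y))) ->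
  (forall x, continuous (fun y => dg (x, y))) ->
  (\int[mu2]_p (psi2 p * g p + phi p * dg p)%:E = 0)%E.
Proof.
move=> gd cdg; have [_ ipsi] := integrable_limsup_quotient.
apply: plane_integral_eq0_y.
  have -> : EFin \o (fun p => psi2 p * g p + phi p * dg p) =
      (fun p => (psi2 p * g p)%:E + (phi p * dg p)%:E)%E by apply/funext.
  apply: integrableD => //; [exact: integrable_mul_bounded ipsi mg gL|].
  exact: integrable_test_mul mdg dgL.
have aeF := ae_filter_ringOfSetsType mu.
have := @ae_xsection _ _ _ _ R mu mu _ phi_partials.
have := @ae_integrable1 _ _ _ _ R mu mu _ ipsi.
have [_ +] := phi_acl.
apply: filterS3 => x phiAC ipsiy phid.
apply: (@integration_by_parts_line R (fun y => phi (x, y)) (fun y => g (x, y))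
  (fun y => psi2 (x, y)) (fun y => dg (x, y)) (B + 1) (Num.max M L)) => //.
- by move=> y yB; apply: phiB; right; lra.
- by move=> y yB; apply: psi2B; right.
- apply: filterS phid => y [_ dy].
  by rewrite (limsup_quotient_y (p := (x, y)) dy); exact: is_derive1_derive1.
- by move=> y; rewrite le_max phiM.
- by move=> y; rewrite le_max gL orbT.
- by move=> y; rewrite le_max dgL orbT.
Qed.

End test_function.
End weak_partial_derivatives.

(** * The energy of a difference of two measures *)

Section bounded_expectation.
Context d (T : measurableType d) (R : realType) (P : probability T R).
Implicit Types (f g : T -> R).

Definition bounded_measurable f : Prop :=
  measurable_fun setT f /\ exists M : R, forall x, `|f x| <= M.

Lemma bounded_measurable_cst (k : R) : bounded_measurable (fun=> k).
Proof. by split; [exact: measurable_cst|exists `|k|]. Qed.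

Lemma bounded_measurableD f g : bounded_measurable f -> bounded_measurable g ->
  bounded_measurable (fun x => f x + g x).
Proof.
move=> [mf [M fM]] [mg [N gN]]; split; first exact: measurable_funD.
by exists (M + N) => x; rewrite (le_trans (ler_normD _ _))// lerD.
Qed.

Lemma bounded_measurableM f g : bounded_measurable f -> bounded_measurable g ->
  bounded_measurable (fun x => f x * g x).
Proof.
move=> [mf [M fM]] [mg [N gN]]; split; first exact: measurable_funM.
by exists (M * N) => x; rewrite normrM ler_pM.
Qed.

Lemma bounded_measurable_integrable f : bounded_measurable f ->
  P.-integrable setT (EFin \o f).
Proof.
move=> [mf [M fM]]; apply: measurable_bounded_integrable => //.
  by rewrite (le_lt_trans (probability_le1 P measurableT))// ltry.
exists M; split; first exact: num_real.
by move=> N MN x _; exact: le_trans (fM x) (ltW MN).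
Qed.

Lemma bounded_expectationD f g : bounded_measurable f -> bounded_measurable g ->
  (\int[P]_x (f x + g x) = \int[P]_x f x + \int[P]_x g x)%R.
Proof. by move=> bf bg; rewrite RintegralD//; exact: bounded_measurable_integrable. Qed.

Lemma bounded_expectationZ f (k : R) : bounded_measurable f ->
  (\int[P]_x (k * f x) = k * \int[P]_x f x)%R.
Proof. by move=> bf; rewrite RintegralZl//; exact: bounded_measurable_integrable. Qed.

Lemma bounded_expectation_cst (k : R) : (\int[P]_x k = k)%R.
Proof.
rewrite Rintegral_cst//.
have /= -> := @probability_setT _ _ _ P.
by rewrite mulr1.
Qed.

Lemma EFin_expectation f : bounded_measurable f ->
  ((\int[P]_x f x)%R%:E = \int[P]_x (f x)%:E)%E.
Proof.
move=> bf; rewrite fineK//; apply: integrable_fin_num => //.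
exact: bounded_measurable_integrable.
Qed.

Lemma le_expectation f g : bounded_measurable f -> bounded_measurable g ->
  (forall x, f x <= g x) -> (\int[P]_x f x <= \int[P]_x g x)%R.
Proof.
by move=> bf bg fg; apply: le_Rintegral => //; exact: bounded_measurable_integrable.
Qed.

Lemma norm_expectation_le f (M : R) : bounded_measurable f ->
  (forall x, `|f x| <= M) -> `|(\int[P]_x f x)%R| <= M.
Proof.
move=> bf fM; rewrite ler_norml -{1}(bounded_expectation_cst (- M)) -{2}(bounded_expectation_cst M).
apply/andP; split; apply: le_expectation => //; try exact: bounded_measurable_cst.
- by move=> x; move: (fM x); rewrite ler_norml => /andP[].
- by move=> x; move: (fM x); rewrite ler_norml => /andP[].
Qed.

End bounded_expectation.

(** Tonelli's theorem gives measurability for nonnegative integrands, so the bound [M] is added and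
    then removed. *)
Lemma measurable_expectation d1 d2 (T1 : measurableType d1) (T2 : measurableType d2)
    (R : realType) (P : probability T2 R) (f : T1 * T2 -> R) (M : R) :
  measurable_fun setT f -> (forall x, `|f x| <= M) ->
  measurable_fun setT (fun x => (\int[P]_y f (x, y))%R).
Proof.
move=> mf fM.
have bf x : bounded_measurable (fun y => f (x, y)).
  by split; [exact: measurableT_comp|exists M].
pose g (p : T1 * T2) : \bar R := (f p + M)%:E.
have mg : measurable_fun setT g by apply/measurable_EFinP; exact: measurable_funD.
have g0 p : (0 <= g p)%E.
  by rewrite lee_fin; move: (fM p); rewrite ler_norml => /andP[]; lra.
have := @measurable_fun_fubini_tonelli_F _ _ _ _ _ P g mg g0.
have -> : fubini_F P g = (fun x => ((\int[P]_y f (x, y))%R + M)%:E).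
  apply/funext => x; rewrite /fubini_F.
  rewrite -(bounded_expectation_cst P M) -bounded_expectationD//; last exact: bounded_measurable_cst.
  rewrite EFin_expectation//.
  by apply: bounded_measurableD => //; exact: bounded_measurable_cst.
move=> /measurable_EFinP mF.
have -> : (fun x => (\int[P]_y f (x, y))%R) = (fun x => ((\int[P]_y f (x, y))%R + M) - M).
  by apply/funext => x; rewrite addrK.
exact: measurable_funB.
Qed.

Section energy_identity.
Variables (R : realType) (c : R).
Hypothesis c0 : 0 < c.
Local Notation mu2 := (plane_measure R).
Implicit Types (u z w : R * R) (nu mu : probability (R * R)%type R).

Definition inv_sqdist u z : R := (sqdist u z + c)^-1.
(** Together with [field_y], the gradient of [- smooth_log c u z] with respect to [u]. *)
Definition field_x u z : R := (u.1 - z.1) * inv_sqdist u z.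
Definition field_y u z : R := (u.2 - z.2) * inv_sqdist u z.

Let p0 u z : 0 < sqdist u z + c.
Proof. by rewrite ltr_wpDl// sqdist_ge0. Qed.

Lemma inv_sqdist_gt0 u z : 0 < inv_sqdist u z.
Proof. by rewrite invr_gt0. Qed.

Lemma inv_sqdist_le u z : inv_sqdist u z <= c^-1.
Proof. by rewrite lef_pV2 ?posrE// lerDr sqdist_ge0. Qed.

Let field_bound (t q : R) : t ^+ 2 <= q -> `|t * (q + c)^-1| <= 1 + c^-1.
Proof.
move=> tq; have q0 : 0 < q + c by rewrite (lt_le_trans c0)// lerDr (le_trans _ tq)// sqr_ge0.
rewrite normrM normfV (gtr0_norm q0) ler_pdivrMr// mulrDl mul1r.
have h1 : `|t| <= t ^+ 2 + 1.
  have := sqr_ge0 (`|t| - 1); rewrite sqrrB1 real_normK ?num_real// -(mulr_natl `|t|).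
  by have := normr_ge0 t; lra.
have h2 : 1 <= c^-1 * (q + c).
  by rewrite mulrC ler_pdivlMr// mul1r lerDr (le_trans _ tq)// sqr_ge0.
by rewrite (le_trans h1)// lerD// (le_trans tq)// lerDl ltW.
Qed.

Lemma field_x_le u z : `|field_x u z| <= 1 + c^-1.
Proof. by apply: field_bound; rewrite lerDl sqr_ge0. Qed.

Lemma field_y_le u z : `|field_y u z| <= 1 + c^-1.
Proof. by apply: field_bound; rewrite lerDr sqr_ge0. Qed.

Section measurability.
Context d (T : measurableType d) (f g : T -> R * R).
Hypotheses (mf : measurable_fun setT f) (mg : measurable_fun setT g).

Lemma measurable_inv_sqdist : measurable_fun setT (fun x => inv_sqdist (f x) (g x)).
Proof.
apply: measurable_inv_gt0 => //; apply: measurable_funD => //.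
exact: measurable_sqdist.
Qed.

Lemma measurable_field_x : measurable_fun setT (fun x => field_x (f x) (g x)).
Proof.
apply: measurable_funM; last exact: measurable_inv_sqdist.
by apply: measurable_funB; apply: measurableT_comp.
Qed.

Lemma measurable_field_y : measurable_fun setT (fun x => field_y (f x) (g x)).
Proof.
apply: measurable_funM; last exact: measurable_inv_sqdist.
by apply: measurable_funB; apply: measurableT_comp.
Qed.

End measurability.

(** It replaces the scalar product of the fields at [u] of masses at [z] and [w], which decays only
    like |u|^-2; this decays like |u|^-4. The difference of the two consists of terms depending on
    one of the masses only, which cancel for measures of equal mass. *)
Definition interaction u z w : R :=
  (sqdist z w + 2 * c) * (inv_sqdist u z * inv_sqdist u w).

Lemma interaction_ge0 u z w : 0 <= interaction u z w.
Proof.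
rewrite mulr_ge0//; last by rewrite mulr_ge0// ltW// inv_sqdist_gt0.
by rewrite addr_ge0 ?sqdist_ge0// mulr_ge0// ltW.
Qed.

(* polarization: (u - z) . (u - w) = (|u - z|^2 + |u - w|^2 - |z - w|^2) / 2 *)
Lemma interactionE u z w : interaction u z w =
  inv_sqdist u z + inv_sqdist u w
  - 2 * (field_x u z * field_x u w + field_y u z * field_y u w).
Proof.
rewrite /interaction /field_x /field_y /inv_sqdist.
have -> : (u.1 - z.1) / (sqdist u z + c) * ((u.1 - w.1) / (sqdist u w + c)) +
    (u.2 - z.2) / (sqdist u z + c) * ((u.2 - w.2) / (sqdist u w + c)) =
  ((u.1 - z.1) * (u.1 - w.1) + (u.2 - z.2) * (u.2 - w.2)) /
    ((sqdist u z + c) * (sqdist u w + c)).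
  by field; rewrite !gt_eqF.
have -> : sqdist z w + 2 * c = (sqdist u z + c) + (sqdist u w + c)
   - 2 * ((u.1 - z.1) * (u.1 - w.1) + (u.2 - z.2) * (u.2 - w.2)).
  by rewrite /sqdist; ring.
by field; rewrite !gt_eqF.
Qed.

Let bm_inv u : bounded_measurable (inv_sqdist u).
Proof.
split; first by apply: measurable_inv_sqdist.
by exists c^-1 => z; rewrite gtr0_norm ?inv_sqdist_gt0// inv_sqdist_le.
Qed.

Let bm_x u : bounded_measurable (field_x u).
Proof. by split; [apply: measurable_field_x|exists (1 + c^-1); exact: field_x_le]. Qed.

Let bm_y u : bounded_measurable (field_y u).
Proof. by split; [apply: measurable_field_y|exists (1 + c^-1); exact: field_y_le]. Qed.

Let bm_interaction u z : bounded_measurable (interaction u z).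
Proof.
have -> : interaction u z = fun w => inv_sqdist u z + inv_sqdist u w
    + (- 2 * field_x u z * field_x u w + - 2 * field_y u z * field_y u w).
  by apply/funext => w; rewrite interactionE; ring.
by do !apply: bounded_measurableD => //; do ?apply: bounded_measurableM => //;
  exact: bounded_measurable_cst.
Qed.

Definition field_energy nu mu u : R :=
  (\int[nu]_z \int[mu]_w interaction u z w)%R.

Let inner_interaction mu u z : (\int[mu]_w interaction u z w)%R =
  inv_sqdist u z + (\int[mu]_w inv_sqdist u w)%R
  + (- 2 * (\int[mu]_w field_x u w)%R * field_x u z
     + - 2 * (\int[mu]_w field_y u w)%R * field_y u z).
Proof.
have -> : interaction u z = fun w => inv_sqdist u z + inv_sqdist u w
    + (- 2 * field_x u z * field_x u w + - 2 * field_y u z * field_y u w).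
  by apply/funext => w; rewrite interactionE; ring.
have bc := @bounded_measurable_cst _ (R * R)%type R.
have bZ (k : R) (f : R * R -> R) :
    bounded_measurable f -> bounded_measurable (fun w => k * f w).
  by move=> bf; exact: bounded_measurableM.
have bx := bZ (- 2 * field_x u z) _ (bm_x u).
have by_ := bZ (- 2 * field_y u z) _ (bm_y u).
rewrite bounded_expectationD; [|exact: bounded_measurableD|exact: bounded_measurableD].
rewrite bounded_expectationD// bounded_expectationD// !bounded_expectationZ// bounded_expectation_cst.
ring.
Qed.

Lemma field_energyE nu mu u : field_energy nu mu u =
  (\int[nu]_z inv_sqdist u z)%R + (\int[mu]_w inv_sqdist u w)%R
  - 2 * ((\int[nu]_z field_x u z)%R * (\int[mu]_w field_x u w)%R
         + (\int[nu]_z field_y u z)%R * (\int[mu]_w field_y u w)%R).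
Proof.
rewrite /field_energy; under eq_Rintegral do rewrite inner_interaction.
have bc := @bounded_measurable_cst _ (R * R)%type R.
have bZ (k : R) (f : R * R -> R) :
    bounded_measurable f -> bounded_measurable (fun w => k * f w).
  by move=> bf; exact: bounded_measurableM.
have bx := bZ (- 2 * (\int[mu]_w field_x u w)%R) _ (bm_x u).
have by_ := bZ (- 2 * (\int[mu]_w field_y u w)%R) _ (bm_y u).
rewrite bounded_expectationD; [|exact: bounded_measurableD|exact: bounded_measurableD].
rewrite bounded_expectationD// bounded_expectationD// !bounded_expectationZ// bounded_expectation_cst.
ring.
Qed.

Lemma EFin_field_energy nu mu u :
  ((field_energy nu mu u)%:E =
   \int[nu]_z \int[mu]_w (interaction u z w)%:E)%E.
Proof.
have bi : bounded_measurable (fun z => (\int[mu]_w interaction u z w)%R).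
  under eq_fun do rewrite inner_interaction.
  by do !apply: bounded_measurableD => //; do ?apply: bounded_measurableM => //;
    exact: bounded_measurable_cst.
rewrite /field_energy EFin_expectation//.
by apply: eq_integral => z _; rewrite EFin_expectation.
Qed.

Definition field_diff_x nu mu u : R :=
  (\int[nu]_z field_x u z)%R - (\int[mu]_z field_x u z)%R.
Definition field_diff_y nu mu u : R :=
  (\int[nu]_z field_y u z)%R - (\int[mu]_z field_y u z)%R.

(** By polarization, -2 times the scalar product of fields and [interaction] define the same
    quadratic form on differences of probabilities. *)
Lemma sqr_field_diff nu mu u :
  (field_diff_x nu mu u ^+ 2 + field_diff_y nu mu u ^+ 2) * 2
  + field_energy nu nu u + field_energy mu mu u = 2 * field_energy nu mu u.
Proof. by rewrite !field_energyE /field_diff_x /field_diff_y; ring. Qed.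

Lemma measurable_mean_inv_sqdist mu :
  measurable_fun setT (fun u => (\int[mu]_z inv_sqdist u z)%R).
Proof.
apply: (@measurable_expectation _ _ _ _ _ _
  (fun p : (R * R) * (R * R) => inv_sqdist p.1 p.2) c^-1).
- by apply: measurable_inv_sqdist.
- by move=> p; rewrite gtr0_norm ?inv_sqdist_gt0// inv_sqdist_le.
Qed.

Lemma measurable_mean_field_x mu :
  measurable_fun setT (fun u => (\int[mu]_z field_x u z)%R).
Proof.
apply: (@measurable_expectation _ _ _ _ _ _
  (fun p : (R * R) * (R * R) => field_x p.1 p.2) (1 + c^-1)).
- by apply: measurable_field_x.
- by move=> p; exact: field_x_le.
Qed.

Lemma measurable_mean_field_y mu :
  measurable_fun setT (fun u => (\int[mu]_z field_y u z)%R).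
Proof.
apply: (@measurable_expectation _ _ _ _ _ _
  (fun p : (R * R) * (R * R) => field_y p.1 p.2) (1 + c^-1)).
- by apply: measurable_field_y.
- by move=> p; exact: field_y_le.
Qed.

Lemma measurable_field_diff_x nu mu : measurable_fun setT (field_diff_x nu mu).
Proof. by apply: measurable_funB; exact: measurable_mean_field_x. Qed.

Lemma measurable_field_diff_y nu mu : measurable_fun setT (field_diff_y nu mu).
Proof. by apply: measurable_funB; exact: measurable_mean_field_y. Qed.

(** 1 / (2 pi) times the integral of [interaction u z w] over [u]; it behaves like ln (|z - w|^2 /
    c) for distant points and stays bounded on the diagonal. *)
Definition log_bounded_kernel z w : R :=
  (sqdist z w + 2 * c) / 2 * energy_param c (sqdist z w).

Definition mutual_energy nu mu : \bar R :=
  (\int[nu]_z \int[mu]_w (2 * pi * log_bounded_kernel z w)%:E)%E.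

(** Tonelli twice, once for each measure, which the sign of [interaction] permits. *)
Lemma integral_field_energy nu mu :
  (\int[mu2]_u (field_energy nu mu u)%:E = mutual_energy nu mu)%E.
Proof.
under eq_integral do rewrite EFin_field_energy.
pose t (p : ((R * R) * (R * R)) * (R * R)) : \bar R :=
  (interaction p.1.1 p.1.2 p.2)%:E.
have mt : measurable_fun setT t.
  apply/measurable_EFinP; apply: measurable_funM.
    by apply: measurable_funD => //; apply: measurable_sqdist => //;
      apply: measurableT_comp.
  by apply: measurable_funM; apply: measurable_inv_sqdist => //;
    apply: measurableT_comp.
have t0 p : (0 <= t p)%E by rewrite lee_fin interaction_ge0.
have mF := @measurable_fun_fubini_tonelli_F _ _ _ _ _ mu t mt t0.
rewrite (@fubini_tonelli _ _ _ _ _ mu2 nu (fubini_F mu t))//; last first.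
  by move=> p; apply: integral_ge0 => w _; exact: t0.
rewrite /mutual_energy; apply: eq_integral => z _.
pose s (p : (R * R) * (R * R)) : \bar R := (interaction p.1 z p.2)%:E.
rewrite -[LHS]/(\int[mu2]_u \int[mu]_w s (u, w))%E.
rewrite (@fubini_tonelli _ _ _ _ _ mu2 mu s)//; last 2 first.
- apply/measurable_EFinP; apply: measurable_funM.
    by apply: measurable_funD => //; apply: measurable_sqdist.
  by apply: measurable_funM; apply: measurable_inv_sqdist.
- by move=> p; rewrite lee_fin interaction_ge0.
apply: eq_integral => w _; rewrite /s/=.
under eq_integral do rewrite /interaction /inv_sqdist -invfM EFinM.
rewrite ge0_integralZl//.
- rewrite integral_energy_kernel// -EFinM /log_bounded_kernel; congr EFin; by field.
- apply/measurable_EFinP; apply: measurable_inv_gt0.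
    by move=> u; rewrite mulr_gt0.
  by apply: measurable_funM; apply: measurable_funD => //; exact: measurable_sqdist.
- by move=> u _; rewrite lee_fin invr_ge0 mulr_ge0// ltW.
- by rewrite lee_fin addr_ge0 ?sqdist_ge0// mulr_ge0// ltW.
Qed.

Lemma field_energy_ge0 nu mu u : 0 <= field_energy nu mu u.
Proof.
by apply: Rintegral_ge0 => z _; apply: Rintegral_ge0 => w _; exact: interaction_ge0.
Qed.

Lemma measurable_field_energy nu mu : measurable_fun setT (field_energy nu mu).
Proof.
rewrite (_ : field_energy nu mu = fun u =>
  (\int[nu]_z inv_sqdist u z)%R + (\int[mu]_w inv_sqdist u w)%R
  - 2 * ((\int[nu]_z field_x u z)%R * (\int[mu]_w field_x u w)%R
         + (\int[nu]_z field_y u z)%R * (\int[mu]_w field_y u w)%R)); last first.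
  by apply/funext => u; exact: field_energyE.
have mi := measurable_mean_inv_sqdist; have mx := measurable_mean_field_x.
have my := measurable_mean_field_y.
apply: measurable_funB; first exact: measurable_funD.
by apply: measurable_funM => //; apply: measurable_funD; apply: measurable_funM.
Qed.

(** Integral of [sqr_field_diff] over the plane, kept free of subtractions because the mutual
    energies may be infinite. *)
Lemma energy_identity nu mu :
  (2%:E * \int[mu2]_u (field_diff_x nu mu u ^+ 2 + field_diff_y nu mu u ^+ 2)%:E
   + mutual_energy nu nu + mutual_energy mu mu = 2%:E * mutual_energy nu mu)%E.
Proof.
rewrite -!integral_field_energy.
have md : measurable_fun setT
    (fun u => field_diff_x nu mu u ^+ 2 + field_diff_y nu mu u ^+ 2).
  by apply: measurable_funD; apply: measurable_funX;
    [exact: measurable_field_diff_x|exact: measurable_field_diff_y].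
have md1 : measurable_fun setT
    (fun u => (field_diff_x nu mu u ^+ 2 + field_diff_y nu mu u ^+ 2)%:E).
  exact/measurable_EFinP.
have me P Q : measurable_fun setT (fun u => (field_energy P Q u)%:E).
  apply/measurable_EFinP; exact: measurable_field_energy.
have md2 := measurable_funeM 2%:E md1.
have md3 := emeasurable_funD md2 (me nu nu).
rewrite -ge0_integralZl//; last first.
- by move=> u _; rewrite lee_fin addr_ge0 ?sqr_ge0.
rewrite -ge0_integralZl//; last 2 first.
- exact: me.
- by move=> u _; rewrite lee_fin field_energy_ge0.
rewrite -ge0_integralD//; first last.
- exact: me.
- by move=> u _; rewrite lee_fin field_energy_ge0.
- by move=> u _; rewrite -EFinM lee_fin mulr_ge0// addr_ge0 ?sqr_ge0.
rewrite -ge0_integralD//; first last.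
- exact: me.
- by move=> u _; rewrite lee_fin field_energy_ge0.
- move=> u _; rewrite -EFinM -EFinD lee_fin addr_ge0 ?field_energy_ge0//.
  by rewrite mulr_ge0// addr_ge0 ?sqr_ge0.
apply: eq_integral => u _; rewrite -!EFinM -!EFinD; congr EFin.
by rewrite mulrC sqr_field_diff.
Qed.

End energy_identity.

Lemma discriminant_le (R : realType) (D B X : R) : 0 <= D ->
  (forall s, 0 <= s ^+ 2 * D + 2 * s * B + X) -> B ^+ 2 <= D * X.
Proof.
rewrite le_eqVlt => /predU1P[<- h|D0 /(_ (- B / D))]; last first.
  have -> : (- B / D) ^+ 2 * D + 2 * (- B / D) * B + X = X - B ^+ 2 / D.
    by field; rewrite gt_eqF.
  by rewrite subr_ge0 ler_pdivrMr// mulrC.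
rewrite mul0r; have [->|B0] := eqVneq B 0; first by rewrite expr0n.
(* With [D = 0] the polynomial is affine in [s]; for [B] nonzero it takes the value -1 at this
   point. *)
have := h (- (X + 1) / (2 * B)).
have -> : (- (X + 1) / (2 * B)) ^+ 2 * 0 + 2 * (- (X + 1) / (2 * B)) * B + X = - 1.
  by field.
by lra.
Qed.

Lemma cauchy_schwarz_integral d (T : measurableType d) (R : realType)
    (m : {measure set T -> \bar R}) (a1 a2 b1 b2 : T -> R) :
  m.-integrable setT (fun x => (a1 x ^+ 2 + a2 x ^+ 2)%:E) ->
  m.-integrable setT (fun x => (b1 x ^+ 2 + b2 x ^+ 2)%:E) ->
  m.-integrable setT (fun x => (a1 x * b1 x + a2 x * b2 x)%:E) ->
  (\int[m]_x (a1 x * b1 x + a2 x * b2 x))%R ^+ 2 <=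
  (\int[m]_x (a1 x ^+ 2 + a2 x ^+ 2))%R * (\int[m]_x (b1 x ^+ 2 + b2 x ^+ 2))%R.
Proof.
move=> ia ib iab; apply: discriminant_le.
  by apply: Rintegral_ge0 => x _; rewrite addr_ge0 ?sqr_ge0.
move=> s.
have ia' : m.-integrable setT (fun x => (s ^+ 2 * (a1 x ^+ 2 + a2 x ^+ 2))%:E).
  exact: (integrableZl measurableT (s ^+ 2) ia).
have iab' : m.-integrable setT (fun x => (2 * s * (a1 x * b1 x + a2 x * b2 x))%:E).
  exact: (integrableZl measurableT (2 * s) iab).
have iD : m.-integrable setT (EFin \o (fun x => s ^+ 2 * (a1 x ^+ 2 + a2 x ^+ 2)
    + 2 * s * (a1 x * b1 x + a2 x * b2 x))).
  exact: (integrableD measurableT ia' iab').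
rewrite -!RintegralZl// -!RintegralD//.
apply: Rintegral_ge0 => x _.
rewrite [leRHS](_ : _ = (s * a1 x + b1 x) ^+ 2 + (s * a2 x + b2 x) ^+ 2); last by ring.
by rewrite addr_ge0 ?sqr_ge0.
Qed.

(** Fubini applies because the integrand is dominated by [M * |a u|], which is integrable for the
    product since [P] is a probability. *)
Lemma exchange_bounded_kernel d1 d2 (T1 : measurableType d1) (T2 : measurableType d2)
    (R : realType) (P : probability T1 R) (m : {sigma_finite_measure set T2 -> \bar R})
    (a : T2 -> R) (k : T1 * T2 -> R) (M : R) :
  m.-integrable setT (EFin \o a) -> measurable_fun setT k ->
  (forall p, `|k p| <= M) ->
  P.-integrable setT (fun z => (\int[m]_u (a u * k (z, u)))%R%:E) /\
  (\int[P]_z (\int[m]_u (a u * k (z, u)))%R)%R =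
  (\int[m]_u (a u * (\int[P]_z k (z, u))%R))%R.
Proof.
move=> ia mk kM.
have M0 : 0 <= M by rewrite (le_trans _ (kM (point, point))).
have ma : measurable_fun setT a by have /integrableP[/measurable_EFinP] := ia.
pose f (p : T1 * T2) : \bar R := (a p.2 * k p)%:E.
have mf : measurable_fun setT f.
  by apply/measurable_EFinP; apply: measurable_funM => //; exact: measurableT_comp.
have iu z : m.-integrable setT (fun u => f (z, u)).
  apply: (integrable_mul_bounded (M := M) ia) => //.
  exact: (measurableT_comp mk).
have iz u : P.-integrable setT (fun z => f (z, u)).
  have iku : P.-integrable setT (fun z => (k (z, u))%:E).
    apply: (@bounded_measurable_integrable _ _ _ _ (fun z => k (z, u))); split; last by exists M.
    exact: (measurableT_comp mk).
  exact: (integrableZl measurableT (a u) iku).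
have if_ : (P \x m)%E.-integrable setT f.
  apply/integrable12ltyP => //.
  apply: (@le_lt_trans _ _ (\int[P]_x (M%:E * \int[m]_u `|a u|%:E))%E).
    apply: ge0_le_integral => //.
    - by move=> z _; exact: integral_ge0.
    - have mabs : measurable_fun setT (abse \o f) by exact: measurableT_comp.
      have fabs0 p : (0 <= (abse \o f) p)%E by exact: abse_ge0.
      exact: (@measurable_fun_fubini_tonelli_F _ _ _ _ _ m (abse \o f) mabs fabs0).
    - move=> z _; rewrite -ge0_integralZl//; last first.
        by apply/measurable_EFinP; exact: measurableT_comp.
      apply: ge0_le_integral => //.
      + by apply: measurableT_comp => //; exact: (measurableT_comp mf).
      + by apply: measurable_funeM; apply/measurable_EFinP; exact: measurableT_comp.
      + by move=> u _; rewrite -EFinM lee_fin normrM mulrC ler_wpM2r.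
  rewrite integral_cst// lte_mul_pinfty//.
  - by rewrite mule_ge0 ?lee_fin// integral_ge0.
  - have /integrableP[_ oo] := ia.
    rewrite fin_numM// ge0_fin_numE//; exact: integral_ge0.
  - by have /= -> := @probability_setT _ _ _ P; rewrite ltry.
have F := @Fubini _ _ _ _ _ P m f if_.
split.
  have := integrable_fubini_F if_; rewrite /fubini_F; apply: eq_integrable => // z _.
  by rewrite fineK//; exact: integrable_fin_num (iu z).
rewrite /Rintegral.
transitivity (fine (\int[P]_z \int[m]_u f (z, u))).
  congr fine; apply: eq_integral => z _; rewrite fineK//.
  exact: integrable_fin_num (iu z).
rewrite F; congr fine; apply: eq_integral => u _.
rewrite EFinM fineK; last first.
  apply: integrable_fin_num => //.
  apply: (@bounded_measurable_integrable _ _ _ _ (fun z => k (z, u))); split; last by exists M.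
  exact: (measurableT_comp mk).
rewrite -integralZl//.
apply: (@bounded_measurable_integrable _ _ _ _ (fun z => k (z, u))); split; last by exists M.
exact: (measurableT_comp mk).
Qed.
Lemma eq_continuous (U V : topologicalType) (f g : U -> V) : f =1 g ->
  continuous f -> continuous g.
Proof. by move=> /funext ->. Qed.

Section affine_inverse.
Variables (R : realType) (a k : R).
Hypothesis k0 : 0 < k.
Let q (x : R) := (x - a) ^+ 2 + k.

Let q0 x : 0 < q x.
Proof. by rewrite ltr_wpDl// sqr_ge0. Qed.

Let is_derive_q x : is_derive x (1 : R) q (2 * (x - a)).
Proof.
have := is_derive1_o (f := fun y => y ^+ 2 + k) (g := fun y => y - a) (is_derive1_sqrp (x - a) k)
  (is_derive1_subr x a).
by rewrite mulr1.
Qed.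

Let is_derive_inv_q x :
  is_derive x (1 : R) (fun x => (q x)^-1) (- (2 * (x - a)) / q x ^+ 2).
Proof. by apply: (is_derive1_inv (f := q)); rewrite // gt_eqF. Qed.

Lemma is_derive_mul_inv_sqr x :
  is_derive x (1 : R) (fun x => (x - a) * (q x)^-1)
    ((q x)^-1 - 2 * (x - a) ^+ 2 * (q x)^-1 ^+ 2).
Proof.
apply: (@is_derive_eq _ _ _ _ _ _ _ _
  (is_derive1_mul (is_derive1_subr x a) (is_derive_inv_q x))).
by rewrite exprVn; field; rewrite gt_eqF.
Qed.

Lemma continuous_derive_mul_inv_sqr :
  continuous (fun x => (q x)^-1 - 2 * (x - a) ^+ 2 * (q x)^-1 ^+ 2).
Proof.
move=> x; have cq : {for x, continuous (fun x => (q x)^-1)}.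
  exact: is_derive1_continuous (is_derive_inv_q x).
have cs : {for x, continuous (fun x => x - a)}.
  exact: is_derive1_continuous (is_derive1_subr x a).
apply: cvgB => //; apply: cvgM; last by apply: cvgM.
by apply: cvgM; [exact: cvg_cst|apply: cvgM].
Qed.

End affine_inverse.

(** Bounds the derivative of [field_x] in its own direction, with [t = (u.1 - z.1)^2] and
    [q = |u - z|^2], and likewise for [field_y]. *)
Lemma norm_inv_sub_le (R : realFieldType) (c t q : R) : 0 < c -> 0 <= t <= q ->
  `|(q + c)^-1 - 2 * t * (q + c)^-1 ^+ 2| <= c^-1.
Proof.
move=> c0 /andP[t0 tq]; have q0 := le_trans t0 tq.
have qc : 0 < q + c by rewrite ltr_wpDl.
have -> : (q + c)^-1 - 2 * t * (q + c)^-1 ^+ 2 =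
  (q + c - 2 * t) / (q + c) * (q + c)^-1 by field; rewrite gt_eqF.
rewrite normrM -[leRHS]mul1r ler_pM//.
  rewrite normrM normfV (gtr0_norm qc) ler_pdivrMr// mul1r ler_norml.
  by apply/andP; split; lra.
by rewrite gtr0_norm ?invr_gt0// lef_pV2 ?posrE// lerDr.
Qed.

Lemma plane_RintegralB (R : realType) (f g : R * R -> R) :
  (plane_measure R).-integrable setT (EFin \o f) ->
  (plane_measure R).-integrable setT (EFin \o g) ->
  (\int[plane_measure R]_u (f u - g u))%R =
  (\int[plane_measure R]_u f u)%R - (\int[plane_measure R]_u g u)%R.
Proof. exact: RintegralB. Qed.

(** * Smoothing of the test function and the Cauchy-Schwarz estimate *)

Section smoothing.
Variables (R : realType) (phi : R * R -> R) (B M c : R).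
Hypotheses (cphi : continuous phi) (phiM : forall p, `|phi p| <= M)
  (phiB : forall p, B <= `|p.1| \/ B <= `|p.2| -> phi p = 0)
  (phi_partials : partials_exist_ae phi)
  (phi_acl : absolutely_continuous_on_lines phi)
  (phi_dirichlet : (dirichlet_integral phi < +oo)%E) (c0 : 0 < c).
Local Notation mu2 := (plane_measure R).
Local Notation psi1 := (limsup_quotient phi (1, 0)).
Local Notation psi2 := (limsup_quotient phi (0, 1)).
Implicit Types (u z : R * R) (nu mu : probability (R * R)%type R).

(** The kernel [2 * c / (|u - z|^2 + c)^2] is the divergence in [u] of the field of a mass at [z].
    Its mass is [2 * pi], so this tends to [2 * pi * phi z] as [c] tends to 0. *)
Definition smoothing z : R :=
  (\int[mu2]_u (phi u * (2 * c * inv_sqdist c u z ^+ 2)))%R.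

Let dfield_x u z : R :=
  inv_sqdist c u z - 2 * (u.1 - z.1) ^+ 2 * inv_sqdist c u z ^+ 2.
Let dfield_y u z : R :=
  inv_sqdist c u z - 2 * (u.2 - z.2) ^+ 2 * inv_sqdist c u z ^+ 2.

Let p0 u z : 0 < sqdist u z + c.
Proof. by rewrite ltr_wpDl// sqdist_ge0. Qed.

Let k0 (t : R) : 0 < t ^+ 2 + c.
Proof. by rewrite ltr_wpDl// sqr_ge0. Qed.

Let is_derive_field_x z (y x : R) :
  is_derive x (1 : R) (fun x => field_x c (x, y) z) (dfield_x (x, y) z).
Proof.
rewrite /field_x /dfield_x /inv_sqdist /sqdist /=; under eq_fun do rewrite -addrA.
rewrite -addrA; exact: (is_derive_mul_inv_sqr z.1 (k0 (y - z.2))).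
Qed.

Let is_derive_field_y z (x y : R) :
  is_derive y (1 : R) (fun y => field_y c (x, y) z) (dfield_y (x, y) z).
Proof.
have e (t : R) : (x - z.1) ^+ 2 + (t - z.2) ^+ 2 + c =
  (t - z.2) ^+ 2 + ((x - z.1) ^+ 2 + c) by ring.
rewrite /field_y /dfield_y /inv_sqdist /sqdist /=; under eq_fun do rewrite e.
rewrite e; exact: (is_derive_mul_inv_sqr z.2 (k0 (x - z.1))).
Qed.

Let continuous_dfield_x z (y : R) : continuous (fun x => dfield_x (x, y) z).
Proof.
have h := @continuous_derive_mul_inv_sqr R z.1 _ (k0 (y - z.2)).
apply: eq_continuous h => x.
by rewrite /dfield_x /inv_sqdist /sqdist /= addrA.
Qed.

Let continuous_dfield_y z (x : R) : continuous (fun y => dfield_y (x, y) z).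
Proof.
have h := @continuous_derive_mul_inv_sqr R z.2 _ (k0 (x - z.1)).
apply: eq_continuous h => y.
by rewrite /dfield_y /inv_sqdist /sqdist /= addrA [X in (X + c)^-1]addrC.
Qed.

Let dfield_x_le z u : `|dfield_x u z| <= c^-1.
Proof. by apply: norm_inv_sub_le; rewrite // sqr_ge0 lerDl sqr_ge0. Qed.

Let dfield_y_le z u : `|dfield_y u z| <= c^-1.
Proof. by apply: norm_inv_sub_le; rewrite // sqr_ge0 lerDr sqr_ge0. Qed.

Let measurable_dfield_x z : measurable_fun setT (dfield_x ^~ z).
Proof.
have mi : measurable_fun setT (fun u => inv_sqdist c u z) by apply: measurable_inv_sqdist.
apply: measurable_funB => //; apply: measurable_funM; last exact: measurable_funX.
apply: measurable_funM => //; apply: measurable_funX.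
by apply: measurable_funB.
Qed.

Let measurable_dfield_y z : measurable_fun setT (dfield_y ^~ z).
Proof.
have mi : measurable_fun setT (fun u => inv_sqdist c u z) by apply: measurable_inv_sqdist.
apply: measurable_funB => //; apply: measurable_funM; last exact: measurable_funX.
apply: measurable_funM => //; apply: measurable_funX.
by apply: measurable_funB.
Qed.

Let mfield_x z : measurable_fun setT (field_x c ^~ z).
Proof. by apply: measurable_field_x. Qed.

Let mfield_y z : measurable_fun setT (field_y c ^~ z).
Proof. by apply: measurable_field_y. Qed.

Let lec1 (t : R) : t <= c^-1 -> t <= 1 + c^-1.
Proof. by move=> /le_trans; apply; rewrite lerDr. Qed.

(** Integration by parts in each variable: the two derivatives [dfield_x] and [dfield_y] add up to
    the kernel of [smoothing]. *)
Lemma smoothingE z : smoothing z =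
  - ((\int[mu2]_u (psi1 u * field_x c u z))%R + (\int[mu2]_u (psi2 u * field_y c u z))%R).
Proof.
have [ip1 ip2] := integrable_limsup_quotient cphi phiB phi_partials phi_dirichlet.
have ix := integrable_mul_bounded ip1 (mfield_x z) (fun u => field_x_le c0 u z).
have iy := integrable_mul_bounded ip2 (mfield_y z) (fun u => field_y_le c0 u z).
have idx := integrable_test_mul cphi phiM phiB (@measurable_dfield_x z) (dfield_x_le z).
have idy := integrable_test_mul cphi phiM phiB (@measurable_dfield_y z) (dfield_y_le z).
have ex : (\int[mu2]_u (psi1 u * field_x c u z))%R = - (\int[mu2]_u (phi u * dfield_x u z))%R.
  apply/eqP; rewrite -addr_eq0 -RintegralD//; apply/eqP.
  rewrite /Rintegral; suff -> : (\int[mu2]_u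
    (psi1 u * field_x c u z + phi u * dfield_x u z)%:E = 0)%E by [].
  apply: (integration_by_parts_x cphi phiM phiB phi_partials phi_acl
    phi_dirichlet (L := 1 + c^-1)) => //.
  - by move=> u; exact: field_x_le.
  - by move=> u; exact: lec1.
have ey : (\int[mu2]_u (psi2 u * field_y c u z))%R = - (\int[mu2]_u (phi u * dfield_y u z))%R.
  apply/eqP; rewrite -addr_eq0 -RintegralD//; apply/eqP.
  rewrite /Rintegral; suff -> : (\int[mu2]_u
    (psi2 u * field_y c u z + phi u * dfield_y u z)%:E = 0)%E by [].
  apply: (integration_by_parts_y cphi phiM phiB phi_partials phi_acl
    phi_dirichlet (L := 1 + c^-1)) => //.
  - by move=> u; exact: field_y_le.
  - by move=> u; exact: lec1.
rewrite ex ey -opprD opprK -RintegralD//; apply: eq_Rintegral => u _.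
rewrite -mulrDr; congr (_ * _).
rewrite /dfield_x /dfield_y /inv_sqdist.
have -> : 2 * c * (sqdist u z + c)^-1 ^+ 2 = (2 * (sqdist u z + c) - 2 * sqdist u z) * (sqdist u z + c)^-1 ^+ 2.
  by congr (_ * _); ring.
have E : sqdist u z = (u.1 - z.1) ^+ 2 + (u.2 - z.2) ^+ 2 by [].
rewrite {2}E; field; by rewrite gt_eqF.
Qed.

Lemma integrable_mul_field_diff nu mu :
  mu2.-integrable setT (fun u => (psi1 u * field_diff_x c nu mu u)%:E) /\
  mu2.-integrable setT (fun u => (psi2 u * field_diff_y c nu mu u)%:E).
Proof.
have [ip1 ip2] := integrable_limsup_quotient cphi phiB phi_partials phi_dirichlet.
have bx (P : probability (R * R)%type R) u : `|(\int[P]_z field_x c u z)%R| <= 1 + c^-1.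
  apply: norm_expectation_le => [|z]; last exact: field_x_le.
  by split; [apply: measurable_field_x|exists (1 + c^-1); exact: field_x_le].
have by_ (P : probability (R * R)%type R) u : `|(\int[P]_z field_y c u z)%R| <= 1 + c^-1.
  apply: norm_expectation_le => [|z]; last exact: field_y_le.
  by split; [apply: measurable_field_y|exists (1 + c^-1); exact: field_y_le].
have b1 u : `|field_diff_x c nu mu u| <= (1 + c^-1) + (1 + c^-1).
  by rewrite (le_trans (ler_normB _ _))// lerD.
have b2 u : `|field_diff_y c nu mu u| <= (1 + c^-1) + (1 + c^-1).
  by rewrite (le_trans (ler_normB _ _))// lerD.
split.
  exact: (integrable_mul_bounded ip1 (measurable_field_diff_x c0 nu mu) b1).
exact: (integrable_mul_bounded ip2 (measurable_field_diff_y c0 nu mu) b2).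
Qed.

Lemma smoothing_diffE nu mu :
  (\int[nu]_z smoothing z)%R - (\int[mu]_z smoothing z)%R =
  - (\int[mu2]_u (psi1 u * field_diff_x c nu mu u + psi2 u * field_diff_y c nu mu u))%R.
Proof.
have [ip1 ip2] := integrable_limsup_quotient cphi phiB phi_partials phi_dirichlet.
have mx : measurable_fun setT (fun p : (R * R) * (R * R) => field_x c p.2 p.1).
  by apply: measurable_field_x.
have be1 (p : (R * R) * (R * R)) : `|field_x c p.2 p.1| <= 1 + c^-1.
  exact: field_x_le.
have e1 (P : probability (R * R)%type R) := exchange_bounded_kernel P ip1 mx be1.
have my : measurable_fun setT (fun p : (R * R) * (R * R) => field_y c p.2 p.1).
  by apply: measurable_field_y.
have be2 (p : (R * R) * (R * R)) : `|field_y c p.2 p.1| <= 1 + c^-1.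
  exact: field_y_le.
have e2 (P : probability (R * R)%type R) := exchange_bounded_kernel P ip2 my be2.
have eP (P : probability (R * R)%type R) : (\int[P]_z smoothing z)%R =
    - ((\int[mu2]_u (psi1 u * (\int[P]_z field_x c u z)%R))%R +
       (\int[mu2]_u (psi2 u * (\int[P]_z field_y c u z)%R))%R).
  have [i1 <-] := e1 P; have [i2 <-] := e2 P.
  rewrite -RintegralD// -mulN1r -RintegralZl//; last exact: (integrableD measurableT i1 i2).
  by apply: eq_Rintegral => z _; rewrite smoothingE mulN1r.
have bx (P : probability (R * R)%type R) u : `|(\int[P]_z field_x c u z)%R| <= 1 + c^-1.
  apply: norm_expectation_le => [|z]; last exact: field_x_le.
  by split; [apply: measurable_field_x|exists (1 + c^-1); exact: field_x_le].
have by_ (P : probability (R * R)%type R) u : `|(\int[P]_z field_y c u z)%R| <= 1 + c^-1.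
  apply: norm_expectation_le => [|z]; last exact: field_y_le.
  by split; [apply: measurable_field_y|exists (1 + c^-1); exact: field_y_le].
have ix P := integrable_mul_bounded ip1 (measurable_mean_field_x c0 P) (bx P).
have iy P := integrable_mul_bounded ip2 (measurable_mean_field_y c0 P) (by_ P).
have [ix' iy'] := integrable_mul_field_diff nu mu.
rewrite !eP RintegralD//.
have -> : (\int[mu2]_u (psi1 u * field_diff_x c nu mu u))%R =
    (\int[mu2]_u (psi1 u * (\int[nu]_z field_x c u z)%R))%R -
    (\int[mu2]_u (psi1 u * (\int[mu]_z field_x c u z)%R))%R.
  transitivity (\int[mu2]_u (psi1 u * (\int[nu]_z field_x c u z)%R
      - psi1 u * (\int[mu]_z field_x c u z)%R))%R; last first.
    by apply: plane_RintegralB; [exact: ix|exact: ix].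
  congr fine; apply: eq_integral => u _.
  by rewrite /field_diff_x mulrBr.
have -> : (\int[mu2]_u (psi2 u * field_diff_y c nu mu u))%R =
    (\int[mu2]_u (psi2 u * (\int[nu]_z field_y c u z)%R))%R -
    (\int[mu2]_u (psi2 u * (\int[mu]_z field_y c u z)%R))%R.
  transitivity (\int[mu2]_u (psi2 u * (\int[nu]_z field_y c u z)%R
      - psi2 u * (\int[mu]_z field_y c u z)%R))%R; last first.
    by apply: plane_RintegralB; [exact: iy|exact: iy].
  congr fine; apply: eq_integral => u _.
  by rewrite /field_diff_y mulrBr.
rewrite -opprD; congr (- _).
by rewrite opprD addrACA.
Qed.

(** Cauchy-Schwarz in [smoothing_diffE], with the measurable substitutes [psi1] and [psi2], whose
    square integral is at most the Dirichlet integral. *)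
Lemma sqr_smoothing_diff_le nu mu (X D : R) :
  (dirichlet_integral phi <= D%:E)%E ->
  (\int[mu2]_u (field_diff_x c nu mu u ^+ 2 + field_diff_y c nu mu u ^+ 2)%:E
    <= X%:E)%E ->
  ((\int[nu]_z smoothing z)%R - (\int[mu]_z smoothing z)%R) ^+ 2 <= D * X.
Proof.
move=> phiD FX; rewrite smoothing_diffE sqrrN.
have [ix iy] := integrable_mul_field_diff nu mu.
have mF1 := measurable_field_diff_x c0 nu mu.
have mF2 := measurable_field_diff_y c0 nu mu.
have mphi : measurable_fun setT phi by exact: continuous_measurable_plane.
have mp1 := measurable_limsup_quotient (1, 0) mphi.
have mp2 := measurable_limsup_quotient (0, 1) mphi.
have psiD := le_trans (integral_sqr_limsup_quotient cphi phi_partials) phiD.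
have isq (a b : R * R -> R) (K : R) : measurable_fun setT a -> measurable_fun setT b ->
    (\int[mu2]_u (a u ^+ 2 + b u ^+ 2)%:E <= K%:E)%E ->
    mu2.-integrable setT (fun u => (a u ^+ 2 + b u ^+ 2)%:E) /\
    (\int[mu2]_u (a u ^+ 2 + b u ^+ 2))%R <= K.
  move=> ma mb abK.
  have mab : measurable_fun setT (fun u => (a u ^+ 2 + b u ^+ 2)%:E).
    by apply/measurable_EFinP; apply: measurable_funD; exact: measurable_funX.
  have iab : mu2.-integrable setT (fun u => (a u ^+ 2 + b u ^+ 2)%:E).
    apply/integrableP; split; first exact: mab.
    under eq_integral do rewrite gee0_abs ?lee_fin ?addr_ge0 ?sqr_ge0//.
    by rewrite (le_lt_trans abK)// ltry.
  split=> //; rewrite -lee_fin fineK//; exact: integrable_fin_num.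
have [i1 h1] := isq _ _ _ mp1 mp2 psiD.
have [i2 h2] := isq _ _ _ mF1 mF2 FX.
have i3 := integrableD measurableT ix iy.
apply: le_trans (cauchy_schwarz_integral i1 i2 i3) _.
by apply: ler_pM => //; apply: Rintegral_ge0 => u _; rewrite addr_ge0 ?sqr_ge0.
Qed.

End smoothing.

(** * The Euclidean distance on the plane, compactness and uniformity *)

Section plane_topology.
Variable R : realType.
Implicit Types (z w u : R * R) (K A : set (R * R)).

Lemma minkowski2 (a b c d : R) : Num.sqrt ((a + c) ^+ 2 + (b + d) ^+ 2) <=
  Num.sqrt (a ^+ 2 + b ^+ 2) + Num.sqrt (c ^+ 2 + d ^+ 2).
Proof.
have sq0 (x y : R) : 0 <= x ^+ 2 + y ^+ 2 by rewrite addr_ge0 ?sqr_ge0.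
have le : a * c + b * d <= Num.sqrt (a ^+ 2 + b ^+ 2) * Num.sqrt (c ^+ 2 + d ^+ 2).
  rewrite -sqrtrM// (le_trans (ler_norm _))// -sqrtr_sqr ler_wsqrtr// -subr_ge0.
  by rewrite [leRHS](_ : _ = (a * d - b * c) ^+ 2) ?sqr_ge0//; ring.
rewrite -(@ler_pXn2r _ 2)// ?nnegrE ?addr_ge0 ?sqrtr_ge0// sqr_sqrtr//.
rewrite [leRHS]sqrrD !sqr_sqrtr//.
have -> : (a + c) ^+ 2 + (b + d) ^+ 2 =
  (a ^+ 2 + b ^+ 2) + (a * c + b * d) *+ 2 + (c ^+ 2 + d ^+ 2) by ring.
by rewrite lerD2r lerD2l lerMn2r.
Qed.

Lemma cdist_triangle u z w : cdist z w <= cdist z u + cdist u w.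
Proof.
have := minkowski2 (z.1 - u.1) (z.2 - u.2) (u.1 - w.1) (u.2 - w.2).
by rewrite !addrA !subrK.
Qed.

Lemma norm_fst_le_cdist z w : `|z.1 - w.1| <= cdist z w.
Proof. by rewrite -sqrtr_sqr ler_wsqrtr// lerDl sqr_ge0. Qed.

Lemma norm_snd_le_cdist z w : `|z.2 - w.2| <= cdist z w.
Proof. by rewrite -sqrtr_sqr ler_wsqrtr// lerDr sqr_ge0. Qed.

Lemma cdist_le_norm z w : cdist z w <= `|z.1 - w.1| + `|z.2 - w.2|.
Proof.
have := minkowski2 (z.1 - w.1) 0 0 (z.2 - w.2).
by rewrite !addr0 !add0r expr0n/= addr0 add0r !sqrtr_sqr.
Qed.

(** The topology of the product comes from the sup norm; Euclidean discs and squares are comparable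
    within a factor 2. *)
Lemma nbhs_cdistP z A :
  nbhs z A <-> exists2 e : R, 0 < e & forall w, cdist w z < e -> A w.
Proof.
split.
  move=> /nbhs_ballP[e /= e0 eA]; exists e => // w wz; apply: eA.
  split; rewrite /ball/= distrC; apply: le_lt_trans wz.
    exact: norm_fst_le_cdist.
  exact: norm_snd_le_cdist.
move=> [e e0 eA]; apply/nbhs_ballP; exists (e / 2) => /=; first by rewrite divr_gt0.
move=> w [w1 w2]; apply: eA; apply: le_lt_trans (cdist_le_norm _ _) _.
move: w1 w2; rewrite /ball/= (distrC z.1) (distrC z.2); lra.
Qed.

Lemma continuous_cdist w : continuous (fun z => cdist z w).
Proof.
move=> z; apply/cvgrPdist_lt => e e0; apply/nbhs_cdistP; exists e => // u uz.
apply: le_lt_trans uz; rewrite ler_norml; apply/andP; split.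
  by rewrite lerBrDl lerBlDr addrC; exact: cdist_triangle.
by rewrite lerBlDr (cdistC u z); exact: cdist_triangle.
Qed.

Lemma continuous_sqdist : continuous (fun z : R * R => sqdist z (0, 0)).
Proof.
apply: (@eq_continuous _ _ (fun z => cdist z (0, 0) ^+ 2)) => z; first exact: sqr_cdist.
by apply: cvgM; exact: continuous_cdist.
Qed.

(** Passage from a local to a uniform radius for a property inherited by smaller radii. Boundedness,
    uniform continuity, the continuity principle near [K] and Dini's theorem below all use it. *)
Lemma compact_uniform K (P : R -> R * R -> Prop) : compact K ->
  (forall (d d' : R) z, 0 < d' <= d -> P d z -> P d' z) ->
  (forall z, K z -> exists2 d : R, 0 < d & forall w, K w -> cdist w z < d -> P d w) ->
  exists2 d : R, 0 < d & forall z, K z -> P d z.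
Proof.
move=> /compact_near_coveringP/near_covering_withinP cK monoP locP.
have /cK : Filter (0 : R)^'+ by exact: _.
move=> /(_ P); case=> [z Kz|e /= e0 eK].
  have [d d0 dP] := locP z Kz.
  exists ([set w | cdist w z < d], [set c : R | 0 < c <= d]).
    split; first by apply/nbhs_cdistP; exists d.
    by near=> c => /=; apply/andP; split; near: c; [exact: nbhs_right_gt|exact: nbhs_right_le].
  by move=> [w c] /= [wz cd] Kw; exact: (monoP d c w cd (dP w Kw wz)).
exists (e / 2) => [|z Kz]; first by rewrite divr_gt0.
apply: (eK (e / 2)) => //=; last by rewrite divr_gt0.
by rewrite sub0r normrN gtr0_norm ?divr_gt0// ltr_pdivrMr// ltr_pMr// ltr1n.
Unshelve. all: by end_near. Qed.

Lemma closed_bounded_compact A (b : R) : closed A ->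
  (forall z, A z -> cdist z (0, 0) <= b) -> compact A.
Proof.
move=> clA Ab.
have cb : compact (`[- b, b]%classic `*` `[- b, b]%classic : set (R * R)).
  by apply: compact_setX; exact: segment_compact.
apply: (subclosed_compact clA cb).
move=> z /Ab zb; have := norm_fst_le_cdist z (0, 0).
have := norm_snd_le_cdist z (0, 0); rewrite /= !subr0.
by move=> /le_trans/(_ zb) z2 /le_trans/(_ zb) z1; split;
  rewrite /= in_itv/= -ler_norml.
Qed.

Lemma compact_bounded_plane K : compact K ->
  exists2 b : R, 0 < b & forall z, K z -> cdist z (0, 0) <= b.
Proof.
move=> /compact_bounded[M [_ MK]].
have K1 z : K z -> `|z| <= `|M| + 1.
  by move=> Kz; apply: (MK (`|M| + 1)) => //; rewrite (le_lt_trans (ler_norm M))// ltrDl.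
exists ((`|M| + 1) + (`|M| + 1)); first by have := normr_ge0 M; lra.
move=> z /K1; rewrite ge_max => /andP[z1 z2].
by rewrite (le_trans (cdist_le_norm _ _))//= !subr0 lerD.
Qed.

End plane_topology.

(** At distance at least sqrt s the kernel of parameter [c] is dominated by that of the fixed
    parameter [s], since q + s <= 2 q <= 2 (q + c); the tail of the smoothing is therefore O(c). *)
Lemma inv_sqr_tail_le (R : realFieldType) (q c s : R) : 0 < c -> 0 < s -> s <= q ->
  (q + c)^-1 ^+ 2 <= 4 * (q + s)^-1 ^+ 2.
Proof.
move=> c0 s0 sq; have q0 := lt_le_trans s0 sq.
have -> : 4 * (q + s)^-1 ^+ 2 = (2 * (q + s)^-1) ^+ 2 by ring.
rewrite lerXn2r ?nnegrE ?mulr_ge0 ?invr_ge0 ?addr_ge0 ?(ltW c0) ?(ltW s0) ?(ltW q0)//.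
rewrite ler_pdivlMr ?addr_gt0// mulrC ler_pdivrMr ?addr_gt0//; lra.
Qed.

Lemma tail_small (R : realFieldType) (e M c t p : R) :
  0 < e -> 0 <= M -> 0 < c -> 0 < t -> 0 < p -> c < e / (2 * (16 * M * p / t + 1)) ->
  e / (4 * p) * (2 * p) + 16 * M * c * (p / t) <= e.
Proof.
move=> e0 M0 c0 t0 p0.
have -> : e / (4 * p) * (2 * p) = e / 2 by field; rewrite gt_eqF.
have -> : 16 * M * c * (p / t) = c * (16 * M * p / t) by field; rewrite gt_eqF.
have : 0 <= 16 * M * p / t by rewrite divr_ge0 ?(ltW t0)// !mulr_ge0// ltW.
move: (16 * M * p / t) => D D0.
by rewrite ltr_pdivlMr ?mulr_gt0 ?ltr_wpDl// mulrCA mulrDr; lra.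
Qed.

Section test_function_bounds.
Variables (R : realType) (phi : R * R -> R).
Hypotheses (cphi : continuous phi) (phi_support : compact (closure [set z | phi z != 0])).
Local Notation K := (closure [set z | phi z != 0]).

Let phi_out z : ~ K z -> phi z = 0.
Proof.
move=> nKz; apply/eqP/negPn/negP => phiz; apply: nKz.
exact: (@subset_closure _ [set z | phi z != 0]).
Qed.

Let phi_near z (e : R) : 0 < e ->
  exists2 d : R, 0 < d & forall w, cdist w z < d -> `|phi w - phi z| < e.
Proof.
move=> e0; have /cvgrPdist_lt/(_ _ e0) := cphi (x := z).
by move=> /nbhs_cdistP[d d0 dP]; exists d => // w /dP; rewrite distrC.
Qed.

Lemma compact_support_bounded : exists M : R, forall z, `|phi z| <= M.
Proof.
have [||d d0 dK] := @compact_uniform R K (fun d z => `|phi z| <= d^-1) phi_support.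
- move=> d d' z /andP[d'0 d'd] /le_trans; apply.
  by rewrite lef_pV2 ?posrE// (lt_le_trans d'0).
- move=> z Kz; have [d d0 dP] := phi_near z ltr01.
  have pz : 0 < `|phi z| + 1 by rewrite ltr_wpDl.
  exists (Num.min d (`|phi z| + 1)^-1); first by rewrite lt_min d0 invr_gt0.
  move=> w _; rewrite lt_min => /andP[/dP h _].
  have : `|phi w| <= `|phi z| + 1.
    by have := ler_distD 0 (phi w) (phi z); have := lerB_dist (phi w) (phi z); lra.
  move=> /le_trans; apply.
  rewrite -[leLHS]invrK lef_pV2 ?posrE ?invr_gt0// ?lt_min ?d0 ?invr_gt0//.
  by rewrite ge_min lexx orbT.
exists d^-1 => z; have [/dK//|/phi_out ->] := pselect (K z).
by rewrite normr0 invr_ge0 ltW.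
Qed.

Lemma compact_support_uniformly_continuous (e : R) : 0 < e ->
  exists2 d : R, 0 < d & forall z w, cdist w z < d -> `|phi w - phi z| <= e.
Proof.
move=> e0.
have [||d d0 dK] := @compact_uniform R K
    (fun d z => forall w, cdist w z < d -> `|phi w - phi z| <= e) phi_support.
- by move=> d d' z /andP[_ d'd] h w wz; apply: h; exact: lt_le_trans wz d'd.
- move=> z Kz; have [d d0 dP] := phi_near z (divr_gt0 e0 (ltr0n R 2)).
  exists (d / 2) => [|w _ wz u uw]; first by rewrite divr_gt0.
  have uz : cdist u z < d.
    by have := cdist_triangle w u z; lra.
  have wz' : cdist w z < d by lra.
  have := dP _ uz; have := dP _ wz'; have := ler_distD (phi z) (phi u) (phi w).
  by rewrite (distrC (phi z)); lra.
exists d => // z w wz; have [/dK|/phi_out z0] := pselect (K z); first exact.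
have [Kw|/phi_out ->] := pselect (K w); last by rewrite z0 subrr normr0 ltW.
by rewrite distrC; apply: dK => //; rewrite cdistC.
Qed.

Lemma compact_support_box : exists B : R,
  forall p, B <= `|p.1| \/ B <= `|p.2| -> phi p = 0.
Proof.
have [b b0 bK] := compact_bounded_plane phi_support.
exists (b + 1) => p bp; apply: phi_out => /bK.
have := norm_fst_le_cdist p (0, 0); have := norm_snd_le_cdist p (0, 0).
by rewrite /= !subr0; case: bp; lra.
Qed.

Local Notation mu2 := (plane_measure R).

Lemma integrable_inv_sqdist_sqr (c : R) z : 0 < c ->
  mu2.-integrable setT (fun u => (inv_sqdist c u z ^+ 2)%:E).
Proof.
move=> c0; have mi : measurable_fun setT (fun u => (inv_sqdist c u z ^+ 2)%:E).
  by apply/measurable_EFinP; apply: measurable_funX; apply: measurable_inv_sqdist.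
apply/integrableP; split; first exact: mi.
under eq_integral do rewrite gee0_abs ?lee_fin ?sqr_ge0// exprVn.
by rewrite integral_inv_sqdist// ltry.
Qed.

(** Approximate identity, uniform in [z]: uniform continuity of [phi] handles |u - z| < s, and
    [inv_sqr_tail_le] the rest. *)
Lemma smoothing_approx (e : R) : 0 < e -> exists2 d : R, 0 < d &
  forall (c : R) z, 0 < c < d -> `|smoothing phi c z - 2 * pi * phi z| <= e.
Proof.
move=> e0.
have [M phiM] := compact_support_bounded.
have M0 : 0 <= M by rewrite (le_trans _ (phiM (0, 0))).
have ppi := pi_gt0 R.
have e1 : 0 < e / (4 * pi) by rewrite divr_gt0// mulr_gt0.
have [s s0 sP] := compact_support_uniformly_continuous e1.
pose D := 16 * M * pi / s ^+ 2 + 1.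
have D0 : 0 < D by rewrite ltr_wpDl// divr_ge0 ?sqr_ge0// !mulr_ge0// ltW.
exists (e / (2 * D)) => [|c z /andP[c0 cd]]; first by rewrite divr_gt0// mulr_gt0.
have mphi : measurable_fun setT phi by exact: continuous_measurable_plane.
have i1 := integrable_inv_sqdist_sqr z c0.
have s20 : 0 < s ^+ 2 by rewrite exprn_gt0.
have i2 := integrable_inv_sqdist_sqr z s20.
have i3 : mu2.-integrable setT (fun u => (2 * c * inv_sqdist c u z ^+ 2)%:E).
  exact: (integrableZl measurableT (2 * c) i1).
have i4 : mu2.-integrable setT (fun u => (2 * c * inv_sqdist c u z ^+ 2 * phi u)%:E).
  exact: (integrable_mul_bounded i3 mphi phiM).
have i5 : mu2.-integrable setT (fun u => (2 * c * inv_sqdist c u z ^+ 2 * phi z)%:E).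
  have mz : measurable_fun setT (fun _ : R * R => phi z) by exact: measurable_cst.
  exact: (integrable_mul_bounded i3 mz (fun=> phiM z)).
have i6 : mu2.-integrable setT (fun u => (e / (4 * pi) * (2 * c * inv_sqdist c u z ^+ 2))%:E).
  exact: (integrableZl measurableT (e / (4 * pi)) i3).
have i7 : mu2.-integrable setT (fun u => (16 * M * c * inv_sqdist (s ^+ 2) u z ^+ 2)%:E).
  exact: (integrableZl measurableT (16 * M * c) i2).
have i8 : mu2.-integrable setT (EFin \o (fun u =>
    e / (4 * pi) * (2 * c * inv_sqdist c u z ^+ 2) +
    16 * M * c * inv_sqdist (s ^+ 2) u z ^+ 2)).
  exact: (integrableD measurableT i6 i7).
have i9 : mu2.-integrable setT (EFin \o (fun u =>
    2 * c * inv_sqdist c u z ^+ 2 * phi u - 2 * c * inv_sqdist c u z ^+ 2 * phi z)).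
  exact: (integrableB measurableT i4 i5).
have i10 : mu2.-integrable setT (EFin \o (fun u =>
    `|2 * c * inv_sqdist c u z ^+ 2 * phi u - 2 * c * inv_sqdist c u z ^+ 2 * phi z|)).
  exact: (integrable_abse i9).
have E1 : (\int[mu2]_u (2 * c * inv_sqdist c u z ^+ 2))%R = 2 * pi.
  rewrite RintegralZl//.
  have -> : (\int[mu2]_u (inv_sqdist c u z ^+ 2))%R = pi / c.
    rewrite /Rintegral; under eq_integral do rewrite exprVn.
    by rewrite integral_inv_sqdist.
  by field; rewrite gt_eqF.
have E2 : (\int[mu2]_u (inv_sqdist (s ^+ 2) u z ^+ 2))%R = pi / s ^+ 2.
  rewrite /Rintegral; under eq_integral do rewrite exprVn.
  by rewrite integral_inv_sqdist.
have -> : smoothing phi c z - 2 * pi * phi z =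
   (\int[mu2]_u (2 * c * inv_sqdist c u z ^+ 2 * phi u
     - 2 * c * inv_sqdist c u z ^+ 2 * phi z))%R.
  rewrite RintegralB// RintegralZr// E1; congr (_ - _).
  by apply: eq_Rintegral => u _; rewrite mulrC.
apply: le_trans (le_normr_Rintegral measurableT i9) _.
apply: le_trans (le_Rintegral measurableT i10 i8 _) _.
  move=> u _; have eta0 : 0 <= 2 * c * inv_sqdist c u z ^+ 2.
    by rewrite mulr_ge0 ?sqr_ge0// mulr_ge0// ltW.
  rewrite -mulrBr normrM (ger0_norm eta0).
  have [/sP us|su] := ltP (cdist u z) s.
    rewrite (le_trans (_ : _ <= e / (4 * pi) * (2 * c * inv_sqdist c u z ^+ 2)))//.
      by rewrite mulrC ler_wpM2r.
    by rewrite lerDl mulr_ge0 ?sqr_ge0// !mulr_ge0// ltW.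
  apply: le_trans (_ : _ <= 16 * M * c * inv_sqdist (s ^+ 2) u z ^+ 2) _; last first.
    by rewrite lerDr mulr_ge0// ltW.
  have sq : s ^+ 2 <= sqdist u z.
    by rewrite -sqr_cdist lerXn2r ?nnegrE ?cdist_ge0// ltW.
  (* The factor 16 is 2 from the kernel, 4 from the tail comparison and 2 from
     [|phi u - phi z| <= 2 * M]. *)
  have -> : 16 * M * c * inv_sqdist (s ^+ 2) u z ^+ 2 =
      2 * c * (4 * inv_sqdist (s ^+ 2) u z ^+ 2) * (M + M) by ring.
  apply: ler_pM => //.
  - rewrite -!mulrA ler_wpM2l ?ler0n// ler_wpM2l ?(ltW c0)//.
    exact: inv_sqr_tail_le.
  - by rewrite (le_trans (ler_normB _ _))// lerD.
have E3 : (\int[mu2]_u (e / (4 * pi) * (2 * c * inv_sqdist c u z ^+ 2)))%R =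
    e / (4 * pi) * (2 * pi) by rewrite RintegralZl// E1.
have E4 : (\int[mu2]_u (16 * M * c * inv_sqdist (s ^+ 2) u z ^+ 2))%R =
    16 * M * c * (pi / s ^+ 2) by rewrite RintegralZl// E2.
rewrite RintegralD// E3 E4.
exact: (@tail_small _ e M c (s ^+ 2) pi).
Qed.

End test_function_bounds.

(** * Integrals of functions controlled only on a set of full measure *)

Section almost_sure_domain.
Context d (T : measurableType d) (R : realType) (P : probability T R).
Variable D : set T.
Hypotheses (mD : measurable D) (PD : P (~` D) = 0%E).
Local Open Scope ereal_scope.
Implicit Types (f g : T -> \bar R).

Lemma probability_domain : P D = 1.
Proof.
have := probability_setC P mD; rewrite PD => /esym/eqP.
rewrite sube_eq ?fin_num_measure// add0e => /eqP <-.
by [].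
Qed.

Lemma integral_cst_domain (k : R) : \int[P]_(x in D) k%:E = k%:E.
Proof.
by rewrite integral_cst//; have /= -> := probability_domain; rewrite mule1.
Qed.

Lemma integral_domain f : measurable_fun setT f ->
  \int[P]_x f x = \int[P]_(x in D) f x.
Proof.
move=> mf; rewrite [RHS]integral_mkcond; apply: ae_eq_integral => //.
  by apply/(measurable_restrictT f mD); exact: measurable_funTS.
exists (~` D); split => // [|x /= nfx]; first exact: measurableC.
by move=> Dx; apply: nfx => _; rewrite patchE mem_set.
Qed.

(** The logarithmic kernel is unbounded below on the plane but not on a compact set. Shifting by [C]
    on the domain reduces its integrals to nonnegative ones, for which monotonicity, additivity and
    monotone convergence hold. *)
Lemma integral_shift f (C : R) : measurable_fun setT f -> (0 <= C)%R ->
  (forall x, D x -> - C%:E <= f x) ->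
  \int[P]_x f x = \int[P]_(x in D) (f x + C%:E) - C%:E.
Proof.
move=> mf C0 fC; rewrite integral_domain//.
have mfD : measurable_fun D f by exact: measurable_funTS.
have mfp : measurable_fun D (f ^\+) by exact: measurable_funepos.
have mfn : measurable_fun D (f ^\-) by exact: measurable_funeneg.
have fC0 x : D x -> 0 <= f x + C%:E by move=> /fC; rewrite -leeBlDr// sub0e.
have fn : \int[P]_(x in D) f^\- x \is a fin_num.
  rewrite ge0_fin_numE; last by apply: integral_ge0 => x _; exact: funeneg_ge0.
  apply: (@le_lt_trans _ _ (\int[P]_(x in D) C%:E)).
    apply: ge0_le_integral => // [x Dx]; rewrite funenegE ge_max lee_fin C0 andbT.
    by rewrite leeNl; exact: fC.
  by rewrite integral_cst_domain ltry.
have E : \int[P]_(x in D) (f x + C%:E) + \int[P]_(x in D) f^\- x =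
    \int[P]_(x in D) f^\+ x + C%:E.
  rewrite -[X in _ = _ + X]integral_cst_domain.
  rewrite -!ge0_integralD//; last exact: emeasurable_funD.
  apply: eq_integral => x; rewrite inE => Dx.
  rewrite addeAC; congr (_ + _); rewrite funeposE funenegE.
  case: (f x) (fC x Dx) => [r| |]//= _; rewrite ?maxNye ?addye//.
  rewrite -EFin_max -EFin_max -EFinD; congr EFin.
  by rewrite /Num.max; do 2 case: ifPn; rewrite -?leNgt; lra.
rewrite integralE -(@addeK _ _ (\int[P]_(x in D) (f x + C%:E)) fn) E.
by rewrite addeAC addeK.
Qed.

Lemma le_integral_domain f g (C : R) : measurable_fun setT f -> measurable_fun setT g ->
  (0 <= C)%R -> (forall x, D x -> - C%:E <= f x) -> (forall x, D x -> f x <= g x) ->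
  \int[P]_x f x <= \int[P]_x g x.
Proof.
move=> mf mg C0 fC fg.
have gC x : D x -> - C%:E <= g x by move=> Dx; exact: le_trans (fC x Dx) (fg x Dx).
rewrite !(integral_shift _ C0)// leeD2r//; apply: ge0_le_integral => //.
- by move=> x /fC; rewrite -leeBlDr// sub0e.
- by apply: emeasurable_funD => //; exact: measurable_funTS.
- by apply: emeasurable_funD => //; exact: measurable_funTS.
- by move=> x Dx; rewrite leeD2r// fg.
Qed.

Lemma cvg_integral_domain (f_ : (T -> \bar R)^nat) f (C : R) :
  (forall n, measurable_fun setT (f_ n)) -> measurable_fun setT f ->
  (0 <= C)%R -> (forall n x, D x -> - C%:E <= f_ n x) ->
  (forall x, D x -> nondecreasing_seq (f_ ^~ x)) ->
  (forall x, D x -> f_ ^~ x @ \oo --> f x) ->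
  (fun n => \int[P]_x f_ n x) @ \oo --> \int[P]_x f x.
Proof.
move=> mf_ mf C0 fC nd cv.
have fC' x : D x -> - C%:E <= f x.
  move=> Dx; have <- : limn (f_ ^~ x) = f x by apply/cvg_lim => //; exact: cv.
  apply: lime_ge; first by apply: ereal_nondecreasing_is_cvgn; exact: nd.
  by apply: nearW => n; exact: fC.
rewrite (integral_shift mf C0)//.
under eq_fun do rewrite (integral_shift (mf_ _) C0 (fC _)).
apply: cvgeB; [by rewrite fin_num_adde_defl| |exact: cvg_cst].
have -> : \int[P]_(x in D) (f x + C%:E) =
    \int[P]_(x in D) (limn (fun n => f_ n x + C%:E)).
  apply: eq_integral => x; rewrite inE => Dx; apply/esym/cvg_lim => //.
  by apply: cvgeD; [rewrite fin_num_adde_defl|exact: cv|exact: cvg_cst].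
apply: cvg_monotone_convergence => //.
- by move=> n; apply: emeasurable_funD => //; exact: measurable_funTS.
- by move=> n x Dx; rewrite -leeBlDr// sub0e fC.
- by move=> x Dx m n mn; rewrite leeD2r// nd.
Qed.

Lemma expectation_domain_integrable (f : T -> R) (C : R) : measurable_fun setT f ->
  (forall x, D x -> (`|f x| <= C)%R) -> P.-integrable setT (EFin \o f).
Proof.
move=> mf fC; have mCD := measurableC mD.
apply/(negligible_integrable mCD measurableT _ PD); first exact/measurable_EFinP.
rewrite setTD setCK; apply: measurable_bounded_integrable => //.
- by have /= -> := probability_domain; rewrite ltry.
- exact: measurable_funTS.
- exists C; split; first exact: num_real.
  by move=> M CM x Dx; exact: le_trans (fC x Dx) (ltW CM).
Qed.

Lemma expectation_domain_le (f : T -> R) (C K : R) : measurable_fun setT f ->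
  (0 <= C)%R -> (forall x, D x -> (`|f x| <= C)%R) -> (forall x, D x -> (f x <= K)%R) ->
  ((\int[P]_x f x)%R <= K)%R.
Proof.
move=> mf C0 fC fK; rewrite -lee_fin fineK; last first.
  apply: integrable_fin_num => //; exact: expectation_domain_integrable fC.
rewrite -[leRHS]integral_cst_domain -(integral_domain (measurable_cst _)).
apply: (@le_integral_domain _ _ C) => //; first exact/measurable_EFinP.
by move=> x /fC; rewrite lee_fin ler_norml => /andP[].
Qed.

End almost_sure_domain.

(** * Logarithmic potentials *)

Section smooth_log_kernel.
Variable R : realType.
Implicit Types (z w : R * R) (c : R).

Lemma log_kernel_diag z : log_kernel z z = +oo%E.
Proof.
rewrite /log_kernel; suff -> : cdist z z = 0 by rewrite le0_lneNy.
by apply/eqP; rewrite eq_le cdist_ge0 leNgt cdist_gt0 eqxx.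
Qed.

Lemma log_kernelE z w : z != w -> log_kernel z w = (- ln (cdist z w))%:E.
Proof. by move=> zw; rewrite /log_kernel lne_EFin// cdist_gt0. Qed.

Lemma ln_cdist z w : z != w -> ln (cdist z w) = ln (sqdist z w) / 2.
Proof.
move=> zw; rewrite -sqr_cdist lnXn ?cdist_gt0//.
by rewrite -(mulr_natl (ln _)); field.
Qed.

Lemma le_smooth_log c c' z w : 0 < c <= c' -> smooth_log c' z w <= smooth_log c z w.
Proof.
move=> /andP[c0 cc']; rewrite lerN2 ler_pM2r ?invr_gt0// ler_ln ?posrE ?lerD2l//.
  by rewrite ltr_wpDl// sqdist_ge0.
by rewrite ltr_wpDl ?sqdist_ge0// (lt_le_trans c0).
Qed.

Lemma smooth_log_le_log_kernel c z w : 0 < c ->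
  ((smooth_log c z w)%:E <= log_kernel z w)%E.
Proof.
move=> c0; have [->|zw] := eqVneq z w; first by rewrite log_kernel_diag leey.
rewrite log_kernelE// lee_fin lerN2 ln_cdist// ler_pM2r ?invr_gt0//.
have q0 : 0 < sqdist z w by rewrite -sqr_cdist exprn_gt0// cdist_gt0.
have qc0 : 0 < sqdist z w + c by rewrite addr_gt0.
by rewrite ler_ln ?posrE// lerDl ltW.
Qed.

Lemma smooth_log_bound c z w (Q : R) : 0 < c -> sqdist z w <= Q ->
  - (ln (Q + c) / 2) <= smooth_log c z w <= - (ln c / 2).
Proof.
move=> c0 zQ; have q0 := sqdist_ge0 z w; have Q0 := le_trans q0 zQ.
have qc0 : 0 < sqdist z w + c by rewrite ltr_wpDl.
have Qc0 : 0 < Q + c by rewrite ltr_wpDl.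
by rewrite !lerN2 !ler_pM2r ?invr_gt0// !ler_ln ?posrE// lerD2r zQ lerDr.
Qed.

Lemma norm_smooth_log_le c z w (Q : R) : 0 < c -> sqdist z w <= Q ->
  `|smooth_log c z w| <= `|ln (Q + c) / 2| + `|ln c / 2|.
Proof.
move=> c0 /(smooth_log_bound c0); rewrite ler_norml => /andP[h1 h2].
have := ler_norm (ln (Q + c) / 2); have := ler_norm (- (ln c / 2)); rewrite normrN.
have := normr_ge0 (ln (Q + c) / 2); have := normr_ge0 (ln c / 2).
by move=> ? ? ? ?; apply/andP; split; lra.
Qed.

(** From ln x <= x - 1 at the ratio of the two arguments, with denominator at least [c]; the bound
    involves [w] only through |z - w|, hence is uniform over a compact support. *)
Lemma smooth_log_lipschitz c z z' w : 0 < c ->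
  smooth_log c z w - smooth_log c z' w <=
  cdist z z' * (2 * cdist z w + cdist z z') / (2 * c).
Proof.
move=> c0; have q0 := sqdist_ge0 z w; have q'0 := sqdist_ge0 z' w.
have p0 : 0 < sqdist z w + c by rewrite ltr_wpDl.
have p'0 : 0 < sqdist z' w + c by rewrite ltr_wpDl.
have -> : smooth_log c z w - smooth_log c z' w =
    ln ((sqdist z' w + c) / (sqdist z w + c)) / 2.
  by rewrite /smooth_log ln_div ?posrE//; ring.
have h := @ln_le_subr1 _ _ (divr_gt0 p'0 p0).
set D := cdist z z' * _.
have D0 : 0 <= D by rewrite mulr_ge0 ?addr_ge0 ?mulr_ge0 ?cdist_ge0.
have hq : sqdist z' w - sqdist z w <= D.
  rewrite -!sqr_cdist subr_sqr /D mulrC (mulrC (cdist z z')).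
  have := cdist_triangle z z' w; have := cdist_ge0 z z'; have := cdist_ge0 z w.
  have := cdist_ge0 z' w; rewrite (cdistC z' z).
  move: (cdist z' w) (cdist z w) (cdist z z') => x y t x0 y0 t0 xyt.
  have [xy|yx] := leP x y.
    by apply: (@le_trans _ _ 0); [rewrite mulr_ge0_le0 ?addr_ge0 ?subr_le0|
      rewrite mulr_ge0// addr_ge0// mulr_ge0].
  by apply: ler_pM; rewrite ?subr_ge0; lra.
have e1 : (sqdist z' w + c) / (sqdist z w + c) - 1 =
    (sqdist z' w - sqdist z w) / (sqdist z w + c).
  by field; rewrite gt_eqF.
have e2 : (sqdist z' w - sqdist z w) / (sqdist z w + c) <= D / c.
  apply: (@le_trans _ _ (D / (sqdist z w + c))).
    by rewrite ler_pM2r ?invr_gt0.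
  by rewrite ler_wpM2l// lef_pV2 ?posrE// lerDr.
have -> : D / (2 * c) = D / c / 2 by field; rewrite gt_eqF.
by rewrite ler_pM2r ?invr_gt0// (le_trans h)// e1.
Qed.

Lemma cvg_smooth_log z w :
  (fun n : nat => (smooth_log n.+1%:R^-1 z w)%:E) @ \oo --> log_kernel z w.
Proof.
have [<-|zw] := eqVneq z w; last first.
  rewrite log_kernelE// ln_cdist//; apply/cvg_EFin; first exact: nearW.
  have q0 : 0 < sqdist z w by rewrite -sqr_cdist exprn_gt0// cdist_gt0.
  have h : sqdist z w + n.+1%:R^-1 @[n --> \oo] --> sqdist z w.
    rewrite -[X in _ --> X]addr0; apply: cvgD; first exact: cvg_cst.
    exact: (@cvg_harmonic R).
  apply: cvgN; apply: cvgMr_tmp; apply: (cvg_comp _ (@ln R) h).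
  exact: continuous_ln.
rewrite log_kernel_diag; apply/cvgeyPge => A; near=> n.
rewrite lee_fin /smooth_log.
have -> : sqdist z z = 0 by apply/eqP; rewrite sqdist_eq0.
rewrite add0r lnV ?posrE// mulNr opprK ler_pdivlMr// -(expRK (A * 2)).
rewrite ler_ln ?posrE ?expR_gt0//; apply: (@le_trans _ _ n%:R); last by rewrite ler_nat.
by near: n; exact: nbhs_infty_ger.
Unshelve. all: by end_near. Qed.

Lemma measurable_smooth_log d (T : measurableType d) (f g : T -> R * R) c :
  0 < c -> measurable_fun setT f -> measurable_fun setT g ->
  measurable_fun setT (fun x => smooth_log c (f x) (g x)).
Proof.
move=> c0 mf mg; apply: measurable_funN; apply: measurable_funM => //.
apply: measurableT_comp; first exact: measurable_ln.
by apply: measurable_funD => //; exact: measurable_sqdist.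
Qed.

Lemma measurable_log_kernel d (T : measurableType d) (f g : T -> R * R) :
  measurable_fun setT f -> measurable_fun setT g ->
  measurable_fun setT (fun x => log_kernel (f x) (g x)).
Proof.
move=> mf mg; apply: (@emeasurable_fun_cvg _ _ _ _
  (fun n x => (smooth_log n.+1%:R^-1 (f x) (g x))%:E)).
  by move=> n; apply/measurable_EFinP; exact: measurable_smooth_log.
by move=> x _; exact: cvg_smooth_log.
Qed.

End smooth_log_kernel.

Section potential.
Variables (R : realType) (E : set (R * R)) (mu : probability (R * R)%type R).
Hypotheses (cE : compact E) (muE : supported_on E mu).
Implicit Types (z w : R * R) (c : R).

Let mE : measurable E.
Proof.
rewrite -[E]setCK; apply: measurableC; apply: open_measurable_plane.
rewrite openC; apply: compact_closed => //; exact: norm_hausdorff.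
Qed.

Definition smooth_potential c z : R := (\int[mu]_w smooth_log c z w)%R.

Let ms c z : 0 < c -> measurable_fun setT (fun w => smooth_log c z w).
Proof. by move=> c0; exact: measurable_smooth_log. Qed.

Let mse c z : 0 < c -> measurable_fun setT (fun w => (smooth_log c z w)%:E).
Proof. by move=> c0; apply/measurable_EFinP; exact: ms. Qed.

Let mlk z : measurable_fun setT (fun w => log_kernel z w).
Proof. exact: measurable_log_kernel. Qed.

Lemma sqdist_bounded z : exists2 Q : R, 0 <= Q & forall w, E w -> sqdist z w <= Q.
Proof.
have [b b0 Eb] := compact_bounded_plane cE.
exists ((cdist z (0, 0) + b) ^+ 2) => [|w Ew]; first exact: sqr_ge0.
rewrite -sqr_cdist lerXn2r ?nnegrE ?addr_ge0 ?cdist_ge0 ?(ltW b0)//.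
by rewrite (le_trans (cdist_triangle (0, 0) _ _))// lerD2l cdistC Eb.
Qed.

Lemma smooth_log_bounded c z : 0 < c ->
  exists2 C : R, 0 <= C & forall w, E w -> `|smooth_log c z w| <= C.
Proof.
move=> c0; have [Q Q0 zQ] := sqdist_bounded z.
exists (`|ln (Q + c) / 2| + `|ln c / 2|) => [|w Ew]; first by rewrite addr_ge0.
by apply: norm_smooth_log_le => //; exact: zQ.
Qed.

Lemma integrable_smooth_log c z : 0 < c ->
  mu.-integrable setT (EFin \o (fun w => smooth_log c z w)).
Proof.
move=> c0; have [C _ zC] := smooth_log_bounded z c0.
exact: (expectation_domain_integrable mE muE (ms z c0) zC).
Qed.

Lemma EFin_smooth_potential c z : 0 < c ->
  ((smooth_potential c z)%:E = \int[mu]_w (smooth_log c z w)%:E)%E.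
Proof.
by move=> c0; rewrite fineK//; apply: integrable_fin_num => //; exact: integrable_smooth_log.
Qed.

Lemma smooth_potential_le c z : 0 < c ->
  ((smooth_potential c z)%:E <= log_potential mu z)%E.
Proof.
move=> c0; have [C C0 zC] := smooth_log_bounded z c0.
rewrite EFin_smooth_potential//; apply: (le_integral_domain mE muE _ _ C0) => //.
- exact: mse.
- by move=> w /zC; rewrite lee_fin ler_norml => /andP[].
- by move=> w _; exact: smooth_log_le_log_kernel.
Qed.

Lemma le_smooth_potential c c' z : 0 < c <= c' ->
  smooth_potential c' z <= smooth_potential c z.
Proof.
move=> cc'; have /andP[c0 c'c] := cc'; have c'0 := lt_le_trans c0 c'c.
apply: le_Rintegral => //; [exact: integrable_smooth_log|exact: integrable_smooth_log|].
by move=> w _; exact: le_smooth_log.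
Qed.

Lemma cvg_smooth_potential z :
  (fun n : nat => (smooth_potential n.+1%:R^-1 z)%:E) @ \oo --> log_potential mu z.
Proof.
have [C C0 zC] := smooth_log_bounded z ltr01.
under eq_fun do rewrite EFin_smooth_potential//.
apply: (cvg_integral_domain mE muE (C := C)) => //.
- by move=> n; exact: mse.
- move=> n w /zC; rewrite lee_fin ler_norml => /andP[+ _].
  by move=> /le_trans; apply; apply: le_smooth_log; rewrite invr_gt0 ltr0n invf_le1// ler1n.
- move=> w _ m n mn; rewrite lee_fin; apply: le_smooth_log.
  by rewrite invr_gt0 ltr0n lef_pV2 ?posrE// ler_nat ltnS.
- by move=> w _; exact: cvg_smooth_log.
Qed.

(** The potential is the increasing limit of the continuous smooth potentials, so a strict lower
    bound is already reached at some [c]. This carries the lower semicontinuity of the potential. *)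
Lemma lt_log_potential (a : R) z : (a%:E < log_potential mu z)%E ->
  exists2 c : R, 0 < c & a < smooth_potential c z.
Proof.
move=> aU; apply: contrapT => nc.
have : (log_potential mu z <= a%:E)%E.
  have cz := @cvg_smooth_potential z; have <- := cvg_lim _ cz; last by [].
  apply: lime_le; first by apply/cvg_ex; exists (log_potential mu z).
  apply: nearW => n; rewrite lee_fin leNgt; apply/negP => an; apply: nc.
  by exists n.+1%:R^-1.
by rewrite leNgt aU.
Qed.

Lemma smooth_potential_lipschitz c z : 0 < c -> exists2 K : R, 0 <= K &
  forall z', cdist z z' <= 1 ->
    `|smooth_potential c z - smooth_potential c z'| <= cdist z z' * K.
Proof.
move=> c0; have [b b0 Eb] := compact_bounded_plane cE.
pose K := (2 * (cdist z (0, 0) + 1 + b) + 1) / (2 * c).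
have K0 : 0 <= K.
  by rewrite divr_ge0 ?mulr_ge0 ?(ltW c0)// addr_ge0// mulr_ge0// !addr_ge0 ?cdist_ge0 ?(ltW b0).
exists K => // z' zz'.
have h z1 z2 : cdist z1 z2 <= 1 -> cdist z1 (0, 0) <= cdist z (0, 0) + 1 ->
    smooth_potential c z1 - smooth_potential c z2 <= cdist z1 z2 * K.
  move=> z12 z1z.
  have i1 := integrable_smooth_log z1 c0; have i2 := integrable_smooth_log z2 c0.
  rewrite -RintegralB//; have [C1 C10 hC1] := smooth_log_bounded z1 c0.
  have [C2 C20 hC2] := smooth_log_bounded z2 c0.
  apply: (expectation_domain_le mE muE (C := C1 + C2)).
  - by apply: measurable_funB; exact: ms.
  - exact: addr_ge0.
  - by move=> w Ew; apply: le_trans (ler_normB _ _) _; exact: lerD (hC1 w Ew) (hC2 w Ew).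
  - move=> w Ew; apply: le_trans (smooth_log_lipschitz _ _ _ c0) _.
    rewrite -mulrA ler_wpM2l ?cdist_ge0// ler_pM2r ?invr_gt0 ?mulr_gt0// lerD//.
    rewrite ler_pM2l// (le_trans (cdist_triangle (0, 0) _ _))// lerD// cdistC.
    exact: Eb.
rewrite ler_norml lerNl opprB; apply/andP; split; last by apply: h; rewrite // lerDl.
rewrite cdistC; apply: h; first by rewrite cdistC.
by rewrite (le_trans (cdist_triangle z _ _))// addrC lerD2l cdistC.
Qed.

Lemma continuous_smooth_potential c : 0 < c -> continuous (smooth_potential c).
Proof.
move=> c0 z; have [K K0 zK] := smooth_potential_lipschitz z c0.
apply/cvgrPdist_lt => e e0; apply/nbhs_cdistP.
have K1 : 0 < K + 1 by rewrite ltr_wpDl.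
exists (Num.min 1 (e / (K + 1))) => [|w]; first by rewrite lt_min ltr01 divr_gt0.
rewrite lt_min cdistC => /andP[/ltW w1 we]; apply: le_lt_trans (zK w w1) _.
apply: (@le_lt_trans _ _ (cdist z w * (K + 1))).
  by rewrite ler_wpM2l ?cdist_ge0// lerDl.
by rewrite -ltr_pdivlMr.
Qed.

Lemma smooth_potential_bounded (b : R) c : 0 < c -> exists2 C : R, 0 <= C &
  forall z, cdist z (0, 0) <= b -> `|smooth_potential c z| <= C.
Proof.
move=> c0; have [e e0 Ee] := compact_bounded_plane cE.
pose Q : R := (`|b| + e) ^+ 2; pose C : R := `|ln (Q + c) / 2| + `|ln c / 2|.
have C0 : 0 <= C by rewrite addr_ge0.
exists C => // z zb; have LC w : E w -> `|smooth_log c z w| <= C.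
  move=> Ew; have zw : sqdist z w <= Q.
    rewrite -sqr_cdist lerXn2r ?nnegrE ?addr_ge0 ?cdist_ge0 ?(ltW e0)//.
    rewrite (le_trans (cdist_triangle (0, 0) _ _))// lerD ?(le_trans zb) ?ler_norm//.
    by rewrite cdistC Ee.
  exact: norm_smooth_log_le.
have h := expectation_domain_le mE muE _ C0.
have NE : - smooth_potential c z = (\int[mu]_w - smooth_log c z w)%R.
  rewrite -mulN1r -RintegralZl//; last exact: integrable_smooth_log.
  by apply: eq_Rintegral => w _; rewrite mulN1r.
rewrite ler_norml lerNl NE; apply/andP; split; apply: h => //; try exact: ms.
- by apply: measurable_funN; exact: ms.
- by move=> w Ew; rewrite normrN; exact: LC.
- by move=> w Ew; have := LC w Ew; rewrite ler_norml lerNl => /andP[].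
- by move=> w Ew; have := LC w Ew; rewrite ler_norml => /andP[].
Qed.

Lemma measurable_log_potential : measurable_fun setT (log_potential mu).
Proof.
apply: (@emeasurable_fun_cvg _ _ _ _ (fun n z => (smooth_potential n.+1%:R^-1 z)%:E)).
  move=> n; apply/measurable_EFinP; apply: continuous_measurable_plane.
  exact: continuous_smooth_potential.
by move=> z _; exact: cvg_smooth_potential.
Qed.

Lemma smooth_energy_le c : 0 < c ->
  ((\int[mu]_z smooth_potential c z)%R%:E <= log_energy mu)%E.
Proof.
move=> c0; have mU := continuous_measurable_plane (continuous_smooth_potential c0).
have [b b0 Eb] := compact_bounded_plane cE.
have [C C0 hC] := smooth_potential_bounded b c0.
have UC z : E z -> `|smooth_potential c z| <= C by move=> /Eb /hC.
rewrite fineK; last first.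
  by apply: integrable_fin_num => //; exact: expectation_domain_integrable mE muE _ _ mU UC.
apply: (le_integral_domain mE muE _ _ C0) => //.
- exact/measurable_EFinP.
- exact: measurable_log_potential.
- by move=> z /UC; rewrite lee_fin ler_norml => /andP[].
- by move=> z _; exact: smooth_potential_le.
Qed.

End potential.

(** * Uniform measures on finite families and comparison of energies *)

Section empirical_measure.
Context d (T : measurableType d) (R : realType) (I : finType).
Variables (i0 : I) (x_ : I -> T).

(** The index is an arbitrary finite type, to allow pairs of a point and a vertex number; [i0] is
    the default value of [nth] and also shows that the family is nonempty. *)
Definition empirical : set T -> \bar R :=
  mscale (#|I|%:R^-1)%:nng
    (msum (fun k => \d_(x_ (nth i0 (enum I) k)) : {measure set T -> \bar R}) #|I|).

HB.instance Definition _ := Measure.on empirical.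

Lemma card_gt0 : 0 < #|I|%:R :> R.
Proof. by rewrite ltr0n; apply/card_gt0P; exists i0. Qed.

Let big_nth_enum (V : nmodType) (f : I -> V) :
  \sum_(k < #|I|) f (nth i0 (enum I) k) = \sum_i f i.
Proof.
rewrite -[RHS]big_enum (big_nth i0) big_mkord cardE.
by apply: eq_bigr.
Qed.

Lemma ge0_integral_empirical (f : T -> \bar R) : (forall x, 0 <= f x)%E ->
  measurable_fun setT f ->
  (\int[empirical]_x f x = (#|I|%:R^-1)%:E * \sum_i f (x_ i))%E.
Proof.
move=> f0 mf; rewrite ge0_integral_mscale//= ge0_integral_measure_sum//.
congr (_ * _)%E; rewrite -(big_nth_enum (fun i => f (x_ i))).
by apply: eq_bigr => k _; rewrite integral_dirac// diracT mul1e.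
Qed.

Lemma empirical_setT : empirical setT = 1%E.
Proof.
have := @ge0_integral_empirical (cst 1%E) (fun=> lee01) (measurable_cst _).
rewrite integral_cst// mul1e => ->.
rewrite (eq_bigr (fun=> 1%:E))// sumEFin sumr_const -EFinM; congr EFin.
by rewrite mulVf// gt_eqF// card_gt0.
Qed.

HB.instance Definition _ := Measure_isProbability.Build _ _ _ empirical empirical_setT.

Lemma Rintegral_empirical (f : T -> R) : bounded_measurable f ->
  (\int[empirical]_x f x)%R = #|I|%:R^-1 * \sum_i f (x_ i).
Proof.
move=> bf; have [mf [M fM]] := bf.
have mM := @bounded_measurable_cst _ T R M.
have := bounded_expectationD empirical bf mM; rewrite bounded_expectation_cst => h.
apply: (addIr M); rewrite -h; apply: EFin_inj.
rewrite EFin_expectation; last exact: bounded_measurableD.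
rewrite ge0_integral_empirical//.
- rewrite sumEFin -EFinM; congr EFin; rewrite big_split/= sumr_const mulrDr.
  by rewrite -[M *+ _]mulr_natl mulrA mulVf ?mul1r// gt_eqF// card_gt0.
- by move=> x; rewrite lee_fin; have := fM x; rewrite ler_norml => /andP[]; lra.
- by apply/measurable_EFinP; exact: measurable_funD.
Qed.

End empirical_measure.
Arguments empirical {d T} R {I} i0 x_ _.

Section energy_bounds.
Variables (R : realType) (E : set (R * R)) (mu : probability (R * R)%type R).
Hypotheses (cE : compact E) (muE : supported_on E mu).
Variables (I : finType) (i0 : I) (p_ : I -> R * R) (c : R).
Hypothesis c0 : 0 < c.
Local Notation nu := (empirical R i0 p_).
Implicit Types (z w : R * R).

Let mE : measurable E.
Proof.
rewrite -[E]setCK; apply: measurableC; apply: open_measurable_plane.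
rewrite openC; apply: compact_closed => //; exact: norm_hausdorff.
Qed.

Let ppi0 : 0 < 2 * pi :> R.
Proof. by rewrite mulr_gt0// pi_gt0. Qed.

(** The lower bound will serve for the two self-energies and the upper one for the mutual energy, so
    [4 * c] appears in the mixed terms only. *)
Lemma log_bounded_kernel_bounds z w :
  - 2 * smooth_log c z w - ln c <= log_bounded_kernel c z w
  <= - 2 * smooth_log (4 * c) z w - ln c.
Proof.
have q0 := sqdist_ge0 z w; have [_] := energy_paramE c0 q0.
have e1 : 1 + sqdist z w / c = (sqdist z w + c) / c by field; rewrite gt_eqF.
have e2 : 4 + sqdist z w / c = (sqdist z w + 4 * c) / c by field; rewrite gt_eqF.
rewrite e1 e2 !ln_div ?posrE ?ltr_wpDl ?mulr_gt0// => h.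
have l1 : - 2 * smooth_log c z w = ln (sqdist z w + c) by rewrite /smooth_log; field.
have l2 : - 2 * smooth_log (4 * c) z w = ln (sqdist z w + 4 * c).
  by rewrite /smooth_log; field.
by rewrite l1 l2.
Qed.

Lemma log_bounded_kernel_ge0 z w : 0 <= log_bounded_kernel c z w.
Proof.
have q0 := sqdist_ge0 z w; have [_ /andP[+ _]] := energy_paramE c0 q0.
by apply: le_trans; rewrite ln_ge0// lerDl divr_ge0// ltW.
Qed.

(** Measurability in the pair (z, w) is obtained from Tonelli's theorem, applied to the plane
    integral that [energy_param] evaluates. *)
Let measurable_kernel : measurable_fun setT
  (fun q : (R * R) * (R * R) => log_bounded_kernel c q.1 q.2).
Proof.
pose t (p : ((R * R) * (R * R)) * (R * R)) : \bar R :=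
  ((sqdist p.2 p.1.1 + c) * (sqdist p.2 p.1.2 + c))^-1%:E.
have pc u z : 0 < sqdist u z + c by rewrite ltr_wpDl// sqdist_ge0.
have mt : measurable_fun setT t.
  apply/measurable_EFinP; apply: measurable_inv_gt0 => [p|]; first exact: mulr_gt0.
  by apply: measurable_funM; apply: measurable_funD => //;
    apply: measurable_sqdist => //; apply: measurableT_comp.
have t0 p : (0 <= t p)%E by rewrite lee_fin invr_ge0 mulr_ge0// ltW.
have := @measurable_fun_fubini_tonelli_F _ _ _ _ _ (plane_measure R) t mt t0.
have -> : fubini_F (plane_measure R) t =
    (fun q : (R * R) * (R * R) => (pi * energy_param c (sqdist q.1 q.2))%:E).
  by apply/funext => q; exact: integral_energy_kernel.
move=> /measurable_EFinP me.
have -> : (fun q : (R * R) * (R * R) => log_bounded_kernel c q.1 q.2) =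
   (fun q => (sqdist q.1 q.2 + 2 * c) / 2 / pi * (pi * energy_param c (sqdist q.1 q.2))).
  by apply/funext => q; rewrite /log_bounded_kernel mulrA divfK// gt_eqF// pi_gt0.
apply: measurable_funM => //; do 2 apply: measurable_funM => //.
by apply: measurable_funD => //; exact: measurable_sqdist.
Qed.

Lemma smooth_log_affine_ge0 z w : 0 <= - 2 * smooth_log c z w - ln c.
Proof.
have q0 := sqdist_ge0 z w; have qc0 : 0 < sqdist z w + c by rewrite ltr_wpDl.
have -> : - 2 * smooth_log c z w = ln (sqdist z w + c) by rewrite /smooth_log; field.
by rewrite subr_ge0 ler_ln ?posrE// lerDr.
Qed.

Let ke (q : (R * R) * (R * R)) : \bar R := (2 * pi * log_bounded_kernel c q.1 q.2)%:E.

Let mke : measurable_fun setT ke.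
Proof. by apply/measurable_EFinP; apply: measurable_funM. Qed.

Let ke0 q : (0 <= ke q)%E.
Proof. by rewrite lee_fin mulr_ge0 ?(ltW ppi0)// log_bounded_kernel_ge0. Qed.

Let mke1 z : measurable_fun setT (fun w => ke (z, w)).
Proof. exact: measurableT_comp. Qed.

Let g z : \bar R := (\int[mu]_w ke (z, w))%E.

Let mg : measurable_fun setT g.
Proof. exact: (@measurable_fun_fubini_tonelli_F _ _ _ _ _ mu ke). Qed.

Let g0 z : (0 <= g z)%E.
Proof. by apply: integral_ge0. Qed.

Let integral_affine (a : R) z : 0 < a ->
  (\int[mu]_w (2 * pi * (- 2 * smooth_log a z w - ln c))%:E =
   (2 * pi * (- 2 * smooth_potential mu a z - ln c))%:E)%E.
Proof.
move=> a0; have iL := integrable_smooth_log cE muE z a0.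
have iL2 : mu.-integrable setT (EFin \o (fun w => - 2 * smooth_log a z w)).
  exact: (integrableZl measurableT (- 2) iL).
have ic : mu.-integrable setT (EFin \o (fun _ : R * R => ln c)).
  exact/bounded_measurable_integrable/bounded_measurable_cst.
have iB : mu.-integrable setT (EFin \o (fun w => - 2 * smooth_log a z w - ln c)).
  exact: (integrableB measurableT iL2 ic).
have iZ : mu.-integrable setT (EFin \o (fun w => 2 * pi * (- 2 * smooth_log a z w - ln c))).
  exact: (integrableZl measurableT (2 * pi) iB).
rewrite -(fineK (integrable_fin_num measurableT iZ)); congr EFin.
by rewrite [LHS]RintegralZl// RintegralB// RintegralZl// bounded_expectation_cst.
Qed.

Lemma mutual_energy_empirical_potential : (mutual_energy c nu mu <=
  (2 * pi * (- 2 * (#|I|%:R^-1 * \sum_i smooth_potential mu (4 * c) (p_ i)) - ln c))%:E)%E.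
Proof.
rewrite -[leLHS]/(\int[nu]_z g z)%E ge0_integral_empirical//.
have gle z : (g z <= (2 * pi * (- 2 * smooth_potential mu (4 * c) z - ln c))%:E)%E.
  rewrite -integral_affine ?mulr_gt0//; apply: ge0_le_integral => //.
  - apply/measurable_EFinP; apply: measurable_funM => //.
    apply: measurable_funB => //; apply: measurable_funM => //.
    by apply: measurable_smooth_log => //; rewrite mulr_gt0.
  - move=> w _; rewrite lee_fin ler_pM2l//.
    by have /andP[] := log_bounded_kernel_bounds z w.
apply: (@le_trans _ _ ((#|I|%:R^-1)%:E *
  \sum_i (2 * pi * (- 2 * smooth_potential mu (4 * c) (p_ i) - ln c))%:E)%E).
  by apply: lee_wpmul2l; rewrite ?lee_fin ?invr_ge0//; apply: lee_sum => i _.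
rewrite sumEFin -EFinM lee_fin -mulr_sumr big_split/= sumr_const -mulr_sumr -[_ *+ _]mulr_natl.
have N0 := card_gt0 R i0.
by rewrite le_eqVlt; apply/orP; left; apply/eqP; field; rewrite gt_eqF.
Qed.

Lemma mutual_energy_empirical : ((2 * pi * (- 2 *
    (#|I|%:R^-1 * (#|I|%:R^-1 * \sum_i \sum_j smooth_log c (p_ i) (p_ j))) - ln c))%:E
  <= mutual_energy c nu nu)%E.
Proof.
have N0 := card_gt0 R i0.
have iE z : (\int[nu]_w ke (z, w) = (#|I|%:R^-1)%:E * \sum_j ke (z, p_ j))%E.
  by rewrite ge0_integral_empirical.
rewrite -[leRHS]/(\int[nu]_z \int[nu]_w ke (z, w))%E.
under eq_integral do rewrite iE.
rewrite ge0_integral_empirical//; last 2 first.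
- by move=> z; rewrite mule_ge0 ?lee_fin ?invr_ge0// sume_ge0.
- apply: measurable_funeM; apply: emeasurable_sum => j.
  exact: measurableT_comp.
rewrite /ke /=; under [X in (_ <= _ * X)%E]eq_bigr do rewrite sumEFin -EFinM.
rewrite sumEFin -EFinM lee_fin.
have -> : 2 * pi * (- 2 * (#|I|%:R^-1 * (#|I|%:R^-1 * \sum_i \sum_j smooth_log c (p_ i) (p_ j))) - ln c)
  = #|I|%:R^-1 * \sum_i (#|I|%:R^-1 * \sum_j 2 * pi * (- 2 * smooth_log c (p_ i) (p_ j) - ln c)).
  under [in RHS]eq_bigr do rewrite -mulr_sumr big_split/= sumr_const -mulr_sumr -[_ *+ _]mulr_natl.
  rewrite -!mulr_sumr big_split/= sumr_const -mulr_sumr -[_ *+ _]mulr_natl.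
  by field; rewrite gt_eqF.
rewrite ler_wpM2l ?invr_ge0//; apply: ler_sum => i _.
rewrite ler_wpM2l ?invr_ge0//; apply: ler_sum => j _.
by rewrite ler_pM2l//; have /andP[] := log_bounded_kernel_bounds (p_ i) (p_ j).
Qed.

Lemma mutual_energy_potential : ((2 * pi *
    (- 2 * (\int[mu]_z smooth_potential mu c z)%R - ln c))%:E <= mutual_energy c mu mu)%E.
Proof.
rewrite -[leRHS]/(\int[mu]_z g z)%E.
have mU := continuous_measurable_plane (continuous_smooth_potential cE muE c0).
have [b b0 Eb] := compact_bounded_plane cE.
have [C C0 hC] := smooth_potential_bounded cE muE b c0.
have iU : mu.-integrable setT (EFin \o smooth_potential mu c).
  by apply: (expectation_domain_integrable mE muE mU (C := C)) => z /Eb /hC.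
have iU2 : mu.-integrable setT (EFin \o (fun w => - 2 * smooth_potential mu c w)).
  exact: (integrableZl measurableT (- 2) iU).
have ic : mu.-integrable setT (EFin \o (fun _ : R * R => ln c)).
  exact/bounded_measurable_integrable/bounded_measurable_cst.
have iB : mu.-integrable setT (EFin \o (fun w => - 2 * smooth_potential mu c w - ln c)).
  exact: (integrableB measurableT iU2 ic).
have iZ : mu.-integrable setT (EFin \o (fun w => 2 * pi * (- 2 * smooth_potential mu c w - ln c))).
  exact: (integrableZl measurableT (2 * pi) iB).
have -> : ((2 * pi * (- 2 * (\int[mu]_z smooth_potential mu c z)%R - ln c))%:E =
    \int[mu]_z (2 * pi * (- 2 * smooth_potential mu c z - ln c))%:E)%E.
  rewrite -(fineK (integrable_fin_num measurableT iZ)); congr EFin.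
  by rewrite [RHS]RintegralZl// RintegralB// RintegralZl// bounded_expectation_cst.
apply: (le_integral_domain mE muE _ _ (C := 2 * pi * (2 * C + `|ln c|))) => //.
- by apply/measurable_EFinP; have /integrableP[/measurable_EFinP] := iZ.
- by rewrite mulr_ge0 ?(ltW ppi0)// addr_ge0// mulr_ge0.
- move=> z /Eb /hC; rewrite ler_norml -EFinN lee_fin -mulrN ler_pM2l// => /andP[h1 h2].
  by have := ler_norm (ln c); lra.
- move=> z _; rewrite -integral_affine//.
  apply: ge0_le_integral => //.
  - by move=> w _; rewrite lee_fin mulr_ge0 ?(ltW ppi0)// smooth_log_affine_ge0.
  - apply/measurable_EFinP; apply: measurable_funM => //.
    apply: measurable_funB => //; apply: measurable_funM => //.
    exact: measurable_smooth_log.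
  - move=> w _; rewrite lee_fin ler_pM2l//.
    by have /andP[] := log_bounded_kernel_bounds z w.
Qed.

End energy_bounds.

(** The self-energies [a] and [b] may a priori be infinite, so the identity enters through one-sided
    real bounds; finiteness of [X] is part of the conclusion. *)
Lemma half_sum_le (R : realType) (X a b h : \bar R) (h' a' b' : R) :
  (0 <= X -> h <= h'%:E -> a'%:E <= a -> b'%:E <= b ->
  2%:E * X + a + b = 2%:E * h -> X <= ((2 * h' - a' - b') / 2)%:E)%E.
Proof.
move=> X0 hh aa bb e.
have : (2%:E * X + a'%:E + b'%:E <= 2%:E * h'%:E)%E.
  apply: (@le_trans _ _ (2%:E * X + a + b)%E); first by rewrite !leeD.
  by rewrite e lee_pmul2l.
case: X X0 {e} => [X| |] // _; last by rewrite gt0_muley// lte_fin.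
by rewrite -!EFinM -!EFinD !lee_fin; lra.
Qed.

Section core_inequality.
Variables (R : realType) (E : set (R * R)) (mu : probability (R * R)%type R).
Hypotheses (cE : compact E) (muE : supported_on E mu).
Variables (I : finType) (i0 : I) (p_ : I -> R * R) (c : R).
Hypothesis c0 : 0 < c.
Variables (phi : R * R -> R) (B M D : R).
Hypotheses (cphi : continuous phi) (phiM : forall p, `|phi p| <= M)
  (phiB : forall p, B <= `|p.1| \/ B <= `|p.2| -> phi p = 0)
  (phi_partials : partials_exist_ae phi)
  (phi_acl : absolutely_continuous_on_lines phi)
  (phiD : (dirichlet_integral phi <= D%:E)%E).
Local Notation nu := (empirical R i0 p_).
Local Notation mu2 := (plane_measure R).

Lemma bounded_measurable_smoothing : bounded_measurable (smoothing phi c).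
Proof.
have iphi : mu2.-integrable setT (EFin \o phi).
  have m1 : measurable_fun setT (fun _ : R * R => 1 : R) by exact: measurable_cst.
  have b1 (p : R * R) : `|1 : R| <= 1 by rewrite normr1.
  have := integrable_test_mul cphi phiM phiB m1 b1.
  by under eq_fun do rewrite mulr1.
pose k (q : (R * R) * (R * R)) : R := 2 * c * inv_sqdist c q.2 q.1 ^+ 2.
have k0 q : 0 <= k q by rewrite mulr_ge0 ?sqr_ge0// mulr_ge0// ltW.
have kM q : `|k q| <= 2 * c * c^-1 ^+ 2.
  rewrite ger0_norm// ler_wpM2l ?mulr_ge0 ?(ltW c0)//.
  rewrite lerXn2r ?nnegrE ?invr_ge0 ?(ltW c0) ?inv_sqdist_le//.
  by rewrite addr_ge0 ?sqdist_ge0 ?(ltW c0).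
have mk : measurable_fun setT k.
  by apply: measurable_funM => //; apply: measurable_funX; apply: measurable_inv_sqdist.
(* Measurability of [smoothing] is extracted from the integrability stated by the exchange
   theorem. *)
have [/integrableP[/measurable_EFinP ms _] _] := exchange_bounded_kernel mu iphi mk kM.
split; first exact: ms.
exists ((\int[mu2]_u `|phi u|)%R * (2 * c * c^-1 ^+ 2)) => z.
have mkz : measurable_fun setT (fun u => k (z, u)) by exact: measurableT_comp.
have i1 : mu2.-integrable setT (EFin \o (fun u => phi u * k (z, u))).
  exact: (integrable_mul_bounded iphi mkz (fun u => kM (z, u))).
have i2 : mu2.-integrable setT (EFin \o (fun u => `|phi u * k (z, u)|)).
  exact: (integrable_abse i1).
have i3 : mu2.-integrable setT (EFin \o (fun u => `|phi u|)).
  exact: (integrable_abse iphi).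
have i4 : mu2.-integrable setT (EFin \o (fun u => `|phi u| * (2 * c * c^-1 ^+ 2))).
  exact: (integrableZr measurableT (2 * c * c^-1 ^+ 2) i3).
apply: le_trans (le_normr_Rintegral measurableT i1) _.
apply: le_trans (le_Rintegral measurableT i2 i4 _) _.
  by move=> u _; rewrite normrM ler_wpM2l.
by rewrite RintegralZr.
Qed.

(** In [energy_identity] the mutual energy counts twice and each self-energy once, so the three
    terms in [ln c] cancel, leaving the smoothed energy of [nu - mu]. *)
Lemma sqr_smoothing_empirical_le :
  (#|I|%:R^-1 * \sum_i smoothing phi c (p_ i) - (\int[mu]_z smoothing phi c z)%R) ^+ 2
  <= D * (2 * pi * (#|I|%:R^-1 * (#|I|%:R^-1 * \sum_i \sum_j smooth_log c (p_ i) (p_ j))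
      + (\int[mu]_z smooth_potential mu c z)%R
      - 2 * (#|I|%:R^-1 * \sum_i smooth_potential mu (4 * c) (p_ i)))).
Proof.
rewrite -(Rintegral_empirical i0 p_ bounded_measurable_smoothing).
have phi_dirichlet : (dirichlet_integral phi < +oo)%E by exact: le_lt_trans phiD (ltry _).
apply: (sqr_smoothing_diff_le cphi phiM phiB phi_partials phi_acl phi_dirichlet) => //.
have := energy_identity c0 nu mu.
have h1 := mutual_energy_empirical_potential cE muE i0 p_ c0.
have h2 := mutual_energy_empirical i0 p_ c0.
have h3 := mutual_energy_potential cE muE c0.
set X := (\int[mu2]_u _)%E; set a := (mutual_energy c nu nu).
move: h1 h2 h3; rewrite -/a.
have X0 : (0 <= X)%E by apply: integral_ge0 => u _; rewrite lee_fin addr_ge0 ?sqr_ge0.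
move=> h1 h2 h3 h4; apply: le_trans (half_sum_le X0 h1 h2 h3 h4) _.
rewrite lee_fin le_eqVlt; apply/orP; left; apply/eqP.
set U4 : R := #|I|%:R^-1 * \sum_i smooth_potential mu _ _.
set L : R := #|I|%:R^-1 * _; set V : R := (\int[mu]_z _)%R.
by move: U4 L V (pi : R) (ln c) => U4 L V p l; field.
Qed.

End core_inequality.

(** * Maximum principles and Frostman's theorem *)

Lemma smooth_log_ratio (R : realType) (c k : R) (z z' w : R * R) : 0 < c -> 1 <= k ->
  cdist z' w <= k * cdist z w -> smooth_log c z w - smooth_log c z' w <= ln k.
Proof.
move=> c0 k1 zz'; have q0 := sqdist_ge0 z w; have q'0 := sqdist_ge0 z' w.
have p0 : 0 < sqdist z w + c by rewrite ltr_wpDl.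
have p'0 : 0 < sqdist z' w + c by rewrite ltr_wpDl.
have k0 : 0 < k by rewrite (lt_le_trans ltr01).
have h : sqdist z' w + c <= k ^+ 2 * (sqdist z w + c).
  rewrite mulrDr lerD//.
    by rewrite -!sqr_cdist -exprMn lerXn2r ?nnegrE ?mulr_ge0 ?cdist_ge0// ltW.
  by rewrite ler_peMl ?(ltW c0)// exprn_ege1.
have : ln (sqdist z' w + c) <= ln k *+ 2 + ln (sqdist z w + c).
  rewrite -lnXn// -lnM ?posrE ?exprn_gt0// ler_ln ?posrE// mulr_gt0// exprn_gt0//.
by rewrite /smooth_log mulr2n; lra.
Qed.

Section expectation_on_domain.
Context d (T : measurableType d) (R : realType) (P : probability T R).
Variable D : set T.
Hypotheses (mD : measurable D) (PD : P (~` D) = 0%E).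

Lemma le_expectation_domain (f g : T -> R) (C : R) :
  measurable_fun setT f -> measurable_fun setT g -> 0 <= C ->
  (forall x, D x -> `|f x| <= C) -> (forall x, D x -> `|g x| <= C) ->
  (forall x, D x -> f x <= g x) -> (\int[P]_x f x)%R <= (\int[P]_x g x)%R.
Proof.
move=> mf mg C0 fC gC fg.
have i1 := expectation_domain_integrable mD PD mf fC.
have i2 := expectation_domain_integrable mD PD mg gC.
rewrite -subr_le0 -RintegralB//; apply: (expectation_domain_le mD PD (C := C + C)) => //.
- exact: measurable_funB.
- exact: addr_ge0.
- by move=> x Dx; rewrite (le_trans (ler_normB _ _))// lerD ?fC ?gC.
- by move=> x Dx; rewrite subr_le0 fg.
Qed.

Lemma expectation_affine_indic (N : set T) (a k : R) : measurable N ->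
  (\int[P]_x (a * \1_N x + k))%R = a * fine (P N) + k.
Proof.
move=> mN; have bN : bounded_measurable (\1_N : T -> R).
  split; first exact: measurable_indic.
  by exists 1 => x; rewrite indicE; case: (x \in N); rewrite ?normr0 ?normr1.
rewrite bounded_expectationD ?bounded_expectation_cst ?bounded_expectationZ//.
- by rewrite /Rintegral integral_indic// setIT.
- by apply: bounded_measurableM => //; exact: bounded_measurable_cst.
- exact: bounded_measurable_cst.
Qed.

End expectation_on_domain.

Section maximum_principle.
Variables (R : realType) (K : set (R * R)) (mu : probability (R * R)%type R) (W : R).
Hypotheses (cK : compact K) (muK : supported_on K mu)
  (KW : forall z, K z -> (log_potential mu z <= W%:E)%E).
Implicit Types (z w : R * R).

Let mK : measurable K.
Proof.
rewrite -[K]setCK; apply: measurableC; apply: open_measurable_plane.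
rewrite openC; apply: compact_closed => //; exact: norm_hausdorff.
Qed.

Lemma log_potential_le (a : R) z : (forall c : R, 0 < c -> smooth_potential mu c z <= a) ->
  (log_potential mu z <= a%:E)%E.
Proof.
move=> Ua; rewrite leNgt; apply/negP => /(lt_log_potential cK muK)[c c0].
by rewrite ltNge Ua.
Qed.

Let measurable_disc z (s : R) : measurable [set w | cdist w z < s].
Proof.
apply: open_measurable_plane; rewrite openE => w /= wz.
apply/nbhs_cdistP; exists (s - cdist w z) => [|u uw]; first by rewrite subr_gt0.
by have := cdist_triangle w u z; rewrite /=; lra.
Qed.

(** A bounded potential at [z0] leaves little mass nearby: the kernel is at least [a] on the disc
    and at least [- C] on the rest of [K], so [a] times the mass of the disc is at most [W + C]. *)
Lemma disc_measure_small z0 (e : R) : K z0 -> 0 < e ->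
  exists2 s : R, 0 < s & fine (mu [set w | cdist w z0 < s]) <= e.
Proof.
move=> Kz0 e0; have [Q Q0 zQ] := sqdist_bounded cK z0.
pose C : R := `|ln (Q + 1) / 2|; pose a : R := (`|W| + C + 1) / e.
have C0 : 0 <= C by exact: normr_ge0.
have a0 : 0 < a by rewrite divr_gt0//; have := normr_ge0 W; lra.
(* With parameter s^2, the argument of the logarithm on the disc is at most 2 s^2 = exp (- 2 a) / 2,
   so the smooth kernel is at least [a] there. *)
pose s : R := expR (- a) / 2; have s0 : 0 < s by rewrite divr_gt0// expR_gt0.
have s1 : s ^+ 2 <= 1.
  rewrite -[leRHS](expr1n _ 2) lerXn2r ?nnegrE ?(ltW s0)//.
  by rewrite ler_pdivrMr// mul1r (le_trans (_ : _ <= 1)) ?ler1n// -expR0 ler_expR oppr_le0 ltW.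
have s20 : 0 < s ^+ 2 by rewrite exprn_gt0.
exists s => //; set N := [set w | _].
have /(le_trans (smooth_potential_le cK muK z0 s20)) := KW Kz0; rewrite lee_fin => UW.
have aN : a * fine (mu N) - C <= smooth_potential mu (s ^+ 2) z0.
  rewrite -(expectation_affine_indic mu a (- C) (measurable_disc z0 s)).
  have [L L0 zL] := smooth_log_bounded cK z0 s20.
  apply: (le_expectation_domain mK muK (C := L + (a + C))).
  - by apply: measurable_funD => //; apply: measurable_funM => //; exact: measurable_indic.
  - exact: measurable_smooth_log.
  - by rewrite !addr_ge0// ltW.
  - move=> w _; rewrite indicE; case: (w \in N); rewrite ?mulr1 ?mulr0 ?add0r ?normrN.
      by rewrite (le_trans (ler_normB _ _))// !ger0_norm ?(ltW a0) ?lerDr.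
    by rewrite /C normr_id; have := normr_ge0 (ln (Q + 1) / 2); lra.
  - by move=> w /zL; have := normr_ge0 (ln (Q + 1) / 2); rewrite -/C; lra.
  - move=> w Kw; rewrite indicE; have [/set_mem/= wN|_] := boolP (w \in N).
      rewrite mulr1 (le_trans (_ : _ <= a)) ?gerBl//.
      have wN' : sqdist z0 w <= s ^+ 2.
        by rewrite -sqr_cdist lerXn2r ?nnegrE ?cdist_ge0 ?(ltW s0)// cdistC ltW.
      have /andP[+ _] := smooth_log_bound s20 wN'; apply: le_trans.
      rewrite lerNr ler_pdivrMr//.
      have -> : - a * 2 = ln (expR (- a) ^+ 2).
        by rewrite lnXn ?expR_gt0// expRK -(mulr_natl (- a)) mulrC.
      rewrite ler_ln ?posrE ?addr_gt0 ?exprn_gt0 ?expR_gt0//.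
      have -> : s ^+ 2 + s ^+ 2 = expR (- a) ^+ 2 / 2 by rewrite /s; field.
      by rewrite ler_pdivrMr// ler_peMr ?sqr_ge0// ler1n.
    rewrite mulr0 add0r.
    have /andP[+ _] := smooth_log_bound s20 (zQ w Kw).
    apply: le_trans; rewrite lerN2 (le_trans _ (ler_norm _))// ler_pM2r// ler_ln ?posrE ?ltr_wpDl//.
    by rewrite lerD2l.
have : a * fine (mu N) <= `|W| + C by have := ler_norm W; lra.
rewrite mulrC -ler_pdivlMr// => /le_trans; apply.
rewrite /a invf_div mulrA ler_pdivrMr ?ltr_wpDl ?addr_ge0// mulrC ler_pM2l//; lra.
Qed.

Let nearest z0 z : K z0 -> exists2 z', K z' & forall w, K w -> cdist z' z <= cdist w z.
Proof.
move=> Kz0; have [||z' /set_mem Kz' z'P] := @compact_EVT_min _ R (fun w => cdist w z) K _ cK.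
- by exists z0.
- by apply: continuous_subspaceT; exact: continuous_cdist.
- by exists z' => // w Kw; apply: z'P; rewrite inE.
Qed.

(* Continuity principle: the nearest point z' of K to z satisfies
   |z' - w| <= 2 |z - w| for w in K, so smooth potentials at z and z' differ
   little near z0, where mu has little mass, and also away from z0. *)
Lemma log_potential_le_near z0 (e : R) : K z0 -> 0 < e -> exists2 t : R, 0 < t &
  forall z, cdist z z0 < t -> (log_potential mu z <= (W + e)%:E)%E.
Proof.
move=> Kz0 e0; have [s s0 Ns] := disc_measure_small Kz0 (divr_gt0 e0 (ltr0n R 2)).
(* On the disc of radius [s] the loss ln 2 is weighted by a mass of at most e/2. Off the disc, |z -
   z0| < s/2 gives |z - w| >= s/2, so the ratio of distances is at most 1 + 2 k and the loss at most
   2 k <= e/2. *)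
pose k : R := Num.min (e / 4) (2^-1).
have k0 : 0 < k by rewrite lt_min !divr_gt0//= invr_gt0.
have ke : k <= e / 4 by rewrite ge_min lexx.
have k2 : k <= 2^-1 by rewrite ge_min lexx orbT.
exists (s * k) => [|z zz0]; first exact: mulr_gt0.
apply: log_potential_le => c c0.
have [z' Kz' z'P] := nearest z Kz0.
have Uz' : smooth_potential mu c z' <= W.
  by rewrite -lee_fin; apply: le_trans (smooth_potential_le cK muK z' c0) (KW Kz').
set N := [set w | cdist w z0 < s] in Ns.
have i1 := integrable_smooth_log cK muK z c0; have i2 := integrable_smooth_log cK muK z' c0.
have [C1 C10 hC1] := smooth_log_bounded cK z c0.
have [C2 C20 hC2] := smooth_log_bounded cK z' c0.
have ln2 : ln 2 <= 1 :> R by have := @ln_le_subr1 R 2 (ltr0n R 2); lra.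
have ln20 : 0 <= ln 2 :> R by rewrite ln_ge0// ler1n.
suff : smooth_potential mu c z - smooth_potential mu c z' <= ln 2 * fine (mu N) + 2 * k.
  have : ln 2 * fine (mu N) <= e / 2.
    by rewrite -[leRHS]mul1r ler_pM// fine_ge0.
  lra.
rewrite -(expectation_affine_indic mu (ln 2) (2 * k) (measurable_disc z0 s)) -RintegralB//.
apply: (le_expectation_domain mK muK (C := C1 + C2 + (1 + 2 * k))).
- by apply: measurable_funB; exact: measurable_smooth_log.
- by apply: measurable_funD => //; apply: measurable_funM => //; exact: measurable_indic.
- by lra.
- move=> w Kw; apply: le_trans (ler_normB _ _) _; have := hC1 w Kw; have := hC2 w Kw.
  by lra.
- move=> w _; rewrite indicE; case: (w \in N);
    rewrite ?mulr1 ?mulr0 ?add0r ger0_norm ?addr_ge0 ?mulr_ge0 ?(ltW k0)//; lra.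
- move=> w Kw; rewrite indicE.
  have wz' : cdist z' w <= cdist z w + cdist z' z.
    by rewrite addrC; exact: cdist_triangle.
  have z'z0 : cdist z' z < s * k by apply: le_lt_trans (z'P z0 Kz0) _; rewrite cdistC.
  have sk2 : s * k <= s / 2 by rewrite ler_pM2l.
  have [_|/negP] := boolP (w \in N).
    rewrite mulr1 (le_trans (smooth_log_ratio (k := 2) c0 _ _)) ?ler1n//.
      by have := z'P w Kw; rewrite (cdistC w z); lra.
    by rewrite lerDl mulr_ge0// ltW.
  rewrite inE/= => /negP; rewrite -leNgt => wz0.
  have zw : s / 2 <= cdist z w.
    by have := cdist_triangle z w z0; rewrite (cdistC w z); lra.
  rewrite mulr0 add0r (le_trans (smooth_log_ratio (k := 1 + 2 * k) c0 _ _))//.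
  + by rewrite lerDl mulr_ge0// ltW.
  + apply: le_trans wz' _; rewrite mulrDl mul1r lerD2l (le_trans (ltW z'z0))//.
    have -> : s * k = 2 * k * (s / 2) by field.
    by rewrite ler_pM2l// mulr_gt0.
  + by rewrite (le_trans (ln_le_subr1 _)) ?ltr_wpDr ?mulr_ge0 ?(ltW k0)//; lra.
Qed.

End maximum_principle.

(* The product of |z + h i^l - w|^2 + c over l < 4 is
   (S^2 - 4 h^2 x^2)(S^2 - 4 h^2 y^2) with (x, y) = z - w and
   S = x^2 + y^2 + h^2 + c. *)
Lemma four_point_le (R : realType) (c h t : R) (z w : R * R) :
  0 < c -> 0 < t -> t <= sqdist z w ->
  4 * smooth_log c z w - (2 * h ^+ 2 * c + h ^+ 4) / t ^+ 2 <=
  smooth_log c (z.1 + h, z.2) w + smooth_log c (z.1 - h, z.2) w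
  + (smooth_log c (z.1, z.2 + h) w + smooth_log c (z.1, z.2 - h) w).
Proof.
move=> c0 t0 tq.
have q0 u : 0 < sqdist u w + c by rewrite ltr_wpDl// sqdist_ge0.
rewrite /smooth_log.
set A1 := sqdist (z.1 + h, _) w + c; set A2 := sqdist (z.1 - h, _) w + c.
set A3 := sqdist (_, z.2 + h) w + c; set A4 := sqdist (_, z.2 - h) w + c.
set A := sqdist z w + c.
have [p1 p2 p3 p4 p] : [/\ 0 < A1, 0 < A2, 0 < A3, 0 < A4 & 0 < A] by split; exact: q0.
have e4 : 0 <= 2 * h ^+ 2 * c + h ^+ 4.
  have h4 : 0 <= h ^+ 4 by rewrite (_ : h ^+ 4 = (h ^+ 2) ^+ 2) ?sqr_ge0//; ring.
  by rewrite addr_ge0 ?h4// mulr_ge0 ?(ltW c0)// mulr_ge0// sqr_ge0.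
set e := 2 * h ^+ 2 * c + h ^+ 4 in e4 *.
have prod : A1 * A2 * (A3 * A4) <= (A ^+ 2 + e) ^+ 2.
  rewrite -subr_ge0.
  rewrite [leRHS](_ : _ = (2 * h ^+ 2 * ((z.1 - w.1) ^+ 2 - (z.2 - w.2) ^+ 2)) ^+ 2) ?sqr_ge0//.
  by rewrite /A1 /A2 /A3 /A4 /A /e /sqdist /=; ring.
have Ae : 0 < A ^+ 2 + e by rewrite ltr_pwDl// exprn_gt0.
have l1 : ln A1 + ln A2 + (ln A3 + ln A4) <= ln (A ^+ 2 + e) *+ 2.
  by rewrite -lnXn// -!lnM ?posrE ?mulr_gt0// ler_ln ?posrE ?mulr_gt0 ?exprn_gt0.
have A2t : t ^+ 2 <= A ^+ 2.
  by rewrite lerXn2r ?nnegrE ?(ltW t0) ?(ltW p)// (le_trans tq)// lerDl ltW.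
have t20 : 0 < t ^+ 2 by rewrite exprn_gt0.
have l2 : ln (A ^+ 2 + e) <= ln A *+ 2 + e / t ^+ 2.
  have -> : A ^+ 2 + e = A ^+ 2 * (1 + e / A ^+ 2) by field; rewrite gt_eqF// ?exprn_gt0.
  have g0 : 0 < 1 + e / A ^+ 2 by rewrite ltr_pwDl// divr_ge0// sqr_ge0.
  rewrite lnM ?posrE ?exprn_gt0// lnXn// lerD2l.
  rewrite (le_trans (ln_le_subr1 g0))// addrC addKr ler_wpM2l// lef_pV2 ?posrE// exprn_gt0//.
move: l1 l2; rewrite -(mulr_natl (ln (_ + e))) -(mulr_natl (ln A)).
move: (ln A1) (ln A2) (ln A3) (ln A4) (ln A) (ln (_ + e)) (e / _) => a1 a2 a3 a4 a b k.
by clear; lra.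
Qed.

(** With A = |z - w|^2 + c, the same product equals (A^2 - h^4)^2 plus two nonnegative terms. The
    error is thus of order h^4 and loses against any multiple of h^2; the condition on [h] gives A^2
    - h^4 >= c^2 / 2. *)
Lemma four_point_ge (R : realType) (c h : R) (z w : R * R) :
  0 < c -> 2 * h ^+ 4 <= c ^+ 2 ->
  smooth_log c (z.1 + h, z.2) w + smooth_log c (z.1 - h, z.2) w
  + (smooth_log c (z.1, z.2 + h) w + smooth_log c (z.1, z.2 - h) w)
  <= 4 * smooth_log c z w + 2 * h ^+ 4 / c ^+ 2.
Proof.
move=> c0 hc.
have q0 u : 0 < sqdist u w + c by rewrite ltr_wpDl// sqdist_ge0.
rewrite /smooth_log.
set A1 := sqdist (z.1 + h, _) w + c; set A2 := sqdist (z.1 - h, _) w + c.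
set A3 := sqdist (_, z.2 + h) w + c; set A4 := sqdist (_, z.2 - h) w + c.
set A := sqdist z w + c.
have [p1 p2 p3 p4 p] : [/\ 0 < A1, 0 < A2, 0 < A3, 0 < A4 & 0 < A] by split; exact: q0.
have h4 : 0 <= h ^+ 4 by rewrite (_ : h ^+ 4 = (h ^+ 2) ^+ 2) ?sqr_ge0//; ring.
have cA : c ^+ 2 <= A ^+ 2.
  by rewrite lerXn2r ?nnegrE ?(ltW c0) ?(ltW p)// lerDr sqdist_ge0.
have c20 : 0 < c ^+ 2 by rewrite exprn_gt0.
have A20 : 0 < A ^+ 2 by rewrite exprn_gt0.
have Ah : 0 < A ^+ 2 - h ^+ 4 by lra.
have prod : (A ^+ 2 - h ^+ 4) ^+ 2 <= A1 * A2 * (A3 * A4).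
  have -> : A1 * A2 * (A3 * A4) = (A ^+ 2 - h ^+ 4) ^+ 2 +
      (4 * h ^+ 2 * c * (A + h ^+ 2) ^+ 2 +
       (4 * h ^+ 2 * ((z.1 - w.1) * (z.2 - w.2))) ^+ 2).
    by rewrite /A1 /A2 /A3 /A4 /A /sqdist /=; ring.
  rewrite lerDl; apply: addr_ge0; last exact: sqr_ge0.
  apply: mulr_ge0; last exact: sqr_ge0.
  by apply: mulr_ge0; [rewrite mulr_ge0// sqr_ge0|exact: ltW].
have l1 : 2 * ln (A ^+ 2 - h ^+ 4) <= ln A1 + ln A2 + (ln A3 + ln A4).
  by rewrite mulr_natl -lnXn// -!lnM ?posrE ?mulr_gt0// ler_ln ?posrE ?mulr_gt0//.
have l2 : 2 * ln A - 2 * h ^+ 4 / c ^+ 2 <= ln (A ^+ 2 - h ^+ 4).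
  rewrite mulr_natl -lnXn// lerBlDr -lerBlDl -ln_div ?posrE//.
  have k0 : 0 < A ^+ 2 / (A ^+ 2 - h ^+ 4) by rewrite divr_gt0.
  rewrite (le_trans (ln_le_subr1 k0))//.
  have -> : A ^+ 2 / (A ^+ 2 - h ^+ 4) - 1 = h ^+ 4 / (A ^+ 2 - h ^+ 4).
    by field; rewrite gt_eqF.
  have -> : 2 * h ^+ 4 / c ^+ 2 = h ^+ 4 / (c ^+ 2 / 2) by field; rewrite gt_eqF.
  by rewrite ler_wpM2l// lef_pV2 ?posrE ?divr_gt0//; lra.
move: l1 l2.
move: (ln A1) (ln A2) (ln A3) (ln A4) (ln A) (ln (A ^+ 2 - _)) (2 * h ^+ 4 / _).
by clear => a1 a2 a3 a4 a b k; lra.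
Qed.

Definition cross (R : realType) (h : R) (z : R * R) : seq (R * R) :=
  [:: (z.1 + h, z.2); (z.1 - h, z.2); (z.1, z.2 + h); (z.1, z.2 - h)].

Section four_point_potential.
Variables (R : realType) (K : set (R * R)) (mu : probability (R * R)%type R).
Hypotheses (cK : compact K) (muK : supported_on K mu).
Implicit Types (z w : R * R) (c h t : R).

Let mK : measurable K.
Proof.
rewrite -[K]setCK; apply: measurableC; apply: open_measurable_plane.
rewrite openC; apply: compact_closed => //; exact: norm_hausdorff.
Qed.

Let cross_smooth_log c h z w := smooth_log c (z.1 + h, z.2) w + smooth_log c (z.1 - h, z.2) w
    + (smooth_log c (z.1, z.2 + h) w + smooth_log c (z.1, z.2 - h) w).

Let integral_cross c h z : 0 < c ->
  (\int[mu]_w cross_smooth_log c h z w)%R = \sum_(v <- cross h z) smooth_potential mu c v.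
Proof.
move=> c0; have iL u := integrable_smooth_log cK muK u c0.
have i1 : mu.-integrable setT (EFin \o (fun w =>
    smooth_log c (z.1 + h, z.2) w + smooth_log c (z.1 - h, z.2) w)).
  exact: (integrableD measurableT (iL _) (iL _)).
have i2 : mu.-integrable setT (EFin \o (fun w =>
    smooth_log c (z.1, z.2 + h) w + smooth_log c (z.1, z.2 - h) w)).
  exact: (integrableD measurableT (iL _) (iL _)).
rewrite RintegralD// RintegralD// RintegralD// /cross !big_cons big_nil addr0.
by rewrite -[LHS]addrA.
Qed.

Let measurable_cross c h z : 0 < c -> measurable_fun setT (cross_smooth_log c h z).
Proof.
by move=> c0; apply: measurable_funD; apply: measurable_funD; exact: measurable_smooth_log.
Qed.

Let cross_bounded c h z : 0 < c -> exists2 C : R, 0 <= C &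
  forall w, K w -> `|cross_smooth_log c h z w| <= C /\ `|smooth_log c z w| <= C.
Proof.
move=> c0; have bL u := smooth_log_bounded cK u c0.
have [C1 C10 h1] := bL (z.1 + h, z.2); have [C2 C20 h2] := bL (z.1 - h, z.2).
have [C3 C30 h3] := bL (z.1, z.2 + h); have [C4 C40 h4] := bL (z.1, z.2 - h).
have [C5 C50 h5] := bL z.
exists (C1 + C2 + (C3 + C4) + C5) => [|w Kw]; first by rewrite !addr_ge0.
split.
  rewrite (@le_trans _ _ (C1 + C2 + (C3 + C4)))//; last by rewrite lerDl.
  rewrite (le_trans (ler_normD _ _))// lerD//.
    exact: le_trans (ler_normD _ _) (lerD (h1 w Kw) (h2 w Kw)).
  exact: le_trans (ler_normD _ _) (lerD (h3 w Kw) (h4 w Kw)).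
by rewrite (le_trans (h5 w Kw))// lerDr !addr_ge0.
Qed.

Let integral_affine c z (k : R) : 0 < c ->
  (\int[mu]_w (4 * smooth_log c z w + k))%R = 4 * smooth_potential mu c z + k.
Proof.
move=> c0; have iL := integrable_smooth_log cK muK z c0.
have i4 : mu.-integrable setT (EFin \o (fun w => 4 * smooth_log c z w)).
  exact: (integrableZl measurableT 4 iL).
have ik : mu.-integrable setT (EFin \o (fun _ : R * R => k)).
  exact/bounded_measurable_integrable/bounded_measurable_cst.
by rewrite RintegralD// RintegralZl// bounded_expectation_cst.
Qed.

Let measurable_affine c z (k : R) : 0 < c ->
  measurable_fun setT (fun w => 4 * smooth_log c z w + k).
Proof.
move=> c0; apply: measurable_funD => //; apply: measurable_funM => //.
exact: measurable_smooth_log.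
Qed.

(** Off [K] the smooth potential is nearly harmonic: the term of order h^2 in the error carries a
    factor [c], coming from the Laplacian - 2 c / (|z - w|^2 + c)^2 of the kernel. *)
Lemma cross_smooth_potential_ge c h t z : 0 < c -> 0 < t ->
  (forall w, K w -> t <= sqdist z w) ->
  4 * smooth_potential mu c z - (2 * h ^+ 2 * c + h ^+ 4) / t ^+ 2 <=
  \sum_(v <- cross h z) smooth_potential mu c v.
Proof.
move=> c0 t0 tK; have [C C0 hC] := cross_bounded h z c0.
set k := - _; rewrite -integral_cross// -integral_affine//.
apply: (le_expectation_domain mK muK (C := 4 * C + `|k|)).
- exact: measurable_affine.
- exact: measurable_cross.
- by rewrite addr_ge0// mulr_ge0.
- move=> w /hC[_ h2]; rewrite (le_trans (ler_normD _ _))// lerD2r normrM ger0_norm//.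
  by rewrite ler_pM2l.
- by move=> w /hC[h1 _]; have := normr_ge0 k; lra.
- by move=> w Kw; exact: four_point_le (tK w Kw).
Qed.

(** Superharmonicity on the whole plane, support included, up to an error of order h^4. *)
Lemma cross_smooth_potential_le c h z : 0 < c -> 2 * h ^+ 4 <= c ^+ 2 ->
  \sum_(v <- cross h z) smooth_potential mu c v <=
  4 * smooth_potential mu c z + 2 * h ^+ 4 / c ^+ 2.
Proof.
move=> c0 hc; have [C C0 hC] := cross_bounded h z c0.
set k := 2 * _ / _; rewrite -integral_cross// -integral_affine//.
apply: (le_expectation_domain mK muK (C := 4 * C + `|k|)).
- exact: measurable_cross.
- exact: measurable_affine.
- by rewrite addr_ge0// mulr_ge0.
- by move=> w /hC[h1 _]; have := normr_ge0 k; lra.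
- move=> w /hC[_ h2]; rewrite (le_trans (ler_normD _ _))// lerD2r normrM ger0_norm//.
  by rewrite ler_pM2l.
- by move=> w Kw; exact: four_point_ge.
Qed.

End four_point_potential.

Lemma sum_cross_sqdist (R : realType) (h : R) (z : R * R) :
  \sum_(v <- cross h z) sqdist v (0, 0) = 4 * sqdist z (0, 0) + 4 * h ^+ 2.
Proof. by rewrite /cross !big_cons big_nil /sqdist /=; ring. Qed.

Lemma cdist_cross (R : realType) (h : R) (z v : R * R) : 0 <= h ->
  v \in cross h z -> cdist v z = h.
Proof.
move=> h0; rewrite /cross !inE => /or4P[] /eqP ->; rewrite /cdist /=.
- by rewrite addrAC subrr add0r subrr expr0n addr0 sqrtr_sqr ger0_norm.
- by rewrite addrAC subrr add0r subrr expr0n addr0 sqrtr_sqr normrN ger0_norm.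
- by rewrite subrr expr0n add0r addrAC subrr add0r sqrtr_sqr ger0_norm.
- by rewrite subrr expr0n add0r addrAC subrr add0r sqrtr_sqr normrN ger0_norm.
Qed.

(** Discrete maximum principle: at a maximum of [F] over [A] the sum over a cross in [A] cannot
    exceed [4 * F z], so the maximum is attained on [Bd]. *)
Lemma cross_maximum (R : realType) (A Bd : set (R * R)) (F : R * R -> R) (z0 : R * R) :
  compact A -> continuous F -> A z0 ->
  (forall z, A z -> ~ Bd z -> exists2 h : R, {in cross h z, forall v, A v} &
    4 * F z < \sum_(v <- cross h z) F v) ->
  exists z, [/\ A z, Bd z & F z0 <= F z].
Proof.
move=> cA cF Az0 AF.
have [||z /set_mem Az zmax] := @compact_EVT_max _ R F A _ cA.
- by exists z0.
- exact: continuous_subspaceT.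
exists z; split=> //; last by apply: zmax; rewrite inE.
apply: contrapT => /(AF z Az)[h hA]; apply/negP; rewrite -leNgt.
have le v : v \in cross h z -> F v <= F z by move=> /hA Av; apply: zmax; rewrite inE.
rewrite /cross !big_cons big_nil addr0.
have := le (z.1 + h, z.2); have := le (z.1 - h, z.2).
have := le (z.1, z.2 + h); have := le (z.1, z.2 - h).
rewrite /cross !inE !eqxx !orbT => /(_ isT) l1 /(_ isT) l2 /(_ isT) l3 /(_ isT) l4.
lra.
Qed.

Section domination.
Variables (R : realType) (K : set (R * R)) (mu : probability (R * R)%type R) (W : R).
Hypotheses (cK : compact K) (muK : supported_on K mu)
  (KW : forall z, K z -> (log_potential mu z <= W%:E)%E).
Implicit Types (z w : R * R).

Let mK : measurable K.
Proof.
rewrite -[K]setCK; apply: measurableC; apply: open_measurable_plane.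
rewrite openC; apply: compact_closed => //; exact: norm_hausdorff.
Qed.

Lemma closed_disc_compact (s : R) : compact [set z : R * R | cdist z (0, 0) <= s].
Proof.
apply: (@closed_bounded_compact R _ s) => //.
have -> : [set z : R * R | cdist z (0, 0) <= s] =
    (fun z => cdist z (0, 0)) @^-1` [set x | x <= s] by [].
apply: closed_comp; last exact: closed_le.
by move=> z _; exact: continuous_cdist.
Qed.

(** Finds a cross small enough that the gain 4 e h^2 of the summand e |z|^2 beats the error of
    [cross_smooth_potential_ge]; the term 2 h^2 c of that error is what requires
    [c < e * t ^+ 2]. *)
Let small_step (e c t d : R) : 0 < e -> 0 < c -> 0 < t -> 0 < d -> c < e * t ^+ 2 ->
  exists2 h : R, 0 < h <= d & (2 * h ^+ 2 * c + h ^+ 4) / t ^+ 2 < 4 * e * h ^+ 2.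
Proof.
move=> e0 c0 t0 d0 ct.
pose h := Num.min d (Num.min 1 (e * t ^+ 2)).
have et0 : 0 < e * t ^+ 2 by rewrite mulr_gt0// exprn_gt0.
have h0 : 0 < h by rewrite !lt_min d0 ltr01.
have hd : h <= d by rewrite ge_min lexx.
have h1 : h <= 1 by rewrite !ge_min lexx orbT.
have he : h <= e * t ^+ 2 by rewrite !ge_min lexx !orbT.
exists h; first by rewrite h0.
rewrite ltr_pdivrMr ?exprn_gt0//.
have h20 : 0 < h ^+ 2 by rewrite exprn_gt0.
have -> : 2 * h ^+ 2 * c + h ^+ 4 = h ^+ 2 * (2 * c + h ^+ 2) by ring.
have -> : 4 * e * h ^+ 2 * t ^+ 2 = h ^+ 2 * (4 * (e * t ^+ 2)) by ring.
rewrite ltr_pM2l//.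
have h2h : h ^+ 2 <= h by rewrite expr2 ler_piMr// ltW.
lra.
Qed.

(** [cross_maximum] on a large disc, for the smooth potential plus e1 |z|^2. The boundary set is the
    outer circle together with a neighbourhood of [K], where the continuity principle gives W +
    e/2. *)
Lemma smooth_potential_domination (e : R) z0 : 0 < e -> exists2 d : R, 0 < d &
  forall c : R, 0 < c < d -> smooth_potential mu c z0 <= W + e.
Proof.
move=> e0; have [b b0 Kb] := compact_bounded_plane cK.
(* At modulus at least b + exp (- W) every point of [K] is at distance at least exp (- W), so the
   kernel is at most [W]; the second entry places [z0] in the disc. Then [e1] keeps the added term
   below e/2. *)
pose s : R := Num.max (b + expR (- W)) (cdist z0 (0, 0) + 1).
have s0 : 0 < s by rewrite lt_max addr_gt0// expR_gt0.
pose e1 : R := e / (2 * s ^+ 2).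
have s20 : 0 < s ^+ 2 by rewrite exprn_gt0.
have e10 : 0 < e1 by rewrite divr_gt0// mulr_gt0.
have e1s : e1 * s ^+ 2 = e / 2 by rewrite /e1; field; rewrite gt_eqF.
have [||t t0 tP] := @compact_uniform R K (fun d z =>
    forall u, cdist u z < d -> (log_potential mu u <= (W + e / 2)%:E)%E) cK.
- by move=> d d' z /andP[_ d'd] h u uz; apply: h; exact: lt_le_trans uz d'd.
- move=> z Kz; have [d d0 dP] := log_potential_le_near cK muK KW Kz (divr_gt0 e0 (ltr0n R 2)).
  exists (d / 2) => [|w _ wz u uw]; first by rewrite divr_gt0.
  by apply: dP; have := cdist_triangle w u z; lra.
pose t2 : R := t ^+ 2; have t20 : 0 < t2 by rewrite exprn_gt0.
exists (e1 * t2 ^+ 2) => [|c /andP[c0 cd]]; first by rewrite mulr_gt0// exprn_gt0.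
pose F z := smooth_potential mu c z + e1 * sqdist z (0, 0).
pose Bd : set (R * R) := [set z | (s <= cdist z (0, 0)) \/ exists2 w, K w & cdist z w < t].
have cF : continuous F.
  move=> z; apply: cvgD; first exact: (continuous_smooth_potential cK muK c0).
  by apply: cvgM; [exact: cvg_cst|exact: (@continuous_sqdist R)].
have [|z nBd|z [zs zBd Fz]] := cross_maximum (Bd := Bd) (@closed_disc_compact s) cF (z0 := z0).
- by rewrite /= le_max; apply/orP; right; rewrite lerDl.
- move=> Bdz; have zs : cdist z (0, 0) < s.
    by rewrite ltNge; apply/negP => h; apply: Bdz; left.
  have zK w : K w -> t2 <= sqdist z w.
    move=> Kw; rewrite -sqr_cdist lerXn2r ?nnegrE ?cdist_ge0 ?(ltW t0)// leNgt.
    by apply/negP => h; apply: Bdz; right; exists w.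
  have sz : 0 < s - cdist z (0, 0) by rewrite subr_gt0.
  have [h /andP[h0 hs] he] := small_step e10 c0 t20 sz cd.
  exists h => [v /(cdist_cross (ltW h0)) vz|].
    by have := cdist_triangle z v (0, 0); rewrite /=; lra.
  rewrite big_split/= -mulr_sumr sum_cross_sqdist.
  have := cross_smooth_potential_ge cK muK h c0 t20 zK; rewrite /F; lra.
have zs2 : e1 * sqdist z (0, 0) <= e / 2.
  rewrite -e1s ler_pM2l// -sqr_cdist lerXn2r ?nnegrE ?cdist_ge0 ?(ltW s0)//.
have F0 : smooth_potential mu c z0 <= F z0.
  by rewrite lerDl mulr_ge0 ?sqdist_ge0// ltW.
have : smooth_potential mu c z <= W + e / 2.
  case: zBd => [sz|[w Kw zw]]; last first.
    by rewrite -lee_fin; apply: le_trans (smooth_potential_le cK muK z c0) (tP w Kw z zw).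
  apply: (@le_trans _ _ W); last by rewrite lerDl divr_ge0// ltW.
  have zKW w : K w -> expR (- W) <= cdist z w.
    move=> /Kb wb; have := cdist_triangle w z (0, 0).
    have : b + expR (- W) <= s by rewrite le_max lexx.
    by lra.
  have [C C0 hC] := smooth_log_bounded cK z c0.
  apply: (expectation_domain_le mK muK (C := C)) => //; first exact: measurable_smooth_log.
  move=> w /zKW zw; have q0 := sqdist_ge0 z w.
  rewrite lerNl ler_pdivlMr// -(expRK (- W * 2)) ler_ln ?posrE ?expR_gt0 ?ltr_wpDl//.
  rewrite expRM_natr -sqr_cdist (le_trans (_ : _ <= cdist z w ^+ 2)) ?lerDl ?(ltW c0)//.
  by rewrite lerXn2r ?nnegrE ?expR_ge0 ?cdist_ge0.
by move: Fz; rewrite {2}/F; lra.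
Qed.

(** The preceding bound needs [c] small, but smooth potentials increase as [c] decreases, so it
    extends to all [c] and then to their limit. *)
Lemma log_potential_domination z : (log_potential mu z <= W%:E)%E.
Proof.
apply/lee_addgt0Pr => e e0; rewrite -EFinD; apply: (log_potential_le cK muK) => c c0.
have [d d0 dP] := smooth_potential_domination z e0.
pose c' : R := Num.min c (d / 2).
have c'0 : 0 < c' by rewrite lt_min c0 divr_gt0.
have c'd : c' < d by rewrite gt_min; apply/orP; right; rewrite ltr_pdivrMr// ltr_pMr// ltr1n.
apply: (@le_trans _ _ (smooth_potential mu c' z)).
  by apply: (le_smooth_potential cK muK); rewrite c'0 ge_min lexx.
by apply: dP; rewrite c'0.
Qed.

End domination.

(** * Variation of the energy and Frostman's inequality *)

Section tilted_measure.
Context d (T : measurableType d) (R : realType) (mu : probability T R).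
Variables (B : set T) (mB : measurable B) (a b : {nonneg R}).
Hypothesis ab1 : (a%:num%:E + b%:num%:E * mu B = 1)%E.

(** The dummy [let] makes the measure depend on the normalisation [ab1], from which its probability
    structure is built. *)
Definition tilted : set T -> \bar R := let _ := ab1 in
  measure_add (mscale a mu : {measure set T -> \bar R})
    (mscale b (mrestr mu mB : {measure set T -> \bar R}) : {measure set T -> \bar R}).

HB.instance Definition _ := Measure.on tilted.

Let tiltedE A : tilted A = (a%:num%:E * mu A + b%:num%:E * mu (A `&` B))%E.
Proof. by rewrite /tilted measure_addE. Qed.

Let tilted_setT : tilted setT = 1%E.
Proof.
rewrite tiltedE setTI -ab1; have /= -> := @probability_setT _ _ _ mu.
by rewrite mule1.
Qed.

HB.instance Definition _ := Measure_isProbability.Build _ _ _ tilted tilted_setT.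

Lemma tilted_null A : mu A = 0%E -> measurable A -> tilted A = 0%E.
Proof.
move=> A0 mA; rewrite tiltedE A0 mule0 add0e.
rewrite (_ : mu (A `&` B) = 0%E) ?mule0//; apply/eqP; rewrite eq_le measure_ge0 andbT.
by rewrite -A0 le_measure// inE//; exact: measurableI.
Qed.

Lemma ge0_integral_tilted (f : T -> \bar R) : (forall x, 0 <= f x)%E ->
  measurable_fun setT f ->
  (\int[tilted]_x f x = a%:num%:E * \int[mu]_x f x + b%:num%:E * \int[mu]_(x in B) f x)%E.
Proof.
move=> f0 mf; rewrite /tilted ge0_integral_measure_add//.
rewrite !ge0_integral_mscale//; congr (_ + _ * _)%E.
have mCB := measurableC mB.
rewrite (ge0_negligible_integral mCB)//; last by rewrite /= /mrestr setICl measure0.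
rewrite setTD setCK; apply: eq_measure_integral => A mA AB.
by rewrite /= /mrestr setIidl.
Qed.

End tilted_measure.

Section kernel_energy.
Variables (R : realType) (E : set (R * R)).
Hypothesis cE : compact E.
Implicit Types (z w : R * R) (lam : probability (R * R)%type R).
Local Open Scope ereal_scope.

Let mE : measurable E.
Proof.
rewrite -[E]setCK; apply: measurableC; apply: open_measurable_plane.
rewrite openC; apply: compact_closed => //; exact: norm_hausdorff.
Qed.

Lemma log_kernel_ge : exists2 C : R, (0 <= C)%R &
  forall z w, E z -> E w -> - C%:E <= log_kernel z w.
Proof.
have [b b0 Eb] := compact_bounded_plane cE.
exists `|ln ((b + b) ^+ 2 + 1) / 2|%R => // z w /Eb zb /Eb wb.
apply: le_trans (smooth_log_le_log_kernel z w ltr01); rewrite lee_fin.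
have zw : (sqdist z w <= (b + b) ^+ 2)%R.
  rewrite -sqr_cdist lerXn2r ?nnegrE ?addr_ge0 ?cdist_ge0 ?(ltW b0)//.
  by rewrite (le_trans (cdist_triangle (0, 0)%R _ _))// lerD// cdistC.
by have /andP[+ _] := smooth_log_bound ltr01 zw; apply: le_trans; rewrite lerN2 ler_norm.
Qed.

Variable C : R.
Hypotheses (C0 : (0 <= C)%R) (EC : forall z w, E z -> E w -> - C%:E <= log_kernel z w).

(** Shifted by [C] on [E] times [E] and cut off elsewhere, the kernel is nonnegative on the whole
    plane and Tonelli's theorem applies; for measures on [E] the energy changes by exactly [C]. *)
Definition pos_kernel z w : \bar R :=
  if (z \in E) && (w \in E) then log_kernel z w + C%:E else 0.

Lemma pos_kernel_ge0 z w : 0 <= pos_kernel z w.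
Proof.
rewrite /pos_kernel; case: ifPn => // /andP[/set_mem Ez /set_mem Ew].
by rewrite -leeBlDr// sub0e EC.
Qed.

Lemma pos_kernelC z w : pos_kernel z w = pos_kernel w z.
Proof. by rewrite /pos_kernel andbC /log_kernel cdistC. Qed.

Lemma measurable_pos_kernel :
  measurable_fun setT (fun q : (R * R) * (R * R) => pos_kernel q.1 q.2).
Proof.
have -> : (fun q : (R * R) * (R * R) => pos_kernel q.1 q.2) =
    (fun q => log_kernel q.1 q.2 + C%:E) \_ (E `*` E).
  by apply/funext => q; rewrite patchE /pos_kernel in_setX.
apply/(measurable_restrictT _ (measurableX mE mE)); apply: measurable_funTS.
by apply: emeasurable_funD => //; exact: measurable_log_kernel.
Qed.

Lemma log_potential_pos_kernel lam z : supported_on E lam -> E z ->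
  log_potential lam z = \int[lam]_w pos_kernel z w - C%:E.
Proof.
move=> lamE Ez; rewrite /log_potential (integral_shift mE lamE _ C0)//.
- rewrite integral_mkcond; congr (_ - _); apply: eq_integral => w _.
  by rewrite patchE /pos_kernel (mem_set Ez).
- exact: measurable_log_kernel.
- by move=> w Ew; exact: EC.
Qed.

Lemma log_energy_pos_kernel lam : supported_on E lam ->
  log_energy lam = \int[lam]_z \int[lam]_w pos_kernel z w - C%:E.
Proof.
move=> lamE; rewrite /log_energy -/(\int[lam]_z log_potential lam z).
have U z : E z -> log_potential lam z + C%:E = \int[lam]_w pos_kernel z w.
  by move=> Ez; rewrite log_potential_pos_kernel// subeK.
rewrite (integral_shift mE lamE _ C0)//.
- rewrite integral_mkcond; congr (_ - _); apply: eq_integral => z _.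
  rewrite patchE; case: ifPn => [/set_mem/U//|nEz].
  by rewrite /pos_kernel (negbTE nEz)/= integral0.
- exact: measurable_log_potential cE lamE.
- move=> z Ez; rewrite -sub0e leeBlDr// U//; apply: integral_ge0 => w _.
  exact: pos_kernel_ge0.
Qed.

End kernel_energy.

(** [al] is the minimal energy, [be] the mutual energy of the minimizer and its restriction to a set
    of mass [m], and [g] the energy of that restriction. The first-order change - 2 t dl contradicts
    minimality for small [t]. *)
Lemma variation_contradiction (R : realFieldType) (al m g dl be : R) :
  0 < m -> 0 < dl -> 0 <= al -> g <= al -> be <= (al - dl) * m ->
  ~ (forall t : R, 0 < t < 1 ->
     al <= (1 - t) ^+ 2 * al + 2 * (1 - t) * (t / m) * be + (t / m) ^+ 2 * g).
Proof.
move=> m0 dl0 al0 gal bem H.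
(* With t k = dl / 2 and t <= 1/2 the positive terms of second order sum to at most 3/2 t dl, less
   than the gain 2 t dl. *)
pose k := al / m ^+ 2 + dl.
have am0 : 0 <= al / m ^+ 2 by rewrite divr_ge0// sqr_ge0.
have k0 : 0 < k by rewrite ltr_wpDl.
pose t := dl / (2 * k).
have t0 : 0 < t by rewrite divr_gt0// mulr_gt0.
have t2 : t <= 2^-1.
  by rewrite ler_pdivrMr ?mulr_gt0// mulrA mulVf// mul1r /k lerDr.
have tk : t * k = dl / 2 by rewrite /t; field; rewrite gt_eqF.
have alk : al / m ^+ 2 <= k by rewrite /k lerDl ltW.
clearbody t k; have /H : 0 < t < 1 by rewrite t0; lra.
apply/negP; rewrite -ltNge.
have h1 : 2 * (1 - t) * (t / m) * be <= 2 * (1 - t) * t * (al - dl).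
  have -> : 2 * (1 - t) * t * (al - dl) = 2 * (1 - t) * (t / m) * ((al - dl) * m).
    by field; rewrite gt_eqF.
  apply: ler_wpM2l => //; apply: mulr_ge0; last by rewrite divr_ge0 ?ltW.
  by lra.
have h2 : (t / m) ^+ 2 * g <= t * (t * (al / m ^+ 2)).
  have -> : t * (t * (al / m ^+ 2)) = (t / m) ^+ 2 * al by field; rewrite gt_eqF.
  by rewrite ler_wpM2l// sqr_ge0.
have h3 : t * (al / m ^+ 2) <= dl / 2 by rewrite -tk ler_wpM2l ?(ltW t0).
have h4 : t * (t * (al / m ^+ 2)) <= t * (dl / 2) by rewrite ler_wpM2l// ltW.
have h5 : 0 < t * dl by rewrite mulr_gt0.
have h6 : t * (t * dl) <= t * (dl / 2) by rewrite ler_wpM2l ?(ltW t0)//; nra.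
have h7 : 0 <= t ^+ 2 * al by rewrite mulr_ge0// sqr_ge0.
have e1 : (1 - t) ^+ 2 * al + 2 * (1 - t) * t * (al - dl) =
  al - t ^+ 2 * al - 2 * (t * dl) + 2 * (t * (t * dl)) by ring.
have e2 : t * (dl / 2) = t * dl / 2 by ring.
lra.
Qed.

Section frostman.
Variables (R : realType) (E : set (R * R)) (mu : probability (R * R)%type R) (V : R).
Hypotheses (cE : compact E) (muE : supported_on E mu).
Hypotheses (muV : log_energy mu = V%:E)
  (minE : forall lam : probability (R * R)%type R,
    supported_on E lam -> (V%:E <= log_energy lam)%E).
Variable C : R.
Hypotheses (C0 : 0 <= C) (EC : forall z w, E z -> E w -> (- C%:E <= log_kernel z w)%E).
Implicit Types (z w : R * R).
Local Open Scope ereal_scope.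

Let mE : measurable E.
Proof.
rewrite -[E]setCK; apply: measurableC; apply: open_measurable_plane.
rewrite openC; apply: compact_closed => //; exact: norm_hausdorff.
Qed.

Local Notation k := (pos_kernel E C).

Let kq (q : (R * R) * (R * R)) : \bar R := k q.1 q.2.

Let kq0 q : 0 <= kq q. Proof. exact: pos_kernel_ge0. Qed.

Let mkq : measurable_fun setT kq. Proof. exact: measurable_pos_kernel. Qed.

Let mk z : measurable_fun setT (k z).
Proof. by have : measurable_fun setT (fun w => kq (z, w)) by exact: measurableT_comp. Qed.

Let u z : \bar R := \int[mu]_w k z w.

Let mu_ : measurable_fun setT u.
Proof. exact: (@measurable_fun_fubini_tonelli_F _ _ _ _ _ mu kq mkq kq0). Qed.

Let u0 z : 0 <= u z.
Proof. by apply: integral_ge0 => w _; exact: pos_kernel_ge0. Qed.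

Let al : R := (V + C)%R.

Let int_u : \int[mu]_z u z = al%:E.
Proof.
have := log_energy_pos_kernel cE C0 EC muE; rewrite muV -/u => h.
have -> : al%:E = V%:E + C%:E by [].
by rewrite h subeK.
Qed.

Let al0 : (0 <= al)%R.
Proof. by rewrite -lee_fin -int_u; apply: integral_ge0. Qed.

Let u_potential z : E z -> log_potential mu z = u z - C%:E.
Proof. exact: log_potential_pos_kernel. Qed.

Section variation.
Variables (dl : R) (B : set (R * R)).
Hypotheses (dl0 : (0 < dl)%R) (mB : measurable B)
  (Bu : forall z, B z -> u z <= (al - dl)%:E).

Let v z : \bar R := \int[mu]_(w in B) k z w.

Let vE z : v z = \int[mu]_w (k z w * (\1_B w)%:E).
Proof.
rewrite /v integral_mkcond; apply: eq_integral => w _; rewrite patchE indicE.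
by case: (w \in B); rewrite ?mule1 ?mule0.
Qed.

Let mkB : measurable_fun setT (fun q : (R * R) * (R * R) => kq q * (\1_B q.2)%:E).
Proof.
apply: emeasurable_funM => //; apply/measurable_EFinP.
by apply: measurableT_comp => //; exact: measurable_indic.
Qed.

Let kB0 (q : (R * R) * (R * R)) : 0 <= kq q * (\1_B q.2)%:E.
Proof. by rewrite mule_ge0// lee_fin indicE. Qed.

Let mv : measurable_fun setT v.
Proof.
have -> : v = fun z => \int[mu]_w (k z w * (\1_B w)%:E) by apply/funext.
exact: (@measurable_fun_fubini_tonelli_F _ _ _ _ _ mu
  (fun q => kq q * (\1_B q.2)%:E) mkB kB0).
Qed.

Let v0 z : 0 <= v z.
Proof. by apply: integral_ge0 => w _; exact: pos_kernel_ge0. Qed.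

Let int_v : \int[mu]_z v z = \int[mu]_(z in B) u z.
Proof.
under eq_integral do rewrite vE.
have := @fubini_tonelli _ _ _ _ _ mu mu (fun q => kq q * (\1_B q.2)%:E) mkB kB0.
rewrite /fubini_F /fubini_G /kq /= => ->.
rewrite [RHS]integral_mkcond; apply: eq_integral => w _; rewrite patchE indicE.
case: (w \in B); last by under eq_integral do rewrite mule0; rewrite integral0.
by rewrite /u; apply: eq_integral => z _; rewrite mule1 pos_kernelC.
Qed.

Let v_le_u z : v z <= u z.
Proof. by apply: ge0_subset_integral => // w _; exact: pos_kernel_ge0. Qed.

(** If [B] had mass [m > 0], moving a fraction [t] of the total mass to the normalised restriction
    of [mu] to [B] would give a competitor of smaller energy. *)
Lemma variation_null : mu B = 0.
Proof.
apply/eqP/negPn/negP => Bn0.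
have Bfin : mu B \is a fin_num by exact: fin_num_measure.
have [m m0 Bm] : exists2 m : R, (0 < m)%R & mu B = m%:E.
  exists (fine (mu B)); last by rewrite fineK.
  by rewrite fine_gt0// lt0e Bn0 measure_ge0/= ltey_eq Bfin.
have int_uB : \int[mu]_(z in B) u z <= ((al - dl) * m)%:E.
  rewrite EFinM -Bm -integral_cst//; apply: ge0_le_integral => //.
  exact: measurable_funTS.
have int_vB : \int[mu]_(z in B) v z <= al%:E.
  rewrite -int_u; apply: (@le_trans _ _ (\int[mu]_(z in B) u z)).
    by apply: ge0_le_integral => //; exact: measurable_funTS.
  exact: ge0_subset_integral.
have [be be0 beE] : exists2 be : R, (be <= (al - dl) * m)%R &
    \int[mu]_(z in B) u z = be%:E.
  have fB : \int[mu]_(z in B) u z \is a fin_num.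
    by rewrite ge0_fin_numE ?integral_ge0// (le_lt_trans int_uB)// ltry.
  by exists (fine (\int[mu]_(z in B) u z)); rewrite ?fineK// -lee_fin fineK.
have [g g0 gE] : exists2 g : R, (g <= al)%R & \int[mu]_(z in B) v z = g%:E.
  have fB : \int[mu]_(z in B) v z \is a fin_num.
    by rewrite ge0_fin_numE ?integral_ge0// (le_lt_trans int_vB)// ltry.
  by exists (fine (\int[mu]_(z in B) v z)); rewrite ?fineK// -lee_fin fineK.
apply: (variation_contradiction m0 dl0 al0 g0 be0) => t /andP[t0 t1].
have a0 : (0 <= 1 - t)%R by lra.
have b0 : (0 <= t / m)%R by rewrite divr_ge0// ltW.
have ab1 : ((NngNum a0)%:num%:E + (NngNum b0)%:num%:E * mu B = 1)%E.
  by rewrite Bm /= -EFinM -EFinD; congr EFin; field; rewrite gt_eqF.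
pose lam : probability (R * R)%type R := tilted mB ab1.
have lamE : supported_on E lam by apply: tilted_null => //; exact: measurableC.
have := minE lamE; rewrite (log_energy_pos_kernel cE C0 EC lamE).
have -> : \int[lam]_z \int[lam]_w k z w =
    \int[lam]_z ((1 - t)%:E * u z + (t / m)%:E * v z).
  apply: eq_integral => z _; rewrite ge0_integral_tilted// => w.
  exact: pos_kernel_ge0.
have mau : measurable_fun setT (fun z => (1 - t)%:E * u z) by exact: measurable_funeM.
have mbv : measurable_fun setT (fun z => (t / m)%:E * v z) by exact: measurable_funeM.
have au0 z : 0 <= (1 - t)%:E * u z by rewrite mule_ge0// lee_fin.
have bv0 z : 0 <= (t / m)%:E * v z by rewrite mule_ge0// lee_fin.
rewrite ge0_integral_tilted//; last 2 first.
- by move=> z; rewrite adde_ge0.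
- exact: emeasurable_funD.
rewrite !ge0_integralD//; try exact: measurable_funTS.
rewrite !ge0_integralZl//; try exact: measurable_funTS.
rewrite int_v int_u beE gE /= -!EFinM -!EFinD lee_fin.
rewrite lerBrDr -/al => /le_trans; apply.
by rewrite le_eqVlt; apply/orP; left; apply/eqP; ring.
Qed.

End variation.

Let mlevel (a : \bar R) : measurable [set z | u z <= a].
Proof. by rewrite -[X in measurable X]setTI; exact: emeasurable_fun_infty_c. Qed.

Let mlevel_ge (a : \bar R) : measurable [set z | a <= u z].
Proof. by rewrite -[X in measurable X]setTI; exact: emeasurable_fun_c_infty. Qed.

Let level_null (dl : R) : (0 < dl)%R -> mu [set z | u z <= (al - dl)%:E] = 0.
Proof. by move=> dl0; apply: (variation_null dl0) => //; exact: mlevel. Qed.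

(** The mean of [u] is [al] and [u > al - e] almost everywhere for every e > 0; an excess of [dl] on
    [N] would raise the mean, so dl times the mass of [N] is at most [e]. *)
Let high_null (dl : R) : (0 < dl)%R -> mu [set z | (al + dl)%:E <= u z] = 0.
Proof.
move=> dl0; set N := [set z | _ <= _].
have mN : measurable N by exact: mlevel_ge.
have Nfin : mu N \is a fin_num by exact: fin_num_measure.
suff : (fine (mu N) <= 0)%R.
  by rewrite -lee_fin fineK// => h; apply/eqP; rewrite eq_le h measure_ge0.
rewrite -(@pmulr_rle0 _ dl)//.
suff H (e : R) : (0 < e)%R -> (dl * fine (mu N) <= e)%R.
  by apply/ler_addgt0Pr => e e0; rewrite add0r; exact: H.
move=> e0.
pose D := ~` [set z | u z <= (al - e)%:E].
have mD : measurable D by apply: measurableC; exact: mlevel.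
have muD : mu (~` D) = 0 by rewrite /D setCK; exact: level_null.
have mf : measurable_fun setT (fun z => ((dl + e) * \1_N z + (al - e))%:E).
  apply/measurable_EFinP; apply: measurable_funD => //; apply: measurable_funM => //.
have h0 z : (0 <= (dl + e) * \1_N z)%R.
  by rewrite mulr_ge0 ?addr_ge0 ?(ltW e0) ?(ltW dl0)// indicE.
have := @le_integral_domain _ _ _ mu D mD muD _ u (`|al| + e)%R mf mu_.
rewrite int_u.
have -> : \int[mu]_z ((dl + e) * \1_N z + (al - e))%:E =
    ((dl + e) * fine (mu N) + (al - e))%:E.
  rewrite -(expectation_affine_indic mu (dl + e) (al - e) mN) EFin_expectation//.
  apply: bounded_measurableD; last exact: bounded_measurable_cst.
  apply: bounded_measurableM; first exact: bounded_measurable_cst.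
  split; first exact: measurable_indic.
  by exists 1%R => x; rewrite indicE; case: (x \in N); rewrite ?normr0 ?normr1.
have Ne0 : (0 <= fine (mu N))%R by exact: fine_ge0.
rewrite lee_fin => h; have : ((dl + e) * fine (mu N) + (al - e) <= al)%R.
  apply: h => [|z _|z].
  - by rewrite addr_ge0// ltW.
  - by rewrite lee_fin; have := h0 z; have := ler_norm (- al)%R; rewrite normrN; lra.
  - move=> /negP; rewrite -ltNge => /ltW uz; rewrite indicE.
    have [/set_mem|_] := boolP (z \in N); last by rewrite mulr0 add0r.
    by apply: le_trans; rewrite lee_fin mulr1; lra.
rewrite mulrDl => h'; have : (0 <= e * fine (mu N))%R by rewrite mulr_ge0// ltW.
lra.
Qed.

Lemma open_log_potential_gt (a : R) : open [set z | a%:E < log_potential mu z].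
Proof.
rewrite openE => z /= /(lt_log_potential cE muE)[c c0 acz].
have /cvgrPdist_lt/(_ (smooth_potential mu c z - a)%R) :=
  @continuous_smooth_potential _ _ _ cE muE c c0 z.
rewrite subr_gt0 => /(_ acz); apply: filterS => w /=; rewrite ltr_norml => /andP[_ h].
apply: lt_le_trans (smooth_potential_le cE muE w c0); rewrite lte_fin; lra.
Qed.

(* Frostman: moving mass towards {U <= V - dl} would lower the energy, so
   U >= V almost everywhere, hence U = V almost everywhere. *)
Lemma log_potential_le_robin z : log_potential mu z <= V%:E.
Proof.
apply/lee_addgt0Pr => dl dl0; rewrite -EFinD.
(* Lower semicontinuity makes [K] compact and [high_null] makes it carry [mu], so the domination
   principle applies on [K] with the bound [V + dl], although the bound is not yet known on all of
   [E]. *)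
pose K := E `&` ~` [set z | (V + dl)%:E < log_potential mu z].
have cK : compact K.
  apply: compact_closedI => //; rewrite closedC; exact: open_log_potential_gt.
have mK : measurable K.
  apply: measurableI => //; apply: measurableC; apply: open_measurable_plane.
  exact: open_log_potential_gt.
apply: (@log_potential_domination _ K) => //; last first.
  by move=> w [_ /= /negP]; rewrite -leNgt.
apply/eqP; rewrite /supported_on eq_le measure_ge0 andbT.
have mN := mlevel_ge (al + dl)%:E.
apply: (@le_trans _ _ (mu (~` E `|` [set z | (al + dl)%:E <= u z]))).
  apply: le_measure; rewrite ?inE.
  - exact: measurableC.
  - by apply: measurableU => //; exact: measurableC.
  - move=> w /= nKw; have [Ew|nEw] := pselect (E w); [right|by left].
    apply/ltW; rewrite ltNge; apply/negP => uw; apply: nKw; split=> //=.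
    apply/negP; rewrite -leNgt u_potential// leeBlDr//.
    by rewrite -EFinD addrAC.
apply: (le_trans (measureU2 _ _ _)) => //; first exact: measurableC.
rewrite -[leRHS]adde0; apply: leeD; rewrite le_eqVlt; apply/orP; left; apply/eqP.
  exact: muE.
exact: high_null.
Qed.

End frostman.

(** * The potential outside Omega *)

Section distance_to_compact.
Variables (R : realType) (E : set (R * R)).
Hypotheses (cE : compact E) (E0 : E !=set0).
Implicit Types (z w t : R * R).

Lemma dist_to_attained z : exists2 t, E t & dist_to E z = cdist z t.
Proof.
have [|t /set_mem Et tP] := @compact_EVT_min _ R (fun w => cdist w z) E E0 cE.
  by apply: continuous_subspaceT; exact: continuous_cdist.
exists t => //; rewrite /dist_to.
have lb : lbound [set cdist z t | t in E] (cdist z t).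
  by move=> _ [w Ew <-]; rewrite (cdistC z t) (cdistC z w) tP// inE.
apply/eqP; rewrite eq_le; apply/andP; split.
  by apply: ge_inf; [exists (cdist z t)|exists t].
by apply: lb_le_inf => //; exists (cdist z t), t.
Qed.

Lemma dist_to_le z t : E t -> dist_to E z <= cdist z t.
Proof.
by move=> Et; apply: ge_inf; [exists 0 => _ [w _ <-]; exact: cdist_ge0|exists t].
Qed.

Lemma dist_to_ge0 z : 0 <= dist_to E z.
Proof. by have [t _ ->] := dist_to_attained z; exact: cdist_ge0. Qed.

Lemma dist_to_in z : E z -> dist_to E z = 0.
Proof.
move=> Ez; apply/eqP; rewrite eq_le dist_to_ge0 andbT (le_trans (dist_to_le z Ez))//.
by rewrite leNgt cdist_gt0 eqxx.
Qed.

Lemma dist_to_triangle z w : dist_to E z <= cdist z w + dist_to E w.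
Proof.
have [t Et ->] := dist_to_attained w.
by apply: le_trans (dist_to_le z Et) _; exact: cdist_triangle.
Qed.

Lemma dist_to_compact (s : R) : compact [set z | dist_to E z <= s].
Proof.
have [b b0 Eb] := compact_bounded_plane cE.
apply: (@closed_bounded_compact R _ (s + b)).
  apply: (closed_comp (f := dist_to E) (D := [set x | x <= s])); last exact: closed_le.
  move=> z _; apply/cvgrPdist_lt => e e0; apply/nbhs_cdistP; exists e => // w wz.
  have := dist_to_triangle z w; have := dist_to_triangle w z.
  rewrite ltr_norml (cdistC z w) => h1 h2; apply/andP; split; lra.
move=> z /= zs; have [t Et zt] := dist_to_attained z.
by have := cdist_triangle t z (0, 0); have := Eb t Et; rewrite -zt; lra.
Qed.

Variable mu : probability (R * R)%type R.
Hypothesis muE : supported_on E mu.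

(** One-sided form of Dini's argument: the potential is only lower semicontinuous, but the smooth
    potentials are continuous and increase as [c] decreases, so a lower bound on a compact set
    becomes uniform. *)
Lemma dini (s a e : R) : (forall z, dist_to E z <= s -> (a%:E <= log_potential mu z)%E) ->
  0 < e -> exists2 d : R, 0 < d & forall (c : R) z, 0 < c <= d -> dist_to E z <= s ->
    a - e <= smooth_potential mu c z.
Proof.
move=> aU e0; have [||d d0 dP] := @compact_uniform R [set z | dist_to E z <= s]
    (fun d z => forall c, 0 < c <= d -> a - e <= smooth_potential mu c z) (@dist_to_compact s).
- move=> d d' z /andP[_ d'd] h c /andP[c0 cd]; apply: h.
  by rewrite c0 (le_trans cd).
- move=> z /aU aUz; have : ((a - e)%:E < log_potential mu z)%E.
    by apply: lt_le_trans aUz; rewrite lte_fin ltrBlDr ltrDl.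
  move=> /(lt_log_potential cE muE)[c c0 acz].
  have /cvgrPdist_lt/(_ (smooth_potential mu c z - (a - e))) :=
    @continuous_smooth_potential _ _ _ cE muE c c0 z.
  rewrite subr_gt0 => /(_ acz)/nbhs_cdistP[d d0 dP].
  exists (Num.min c d); first by rewrite lt_min c0.
  move=> w _; rewrite lt_min => /andP[_ /dP]; rewrite ltr_norml => /andP[_ h] c'.
  rewrite le_min => /and3P[c'0 c'c _].
  have : smooth_potential mu c w <= smooth_potential mu c' w.
    by apply: (le_smooth_potential cE muE); rewrite c'0.
  lra.
by exists d => // c z cd zs; exact: dP.
Qed.

End distance_to_compact.

Section outer_domain.
Variables (R : realType) (E : set (R * R)).
Hypothesis cE : compact E.
Implicit Types (z w u : R * R).
Local Notation opc := (one_point_compactification (R * R)%type).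
Local Notation somE := [set (Some z : opc) | z in E].

Lemma Omega_notin z : Omega E z -> ~ E z.
Proof.
move=> /connected_component_sub nE Ez; apply: nE; by exists z.
Qed.

Let line z w (t : R) : R * R := (z.1 + t * (w.1 - z.1), z.2 + t * (w.2 - z.2)).

Let continuous_line z w : continuous (line z w).
Proof.
have c (a b : R) : continuous (fun t : R => a + t * b).
  move=> t; apply: cvgD; first exact: cvg_cst.
  by apply: cvgM; [exact: cvg_id|exact: cvg_cst].
move=> t; exact: (cvg_pair (f := fun t : R => z.1 + t * (w.1 - z.1))
  (g := fun t : R => z.2 + t * (w.2 - z.2)) (c _ _ t) (c _ _ t)).
Qed.

Let connected_Some_line z w (I : set R) : connected I ->
  connected [set (Some (line z w t) : opc) | t in I].
Proof.
move=> cI; apply: connected_continuous_connected => //.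
apply: continuous_subspaceT => t.
apply: (continuous_comp (f := line z w) (g := Some : R * R -> opc)).
  exact: continuous_line.
exact: one_point_compactification_some_continuous.
Qed.

Let cdist_line z w (t : R) : 0 <= t -> cdist (line z w t) z = t * cdist w z.
Proof.
move=> t0; rewrite /cdist /line /=.
have -> : (z.1 + t * (w.1 - z.1) - z.1) ^+ 2 + (z.2 + t * (w.2 - z.2) - z.2) ^+ 2 =
  t ^+ 2 * ((w.1 - z.1) ^+ 2 + (w.2 - z.2) ^+ 2) by ring.
by rewrite sqrtrM ?sqr_ge0// sqrtr_sqr ger0_norm.
Qed.

(** The segment from [z] to [w] stays in a disc free of [E], so it joins [w] to the component of
    [z]. *)
Lemma Omega_disc z w (h : R) : (forall u, cdist u z < h -> ~ E u) ->
  cdist w z < h -> Omega E z -> Omega E w.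
Proof.
move=> zE wz Oz; apply: (@connected_component_trans opc _ (Some z) None (Some w) Oz).
exists [set (Some (line z w t) : opc) | t in `[0, 1]%classic].
  split.
  - exists 0; first by rewrite /= in_itv/= lexx ler01.
    by rewrite /line !mul0r !addr0 -surjective_pairing.
  - move=> _ [t t01 <-] [u Eu [ut]]; apply: (zE u) => //.
    move: t01; rewrite /= in_itv/= => /andP[t0 t1].
    rewrite ut cdist_line//; apply: le_lt_trans wz.
    by rewrite ler_piMl ?cdist_ge0.
  - by apply: connected_Some_line; exact: segment_connected.
exists 1; first by rewrite /= in_itv/= lexx ler01.
by rewrite /line !mul1r !addrA ![_ + _ - _]addrAC !subrr !add0r -surjective_pairing.
Qed.

Lemma Omega_far (b : R) z : 0 <= b -> (forall u, E u -> cdist u (0, 0) <= b) ->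
  b < cdist z (0, 0) -> Omega E z.
Proof.
move=> b0 Eb bz; have z0 : 0 < cdist z (0, 0) by exact: le_lt_trans bz.
pose A : set opc := [set (Some (line (0, 0) z t) : opc) | t in `[1, +oo[%classic].
(* [A] is the ray from [z] away from the origin. Its closure remains connected and contains
   infinity; the ray keeps a distance of at least |z| - b from [E], so the closure avoids [E] as
   well. *)
exists (closure A).
  split.
  - move=> U [C [cC _] CU]; have [d d0 Cd] := compact_bounded_plane cC.
    pose t : R := Num.max 1 ((d + 1) / cdist z (0, 0)).
    have t1 : 1 <= t by rewrite le_max lexx.
    have td : (d + 1) / cdist z (0, 0) <= t by rewrite le_max lexx orbT.
    exists (Some (line (0, 0) z t)); split.
      by exists t => //; rewrite /= in_itv/= t1.
    apply: CU; left; exists (line (0, 0) z t) => //= /Cd.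
    rewrite cdist_line ?(le_trans ler01)//; move: td; rewrite ler_pdivrMr//; lra.
  - move=> y Ay [u Eu uy]; move: Ay; rewrite -uy => Ay.
    have zb : 0 < cdist z (0, 0) - b by rewrite subr_gt0.
    have /Ay[_ [[t t1 <-] [v vu [vt]]]] :
        nbhs (Some u : opc) (Some @` [set v | cdist v u < cdist z (0, 0) - b]).
      apply: one_point_compactification_some_nbhs.
      by apply/nbhs_cdistP; exists (cdist z (0, 0) - b).
    move: t1; rewrite /= in_itv/= andbT => t1.
    have : cdist z (0, 0) <= cdist v (0, 0).
      rewrite vt cdist_line ?(le_trans ler01)//.
      by rewrite ler_peMl ?(ltW z0).
    by move: vu; have := cdist_triangle u v (0, 0); have := Eb u Eu; rewrite /=; lra.
  - apply: connected_closure; apply: connected_Some_line.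
    exact/connected_intervalP/interval_is_interval.
apply: subset_closure; exists 1; first by rewrite /= in_itv/= lexx.
by rewrite /line /= !subr0 !mul1r !add0r -surjective_pairing.
Qed.

Lemma outside_Omega_compact : compact (~` Omega E).
Proof.
have [b b0 Eb] := compact_bounded_plane cE.
apply: (@closed_bounded_compact R _ b) => [|z nOz]; last first.
  by rewrite leNgt; apply/negP => /(Omega_far (ltW b0) Eb).
rewrite closedC openE => z Oz; have nEz := Omega_notin Oz.
have : open (~` E) by rewrite openC; apply: compact_closed => //; exact: norm_hausdorff.
rewrite openE => /(_ z nEz)/nbhs_cdistP[e e0 eE].
apply/nbhs_cdistP; exists e => // w wz.
exact: Omega_disc eE wz Oz.
Qed.

Variable mu : probability (R * R)%type R.
Hypotheses (muE : supported_on E mu) (E0 : E !=set0).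

Let small_step (e c s : R) : 0 < e -> 0 < c -> 0 < s ->
  exists2 h : R, 0 < h <= s & 2 * h ^+ 4 <= c ^+ 2 /\ 2 * h ^+ 4 / c ^+ 2 < 4 * e * h ^+ 2.
Proof.
move=> e0 c0 s0; pose m : R := Num.min s (Num.min 1 (Num.min (c ^+ 2 / 2) (e * c ^+ 2))).
have c20 : 0 < c ^+ 2 by rewrite exprn_gt0.
have m0 : 0 < m by rewrite !lt_min s0 ltr01 divr_gt0// mulr_gt0.
have ms : m <= s by rewrite ge_min lexx.
have m1 : m <= 1 by rewrite !ge_min lexx orbT.
have mc : m <= c ^+ 2 / 2 by rewrite !ge_min lexx !orbT.
have me : m <= e * c ^+ 2 by rewrite !ge_min lexx !orbT.
exists m; first by rewrite m0.
have m2 : m ^+ 2 <= m by rewrite expr2 ler_piMr// ltW.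
have m20 : 0 < m ^+ 2 by rewrite exprn_gt0.
have m4 : m ^+ 4 = m ^+ 2 * m ^+ 2 by ring.
have m4m : m ^+ 4 <= m by rewrite m4 (le_trans _ m2)// ler_piMr ?(ltW m20)// (le_trans m2).
split; first by lra.
rewrite ltr_pdivrMr// m4 mulrA.
have -> : 4 * e * m ^+ 2 * c ^+ 2 = 2 * m ^+ 2 * (2 * (e * c ^+ 2)) by ring.
by rewrite ltr_pM2l ?mulr_gt0//; lra.
Qed.

(* -U_c is nearly subharmonic, so over the complement of Omega it is
   dominated by its values near E. *)
Lemma log_potential_outside_Omega (s a : R) z0 : 0 < s ->
  (forall z, dist_to E z <= s -> (a%:E <= log_potential mu z)%E) ->
  ~ Omega E z0 -> (a%:E <= log_potential mu z0)%E.
Proof.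
move=> s0 aU nOz0; apply/lee_subgt0Pr => e e0.
have [d d0 dP] := dini cE E0 muE aU (divr_gt0 e0 (ltr0n R 2)).
have [b b0 Eb] := compact_bounded_plane cE.
have b20 : 0 < b ^+ 2 by rewrite exprn_gt0.
pose e1 : R := e / (2 * b ^+ 2).
have e10 : 0 < e1 by rewrite divr_gt0// mulr_gt0.
have e1b : e1 * b ^+ 2 = e / 2 by rewrite /e1; field; rewrite gt_eqF.
pose F z := e1 * sqdist z (0, 0) - smooth_potential mu d z.
have cF : continuous F.
  move=> z; apply: cvgB; last exact: (continuous_smooth_potential cE muE d0).
  by apply: cvgM; [exact: cvg_cst|exact: (@continuous_sqdist R)].
have [z nOz /negP zs|z [nOz zs Fz]] := cross_maximum (Bd := [set z | dist_to E z <= s])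
    outside_Omega_compact cF nOz0.
  have [h /andP[h0 hs] [hd he]] := small_step e10 d0 (divr_gt0 s0 (ltr0n R 2)).
  move: zs; rewrite -ltNge => zs; exists h.
    (* A neighbour [v] in Omega would pull [z] into Omega: the disc about [v] of radius
       [dist_to E z - h] is free of [E], and it contains [z] because h <= s/2 and dist_to E z >
       s. *)
    move=> v /(cdist_cross (ltW h0)) vz Ov; apply: nOz.
    apply: (Omega_disc (h := dist_to E z - h) _ _ Ov) => [u uv Eu|].
      have := dist_to_le z Eu; have := cdist_triangle v u z.
      by rewrite vz (cdistC z u); lra.
    by rewrite cdistC vz; lra.
  rewrite sumrB -mulr_sumr sum_cross_sqdist.
  have := cross_smooth_potential_le cE muE z d0 hd; rewrite /F; lra.
rewrite -EFinB; apply: le_trans (smooth_potential_le cE muE z0 d0); rewrite lee_fin.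
have zb : e1 * sqdist z (0, 0) <= e / 2.
  rewrite -e1b ler_pM2l// -sqr_cdist lerXn2r ?nnegrE ?cdist_ge0 ?(ltW b0)//.
  by rewrite leNgt; apply/negP => /(Omega_far (ltW b0) Eb).
have := dP d z; rewrite d0 lexx => /(_ isT zs).
have : 0 <= e1 * sqdist z0 (0, 0) by rewrite mulr_ge0 ?sqdist_ge0// ltW.
by move: Fz; rewrite /F; lra.
Qed.

End outer_domain.

(** * Potentials and energies of polygons *)

Section polygon_mean_theory.
Variable R : realType.
Implicit Types (f g : nat -> R) (m : nat).

Let pow_gt0 m : 0 < (2 : R) ^+ m. Proof. by rewrite exprn_gt0. Qed.

Lemma polygon_mean_le m f g : (forall i, f i <= g i) -> polygon_mean m f <= polygon_mean m g.
Proof. by move=> fg; rewrite /polygon_mean ler_pM2r ?invr_gt0//; exact: ler_sum. Qed.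

Lemma polygon_meanD m f g :
  polygon_mean m (fun i => f i + g i) = polygon_mean m f + polygon_mean m g.
Proof. by rewrite /polygon_mean big_split/= mulrDl. Qed.

Lemma polygon_mean_cst m (k : R) : polygon_mean m (fun=> k) = k.
Proof.
rewrite /polygon_mean sumr_const_nat subn0 -[_ *+ _]mulr_natr natrX mulfK//.
Qed.

End polygon_mean_theory.

Lemma Rintegral_sum_nat d (T : measurableType d) (R : realType)
    (mu : {measure set T -> \bar R}) (f : nat -> T -> R) (N : nat) :
  (forall i, mu.-integrable setT (EFin \o f i)) ->
  mu.-integrable setT (EFin \o (fun x => \sum_(0 <= i < N) f i x)) /\
  (\int[mu]_x (\sum_(0 <= i < N) f i x))%R = \sum_(0 <= i < N) (\int[mu]_x f i x)%R.
Proof.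
move=> fi; elim: N => [|N [iS IS]].
  have E0 : (fun x => \sum_(0 <= i < 0) f i x) = (fun=> 0).
    by apply/funext => x; rewrite big_nil.
  rewrite E0 big_nil; split; first exact: integrable0.
  by rewrite /Rintegral integral0.
have ES : (fun x => \sum_(0 <= i < N.+1) f i x) =
    (fun x => \sum_(0 <= i < N) f i x + f N x).
  by apply/funext => x; rewrite big_nat_recr.
rewrite ES big_nat_recr//= -IS; split; first exact: (integrableD measurableT iS (fi N)).
by rewrite RintegralD.
Qed.

Lemma integrable_domain_le d (T : measurableType d) (R : realType) (P : probability T R)
    (D : set T) (f : T -> R) (K : R) : measurable D -> P (~` D) = 0%E ->
  P.-integrable setT (EFin \o f) -> (forall x, D x -> f x <= K) ->
  (\int[P]_x f x)%R <= K.
Proof.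
move=> mD PD iF fK; have [mf _] := integrableP _ _ _ iF.
rewrite -lee_fin fineK; last exact: integrable_fin_num.
rewrite (integral_domain mD PD mf) -[leRHS](integral_cst_domain mD PD K).
apply: le_integral => //; first exact: integrableS iF.
- exact: finite_measure_integrable_cst.
- by move=> x /set_mem Dx; rewrite lee_fin fK.
Qed.

Section polygon_potential.
Variables (R : realType) (E : set (R * R)) (mu : probability (R * R)%type R) (r : R).
Hypotheses (cE : compact E) (muE : supported_on E mu) (E0 : E !=set0) (r0 : 0 < r).
Implicit Types (z w : R * R).

Let mE : measurable E.
Proof.
rewrite -[E]setCK; apply: measurableC; apply: open_measurable_plane.
rewrite openC; apply: compact_closed => //; exact: norm_hausdorff.
Qed.

Lemma polygon_mean_smooth_potential (c : R) z m : 0 < c ->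
  mu.-integrable setT (EFin \o (fun w =>
    polygon_mean m (fun i => smooth_log c (vertex z r m i) w))) /\
  (\int[mu]_w polygon_mean m (fun i => smooth_log c (vertex z r m i) w))%R =
  polygon_mean m (fun i => smooth_potential mu c (vertex z r m i)).
Proof.
move=> c0; have iL i := integrable_smooth_log cE muE (vertex z r m i) c0.
have [iS IS] := @Rintegral_sum_nat _ _ _ mu
  (fun i w => smooth_log c (vertex z r m i) w) (2 ^ m) iL.
split; first exact: (integrableZr measurableT (2 ^+ m)^-1 iS).
by rewrite /polygon_mean RintegralZr// IS.
Qed.

(** For |z - w| > r the circle mean is exactly log 1/|z - w|. The two error terms come from sqrt c
    beside |z - w| > r and from the finite number of vertices. *)
Lemma log_potential_polygon_far (c : R) z m : r < dist_to E z -> 0 < c ->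
  (log_potential mu z <= (polygon_mean m (fun i => smooth_potential mu c (vertex z r m i))
     + (Num.sqrt c / r + ln 2 / 2 ^+ m))%:E)%E.
Proof.
move=> rz c0; apply: (log_potential_le cE muE) => a a0.
have [iP <-] := polygon_mean_smooth_potential z m c0.
have iL := integrable_smooth_log cE muE z a0.
have sc0 : 0 < Num.sqrt c by rewrite sqrtr_gt0.
set k := _ / r + _; rewrite -lerBlDl.
have ik : mu.-integrable setT (EFin \o (fun _ : R * R => k)).
  exact/bounded_measurable_integrable/bounded_measurable_cst.
rewrite -RintegralB//; apply: (integrable_domain_le mE muE).
  exact: (integrableB measurableT iL iP).
move=> w Ew; have zw : r < cdist z w by exact: lt_le_trans rz (dist_to_le z Ew).
have x0 := lt_trans r0 zw.
have := polygon_mean_smooth_log_ge m z w r0 c0; rewrite (max_idPl (ltW zw)).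
have : smooth_log a z w <= - ln (cdist z w).
  have zw' : z != w by rewrite -cdist_gt0.
  by have := smooth_log_le_log_kernel z w a0; rewrite log_kernelE// lee_fin.
have y0 : 0 < (cdist z w + Num.sqrt c) / cdist z w by rewrite divr_gt0// addr_gt0.
have : ln (cdist z w + Num.sqrt c) - ln (cdist z w) <= Num.sqrt c / r.
  rewrite -ln_div ?posrE ?addr_gt0//; apply: le_trans (ln_le_subr1 y0) _.
  have -> : (cdist z w + Num.sqrt c) / cdist z w - 1 = Num.sqrt c / cdist z w.
    by field; rewrite gt_eqF.
  by rewrite ler_pM2l// lef_pV2 ?posrE// ltW.
rewrite /k; lra.
Qed.

End polygon_potential.

Lemma div_pow2_small (R : realType) (K e : R) : 0 < e ->
  exists m0 : nat, forall m, (m0 <= m)%N -> K / 2 ^+ m <= e.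
Proof.
move=> e0; exists (Num.truncn (`|K| / e)).+1 => m m0m.
have p0 : (0 : R) < 2 ^+ m by rewrite exprn_gt0.
rewrite ler_pdivrMr// mulrC -ler_pdivrMr//.
have Ke : K / e <= `|K| / e by rewrite ler_pM2r ?invr_gt0// ler_norm.
apply: le_trans Ke _; apply: (@le_trans _ _ m%:R).
  apply: (@le_trans _ _ (Num.truncn (`|K| / e)).+1%:R); last by rewrite ler_nat.
  by apply/ltW/truncnS_gt.
by rewrite -natrX ler_nat ltnW// ltn_expl.
Qed.

Lemma smooth_logC (R : realType) (c : R) (z w : R * R) : smooth_log c z w = smooth_log c w z.
Proof. by rewrite /smooth_log sqdistC. Qed.

Lemma ln_ratio_le (R : realType) (a b s : R) : 0 < a -> 0 < s -> a <= b ->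
  ln (a / s) <= ln (b / s).
Proof.
move=> a0 s0 ab; have b0 := lt_le_trans a0 ab.
by rewrite ler_ln ?posrE ?divr_gt0// ler_pM2r ?invr_gt0.
Qed.

Lemma half_log_bound (R : realFieldType) (a l g q : R) :
  0 <= q -> g <= 1 + q - 1 -> a <= 2 * l + g -> - l <= - (a / 2) + q.
Proof. lra. Qed.

Lemma near_vertex_arith (R : realFieldType) (p u V M e s l : R) : 0 <= M ->
  s <= e / 2 -> l <= e / 2 -> u <= p + (s + l) -> - p <= V - u + M - V + e.
Proof. lra. Qed.

Lemma far_vertex_arith (R : realFieldType) (p u V M e s l : R) : V - M <= u ->
  s <= e / 2 -> l <= e / 2 -> u <= p + (s + l) -> - p <= 0 + M - V + e.
Proof. lra. Qed.

Section vertex_energies.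
Variables (R : realType) (r c : R).
Hypotheses (r0 : 0 < r) (c0 : 0 < c).
Implicit Types (z w : R * R).

Definition vertex_energy m z w : R := polygon_mean m (fun i =>
  polygon_mean m (fun j => smooth_log c (vertex z r m i) (vertex w r m j))).

Let sc0 : 0 < Num.sqrt c. Proof. by rewrite sqrtr_gt0. Qed.

Let inner_le m z w i (b : R) : cdist z w <= b ->
  polygon_mean m (fun j => smooth_log c (vertex z r m i) (vertex w r m j))
  <= - ln (Num.max (cdist w (vertex z r m i)) r) +
     ln ((b + 2 * r + Num.sqrt c) / Num.sqrt c) / 2 ^+ m.
Proof.
move=> zwb.
have -> : polygon_mean m (fun j => smooth_log c (vertex z r m i) (vertex w r m j)) =
    polygon_mean m (fun j => smooth_log c (vertex w r m j) (vertex z r m i)).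
  by congr polygon_mean; apply/funext => j; rewrite smooth_logC.
apply: le_trans (polygon_mean_smooth_log_le m w (vertex z r m i) r0 c0) _.
rewrite lerD2l ler_pM2r ?invr_gt0 ?exprn_gt0//.
have := cdist_triangle z w (vertex z r m i).
rewrite (cdistC z (vertex _ _ _ _)) cdist_vertex ?(ltW r0)// (cdistC w z) => wz.
have d0 := cdist_ge0 w (vertex z r m i); have e0 := cdist_ge0 z w.
apply: ln_ratio_le => //.
  by rewrite addr_gt0// ltr_wpDl.
by rewrite lerD2r mulr_natl mulr2n addrA lerD2r (le_trans wz)// lerD2r.
Qed.

(** Every vertex is at distance [r] from the centre, where the potential of the polygon is nearly
    [- ln r]. *)
Lemma vertex_energy_diag m z :
  vertex_energy m z z <= - ln r + ln ((2 * r + Num.sqrt c) / Num.sqrt c) / 2 ^+ m.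
Proof.
rewrite -[leRHS](polygon_mean_cst m); apply: polygon_mean_le => i.
have zz : cdist z z <= 0 by rewrite leNgt cdist_gt0 eqxx.
have := @inner_le m z z i 0 zz.
by rewrite cdistC cdist_vertex ?(ltW r0)// maxxx add0r.
Qed.

(** Averaging over the polygon of [w] gives log 1/max(x, r), with x the distance of [w] to a vertex
    of the other polygon. Since x^2 + c <= max(x, r)^2 (1 + c / r^2), this is again a smooth
    logarithm up to c / r^2, and the average over the polygon of [z] applies to it. *)
Lemma vertex_energy_offdiag m z w (b : R) : z != w -> cdist z w <= b ->
  vertex_energy m z w <= - ln (cdist z w) + c / r ^+ 2 +
    2 * (ln ((b + 2 * r + Num.sqrt c) / Num.sqrt c) / 2 ^+ m).
Proof.
move=> zw zwb; set k := ln _ / _.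
have p0 : 0 < cdist z w by rewrite cdist_gt0.
have h i : polygon_mean m (fun j => smooth_log c (vertex z r m i) (vertex w r m j)) <=
    smooth_log c (vertex z r m i) w + (c / r ^+ 2 + k).
  apply: le_trans (inner_le m i zwb) _; rewrite -/k addrA lerD2r.
  set v := vertex z r m i; rewrite /smooth_log -sqr_cdist (cdistC v w).
  set x := cdist w v; have x0 : 0 <= x by exact: cdist_ge0.
  set M := Num.max x r; have M0 : 0 < M by rewrite lt_max r0 orbT.
  have xM : x <= M by rewrite le_max lexx.
  have rM : r <= M by rewrite le_max lexx orbT.
  have xc : 0 < x ^+ 2 + c by rewrite ltr_wpDl// sqr_ge0.
  have r20 : 0 < r ^+ 2 by rewrite exprn_gt0.
  have g0 : 0 < 1 + c / r ^+ 2 by rewrite addr_gt0// divr_gt0.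
  have : ln (x ^+ 2 + c) <= ln M *+ 2 + ln (1 + c / r ^+ 2).
    rewrite -lnXn// -lnM ?posrE ?exprn_gt0// ler_ln ?posrE ?mulr_gt0 ?exprn_gt0//.
    rewrite mulrDr mulr1 lerD//.
      by rewrite lerXn2r ?nnegrE// ltW.
    rewrite mulrCA ler_peMr ?(ltW c0)// ler_pdivlMr// mul1r.
    by rewrite lerXn2r ?nnegrE ?(ltW r0) ?(ltW M0).
  have := ln_le_subr1 g0; have cr : 0 <= c / r ^+ 2 by rewrite divr_ge0// ltW.
  rewrite -(mulr_natl (ln M)).
  move=> h1 h2; exact: (half_log_bound cr h1 h2).
apply: le_trans (polygon_mean_le m h) _.
rewrite polygon_meanD polygon_mean_cst.
have h2 : polygon_mean m (fun i => smooth_log c (vertex z r m i) w) <= - ln (cdist z w) + k.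
  apply: le_trans (polygon_mean_smooth_log_le m z w r0 c0) _.
  have M0 : 0 < Num.max (cdist z w) r by rewrite lt_max r0 orbT.
  rewrite lerD//.
    by rewrite lerN2 ler_ln ?posrE// le_max lexx.
  rewrite /k ler_pM2r ?invr_gt0 ?exprn_gt0//; apply: ln_ratio_le => //.
    by rewrite addr_gt0// addr_gt0.
  by rewrite lerD2r lerD// mulr_natl mulr2n lerDl ltW.
lra.
Qed.

End vertex_energies.

Section vertex_potentials.
Variables (R : realType) (E : set (R * R)) (mu : probability (R * R)%type R) (r V M : R).
Hypotheses (cE : compact E) (muE : supported_on E mu) (E0 : E !=set0) (r0 : 0 < r).
Variable u : R * R -> R.
Hypotheses (uE : forall z, log_potential mu z = (u z)%:E) (uV : forall z, u z <= V)
  (M0 : 0 <= M) (uM : forall z, dist_to E z <= 2 * r -> V - M <= u z)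
  (uO : forall z, ~ Omega E z -> V - M <= u z).

Lemma vertex_potential_ge (e : R) : 0 < e -> exists2 d : R, 0 < d &
  exists m0 : nat, forall (c : R) m z, 0 < c <= d -> (m0 <= m)%N ->
  - polygon_mean m (fun i => smooth_potential mu c (vertex z r m i)) <=
  (if z \in Omega E then V - u z else 0) + M - V + e.
Proof.
move=> e0; have e20 : 0 < e / 2 by rewrite divr_gt0.
have aU z : dist_to E z <= 2 * r -> ((V - M)%:E <= log_potential mu z)%E.
  by move=> zr; rewrite uE lee_fin uM.
have [d d0 dP] := dini cE E0 muE aU e0.
have [m0 m0P] := div_pow2_small (ln 2) e20.
pose d' : R := Num.min d ((e / 2 * r) ^+ 2).
exists d'; first by rewrite lt_min d0 exprn_gt0// mulr_gt0.
exists m0 => c m z /andP[c0 cd'] m0m.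
have cd : c <= d by rewrite (le_trans cd')// ge_min lexx.
have ce : Num.sqrt c / r <= e / 2.
  rewrite ler_pdivrMr// -[leRHS]ger0_norm ?(mulr_ge0 (ltW e20) (ltW r0))//.
  by rewrite -sqrtr_sqr ler_wsqrtr// (le_trans cd')// ge_min lexx orbT.
have g0 : 0 <= (if z \in Omega E then V - u z else 0) by case: ifP => // _; rewrite subr_ge0.
(* In the first case all vertices are within 2 r of [E], and the Green term, nonnegative by
   Frostman's inequality, is discarded. *)
have [zr|rz] := leP (dist_to E z) r.
  suff : V - M - e <= polygon_mean m (fun i => smooth_potential mu c (vertex z r m i)) by lra.
  rewrite -[leLHS](polygon_mean_cst m); apply: polygon_mean_le => i.
  apply: dP; first by rewrite c0.
  have := dist_to_triangle cE E0 (vertex z r m i) z.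
  by rewrite cdist_vertex ?(ltW r0)//; lra.
have := log_potential_polygon_far cE muE r0 m rz c0; rewrite uE lee_fin.
have := m0P m m0m.
move=> h1 h2; case: ifPn => [_|]; first exact: near_vertex_arith M0 ce h1 h2.
by rewrite notin_setE => /uO h3; exact: far_vertex_arith h3 ce h1 h2.
Qed.

End vertex_potentials.

Section averaged_vertices.
Variables (R : realType) (n : nat) (Z : 'I_n -> R * R) (r : R).
Hypothesis r0 : 0 < r.

Lemma polygon_mean_sum m (I : finType) (a : R) (f : I -> nat -> R) :
  polygon_mean m (fun i => a * \sum_k f k i) = a * \sum_k polygon_mean m (f k).
Proof.
rewrite /polygon_mean -mulr_sumr -mulr_suml exchange_big/=.
by rewrite mulrA.
Qed.

Lemma mean_prod m (f : 'I_n -> nat -> R) :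
  #|{: 'I_n * 'I_(2 ^ m)}|%:R^-1 * \sum_(i : 'I_n * 'I_(2 ^ m)) f i.1 i.2 =
  n%:R^-1 * \sum_k polygon_mean m (f k).
Proof.
rewrite card_prod !card_ord natrM invfM natrX -mulrA; congr (_ * _).
rewrite -(pair_bigA _ (fun k (i : 'I_(2 ^ m)) => f k i))/= mulr_sumr.
by apply: eq_bigr => k _; rewrite /polygon_mean big_mkord mulrC.
Qed.

Lemma double_mean_prod m (f : R * R -> R * R -> R) (p_ : 'I_n -> nat -> R * R) :
  #|{: 'I_n * 'I_(2 ^ m)}|%:R^-1 * (#|{: 'I_n * 'I_(2 ^ m)}|%:R^-1 *
    \sum_(i : 'I_n * 'I_(2 ^ m)) \sum_(j : 'I_n * 'I_(2 ^ m)) f (p_ i.1 i.2) (p_ j.1 j.2)) =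
  n%:R^-1 * (n%:R^-1 * \sum_k \sum_l
    polygon_mean m (fun i => polygon_mean m (fun j => f (p_ k i) (p_ l j)))).
Proof.
rewrite mulr_sumr.
under eq_bigr => i _ do rewrite (mean_prod m (fun l j => f (p_ i.1 i.2) (p_ l j))).
rewrite (mean_prod m (fun k i => n%:R^-1 * \sum_l polygon_mean m (fun j => f (p_ k i) (p_ l j)))).
under eq_bigr => k _ do rewrite polygon_mean_sum.
by rewrite -mulr_sumr.
Qed.

Lemma mean_le (f g : 'I_n -> R) : (forall k, f k <= g k) ->
  n%:R^-1 * \sum_k f k <= n%:R^-1 * \sum_k g k.
Proof. by move=> fg; rewrite ler_wpM2l ?invr_ge0//; apply: ler_sum. Qed.

(** [m] depends on [c], since the polygon errors involve ln (1 / sqrt c) / 2^m. The [n] diagonal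
    terms among the n^2 produce [- ln r / n]. *)
Lemma vertex_energies_le (e : R) : (0 < n)%N -> injective Z -> 0 < e ->
  exists2 d : R, 0 < d & forall c : R, 0 < c < d -> exists m0 : nat, forall m, (m0 <= m)%N ->
  n%:R^-1 * (n%:R^-1 * \sum_k \sum_l vertex_energy r c m (Z k) (Z l)) <=
  n%:R^-1 * (n%:R^-1 * \sum_k \sum_(l | l != k) - ln (cdist (Z k) (Z l))) - ln r / n%:R + e.
Proof.
move=> n0 injZ e0; have e40 : 0 < e / 2 by rewrite divr_gt0.
have r20 : 0 < r ^+ 2 by rewrite exprn_gt0.
exists (e / 2 * r ^+ 2); first by rewrite mulr_gt0.
move=> c /andP[c0 cd].
pose b : R := \sum_k \sum_l cdist (Z k) (Z l).
have Zb k l : cdist (Z k) (Z l) <= b.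
  rewrite /b (bigD1 k)//= (bigD1 l)//= -addrA lerDl addr_ge0//.
    by apply: sumr_ge0 => ? _; exact: cdist_ge0.
  by apply: sumr_ge0 => ? _; apply: sumr_ge0 => ? _; exact: cdist_ge0.
have [m1 m1P] := div_pow2_small (ln ((2 * r + Num.sqrt c) / Num.sqrt c)) e40.
have [m2 m2P] := div_pow2_small (2 * ln ((b + 2 * r + Num.sqrt c) / Num.sqrt c)) e40.
exists (maxn m1 m2) => m; rewrite geq_max => /andP[/m1P h1 /m2P h2].
have nR : (n%:R : R) != 0 by rewrite pnatr_eq0 -lt0n.
have row k : n%:R^-1 * \sum_l vertex_energy r c m (Z k) (Z l) <=
    n%:R^-1 * (\sum_(l | l != k) - ln (cdist (Z k) (Z l)) - ln r) + e.
  have -> : e = n%:R^-1 * \sum_(l < n) e.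
    by rewrite sumr_const card_ord -[e *+ n]mulr_natl mulKf.
  rewrite -mulrDr ler_wpM2l ?invr_ge0// (bigD1 k)//= [X in _ <= _ + X](bigD1 k)//=.
  rewrite [leLHS]addrC [X in _ <= _ + X]addrC addrACA -big_split/= lerD//.
    apply: ler_sum => l lk.
    have kl : Z k != Z l by apply: contra lk => /eqP/injZ ->.
    have := vertex_energy_offdiag r0 c0 m kl (Zb k l).
    have : c / r ^+ 2 <= e / 2 by rewrite ler_pdivrMr// ltW.
    move: h2; rewrite -mulrA; lra.
  have := vertex_energy_diag r0 c0 m (Z k); lra.
rewrite mulr_sumr; apply: le_trans (mean_le row) _.
rewrite big_split/= sumr_const card_ord -mulr_sumr big_split/= sumr_const card_ord.
rewrite -[(- ln r) *+ n]mulr_natl -[e *+ n]mulr_natl.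
rewrite mulrDr (mulKf nR e) [n%:R^-1 * (_ + _)]mulrDr (mulKf nR (- ln r)).
by rewrite mulrDr mulrN [ln r / _]mulrC.
Qed.

End averaged_vertices.

Lemma limit_bound_arith (R : rcfType) (A Q x : R) : 0 <= A ->
  (forall e : R, 0 < e -> exists y : R, [/\ 0 <= y, y ^+ 2 <= A * (Q + e) & x <= y + 2 * e]) ->
  x <= Num.sqrt (A * Q).
Proof.
move=> A0 H; rewrite leNgt; apply/negP => hx.
pose s : R := Num.sqrt (A * Q); have s0 : 0 <= s by exact: sqrtr_ge0.
have sAQ : A * Q <= s ^+ 2.
  have [q0|/ltW q0] := leP 0 (A * Q); first by rewrite sqr_sqrtr.
  by rewrite (le_trans q0)// sqr_ge0.
pose t : R := x - s; have t0 : 0 < t by rewrite subr_gt0.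
have A10 : 0 < 8 * (A + 1) by lra.
(* The first bound gives y >= s + t/2; the second gives A e <= t^2 / 8, so y^2 <= s^2 + t^2 / 8, a
   contradiction. *)
pose e : R := Num.min (t / 4) (t ^+ 2 / (8 * (A + 1))).
have e0 : 0 < e by rewrite lt_min !divr_gt0// exprn_gt0.
have e1 : e <= t / 4 by rewrite ge_min lexx.
have e2 : e * (8 * (A + 1)) <= t ^+ 2 by rewrite -ler_pdivlMr// ge_min lexx orbT.
have [y [y0 y2 xy]] := H e e0.
have yt : s + t / 2 <= y by rewrite /t in e1 *; lra.
have : (s + t / 2) ^+ 2 <= y ^+ 2 by rewrite lerXn2r ?nnegrE ?addr_ge0 ?divr_ge0 ?(ltW t0).
have := mulr_ge0 s0 (ltW t0); have : 0 < t ^+ 2 by rewrite exprn_gt0.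
by clear -y2 sAQ e2 e0; nra.
Qed.

Lemma expectation_dist_le d (T : measurableType d) (R : realType) (P : probability T R)
    (f g : T -> R) (k e : R) : bounded_measurable f -> bounded_measurable g ->
  (forall x, `|f x - k * g x| <= e) ->
  `|(\int[P]_x f x)%R - k * (\int[P]_x g x)%R| <= e.
Proof.
move=> bf bg fg; have bk := bounded_measurableM (bounded_measurable_cst T (- k)) bg.
have <- : (\int[P]_x (f x + - k * g x) = \int[P]_x f x - k * \int[P]_x g x)%R.
  by rewrite bounded_expectationD// bounded_expectationZ// mulNr.
apply: norm_expectation_le => [|x]; first exact: bounded_measurableD.
by rewrite mulNr.
Qed.

Lemma mean_dist_le (R : realType) (I : finType) (f g : I -> R) (k : R) : (0 < #|I|)%N ->
  (forall i, `|f i - g i| <= k) ->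
  `|#|I|%:R^-1 * (\sum_i f i) - #|I|%:R^-1 * \sum_i g i| <= k.
Proof.
move=> I0 fg; have I1 : (0 : R) < #|I|%:R by rewrite ltr0n.
rewrite -mulrBr -sumrB normrM gtr0_norm ?invr_gt0// mulrC ler_pdivrMr//.
apply: le_trans (ler_norm_sum _ _ _) _; rewrite mulr_natr -sumr_const.
exact: ler_sum.
Qed.


Lemma deviation_arith (R : realFieldType) (P w S S' s s' m e : R) : 0 < P ->
  `|S - S'| <= w -> `|s - P * S'| <= e -> `|s' - P * m| <= e ->
  P * (`|S - m| - w) <= `|s - s'| + 2 * e.
Proof.
move=> P0 h1 h2 h3.
have h4 : `|S - m| <= `|S - S'| + `|S' - m|.
  by rewrite (le_trans _ (ler_normD _ _))// addrA subrK.
have h5 : P * `|S' - m| <= `|s - s'| + 2 * e.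
  rewrite -[X in X * _](gtr0_norm P0) -normrM.
  have -> : P * (S' - m) = (s - s') - (s - P * S') + (s' - P * m) by ring.
  apply: le_trans (ler_normD _ _) _.
  have := ler_normB (s - s') (s - P * S'); lra.
have : P * (`|S - m| - w) <= P * `|S' - m| by rewrite ler_pM2l//; lra.
lra.
Qed.

(** * From the smoothed estimate to the limit *)

Section deviation.
Variables (R : realType) (E : set (R * R)) (mu : probability (R * R)%type R).
Hypotheses (cE : compact E) (muE : supported_on E mu).
Variables (n : nat) (Z : 'I_n -> R * R) (r : R).
Hypotheses (n0 : (0 < n)%N) (r0 : 0 < r).
Variables (phi : R * R -> R) (w D : R).
Hypotheses (cphi : continuous phi)
  (phi_support : compact (closure [set z | phi z != 0]))
  (phi_partials : partials_exist_ae phi)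
  (phi_acl : absolutely_continuous_on_lines phi)
  (phiD : (dirichlet_integral phi <= D%:E)%E)
  (phiw : forall z z', cdist z z' <= r -> `|phi z - phi z'| <= w).

Definition deviation_energy c m : R :=
  n%:R^-1 * (n%:R^-1 * \sum_k \sum_l vertex_energy r c m (Z k) (Z l))
  + (\int[mu]_z smooth_potential mu c z)%R
  - 2 * (n%:R^-1 * \sum_k polygon_mean m (fun i => smooth_potential mu (4 * c) (vertex (Z k) r m i))).

Lemma bounded_measurable_test : bounded_measurable phi.
Proof.
split; last exact: compact_support_bounded cphi phi_support.
exact: continuous_measurable_plane.
Qed.

(** Three errors are collected: moving each point to its vertices costs [w], and replacing
    [2 * pi * phi] by its smoothing costs [e] for each of the two measures. [y] is the remaining
    difference of smoothed means. *)
Lemma deviation_le (e : R) : 0 < e -> exists2 d : R, 0 < d &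
  forall (c : R) m, 0 < c < d -> exists y : R, [/\ 0 <= y,
    y ^+ 2 <= D * (2 * pi * deviation_energy c m) &
    2 * pi * (`|n%:R^-1 * (\sum_k phi (Z k)) - (\int[mu]_z phi z)%R| - w) <= y + 2 * e].
Proof.
move=> e0; have [d d0 dP] := smoothing_approx cphi phi_support e0.
have [M phiM] := compact_support_bounded cphi phi_support.
have [B phiB] := compact_support_box phi_support.
exists d => // c m cd; have /andP[c0 _] := cd.
have p2 : (0 < 2 ^ m)%N by rewrite expn_gt0.
pose i0 : 'I_n * 'I_(2 ^ m) := (Ordinal n0, Ordinal p2).
pose p_ (i : 'I_n * 'I_(2 ^ m)) : R * R := vertex (Z i.1) r m i.2.
have I0 : (0 < #|{: 'I_n * 'I_(2 ^ m)}|)%N by apply/card_gt0P; exists i0.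
have : (#|{: 'I_n * 'I_(2 ^ m)}|%:R^-1 * (\sum_i smoothing phi c (p_ i))
    - (\int[mu]_z smoothing phi c z)%R) ^+ 2 <= D * (2 * pi * deviation_energy c m).
  rewrite /deviation_energy /vertex_energy.
  rewrite -(double_mean_prod m (smooth_log c) (fun k i => vertex (Z k) r m i)).
  rewrite -(mean_prod m (fun k i => smooth_potential mu (4 * c) (vertex (Z k) r m i))).
  exact: (sqr_smoothing_empirical_le cE muE i0 p_ c0 cphi phiM phiB phi_partials phi_acl phiD).
rewrite -real_normK ?num_real// => hy.
eexists; split; [|exact: hy|]; first exact: normr_ge0.
have bs := bounded_measurable_smoothing mu c0 cphi phiM phiB.
have bphi := bounded_measurable_test.
apply: (@deviation_arith _ _ _ _ (#|{: 'I_n * 'I_(2 ^ m)}|%:R^-1 * \sum_i phi (p_ i))).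
- by rewrite mulr_gt0// pi_gt0.
- have -> : \sum_k phi (Z k) = \sum_k polygon_mean m (fun=> phi (Z k)).
    by apply: eq_bigr => k _; rewrite polygon_mean_cst.
  rewrite -(mean_prod m (fun k _ => phi (Z k))).
  apply: mean_dist_le => // i; apply: phiw.
  by rewrite cdistC cdist_vertex ?(ltW r0).
- rewrite [2 * pi * (_^-1 * _)]mulrCA [2 * pi * (\sum_i _)]mulr_sumr; apply: mean_dist_le => // i; exact: dP.
- by apply: (@expectation_dist_le _ _ _ mu _ _ (2 * pi)) => [||z]; [exact: bs|exact: bphi|exact: dP].
Qed.

End deviation.

Lemma deviation_energy_arith (R : realFieldType) (a i p g s q V M e : R) : 0 <= e ->
  a <= s - q + e / 4 -> i <= V -> - p <= g + (M - V + e / 4) ->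
  a + i - 2 * p <= 2 * g + s - V - q + 2 * M + e.
Proof. lra. Qed.

Lemma mean_shift (R : realType) (n : nat) (g : 'I_n -> R) (a : R) : (0 < n)%N ->
  n%:R^-1 * \sum_k (g k + a) = n%:R^-1 * (\sum_k g k) + a.
Proof.
move=> n0; have nR : (n%:R : R) != 0 by rewrite pnatr_eq0 -lt0n.
by rewrite big_split/= sumr_const card_ord -[a *+ n]mulr_natl mulrDr (mulKf nR).
Qed.

Lemma scaled_sqrt_le (R : rcfType) (p D Q x w : R) : 0 < p -> 0 <= D ->
  p * (x - w) <= Num.sqrt (p * D * Q) -> x <= w + Num.sqrt (D * p^-1) * Num.sqrt Q.
Proof.
move=> p0 D0; rewrite -lerBlDl -sqrtrM ?divr_ge0 ?(ltW p0)//.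
have -> : p * D * Q = p ^+ 2 * (D / p * Q) by field; rewrite gt_eqF.
by rewrite sqrtrM ?sqr_ge0// sqrtr_sqr gtr0_norm// ler_pM2l.
Qed.

Section real_estimate.
Variables (R : realType) (E : set (R * R)) (mu : probability (R * R)%type R) (r V M : R).
Hypotheses (cE : compact E) (muE : supported_on E mu) (E0 : E !=set0) (r0 : 0 < r).
Variable u : R * R -> R.
Hypotheses (uE : forall z, log_potential mu z = (u z)%:E) (uV : forall z, u z <= V)
  (M0 : 0 <= M) (uM : forall z, dist_to E z <= 2 * r -> V - M <= u z)
  (uO : forall z, ~ Omega E z -> V - M <= u z) (muV : log_energy mu = V%:E).
Variables (n : nat) (Z : 'I_n -> R * R).
Hypothesis n0 : (0 < n)%N.

(** Real form of the quantity [I] of the theorem for distinct points, with the discrete energy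
    written over ordered pairs. *)
Definition energy_bound : R :=
  2 * (n%:R^-1 * \sum_k (if Z k \in Omega E then V - u (Z k) else 0))
  + n%:R^-1 * (n%:R^-1 * \sum_k \sum_(l | l != k) - ln (cdist (Z k) (Z l)))
  - V - ln r / n%:R + 2 * M.

Lemma deviation_energy_le (e : R) : injective Z -> 0 < e ->
  exists2 d : R, 0 < d & forall c : R, 0 < c < d ->
  exists m, deviation_energy mu Z r c m <= energy_bound + e.
Proof.
move=> injZ e0; have e4 : 0 < e / 4 by rewrite divr_gt0.
have [d1 d10 [m1 h1]] := vertex_potential_ge cE muE E0 r0 uE uV M0 uM uO e4.
have [d2 d20 h2] := vertex_energies_le r0 n0 injZ e4.
exists (Num.min (d1 / 4) d2); first by rewrite lt_min d20 divr_gt0.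
move=> c /andP[c0]; rewrite lt_min => /andP[cd1 cd2].
have [|m2 {}h2] := h2 c; first by rewrite c0.
exists (maxn m1 m2).
have c4 : 0 < 4 * c <= d1 by rewrite mulr_gt0//=; lra.
have {}h1 k := h1 (4 * c) (maxn m1 m2) (Z k) c4 (leq_maxl _ _).
have {}h2 := h2 _ (leq_maxr m1 m2).
have := smooth_energy_le cE muE c0; rewrite muV lee_fin => h3.
have := mean_le h1.
have -> : \sum_k ((if Z k \in Omega E then V - u (Z k) else 0) + M - V + e / 4) =
    \sum_k ((if Z k \in Omega E then V - u (Z k) else 0) + (M - V + e / 4)).
  by apply: eq_bigr => k _; rewrite !addrA.
rewrite mean_shift// sumrN mulrN => h4.
exact: (deviation_energy_arith (ltW e0) h2 h3 h4).
Qed.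

Variables (phi : R * R -> R) (w D : R).
Hypotheses (cphi : continuous phi)
  (phi_support : compact (closure [set z | phi z != 0]))
  (phi_partials : partials_exist_ae phi)
  (phi_acl : absolutely_continuous_on_lines phi)
  (D0 : 0 <= D) (phiD : (dirichlet_integral phi <= D%:E)%E)
  (phiw : forall z z', cdist z z' <= r -> `|phi z - phi z'| <= w).

Let p2 : 0 < 2 * pi :> R. Proof. by rewrite mulr_gt0// pi_gt0. Qed.

Lemma mean_error_le : injective Z ->
  `|n%:R^-1 * (\sum_k phi (Z k)) - (\int[mu]_z phi z)%R| <=
  w + Num.sqrt (D * (2 * pi)^-1) * Num.sqrt energy_bound.
Proof.
move=> injZ; apply: scaled_sqrt_le => //.
apply: limit_bound_arith => [|e e0]; first by rewrite mulr_ge0// ltW.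
have [d1 d10 h1] := deviation_energy_le injZ e0.
have [d2 d20 h2] :=
  deviation_le cE muE Z n0 r0 cphi phi_support phi_partials phi_acl phiD phiw e0.
pose c : R := Num.min d1 d2 / 2.
have m0 : 0 < Num.min d1 d2 by rewrite lt_min d10.
have c0 : 0 < c by rewrite divr_gt0.
have cm : c < Num.min d1 d2 by rewrite /c; lra.
move: cm; rewrite lt_min => /andP[cd1 cd2].
have [|m hm] := h1 c; first by rewrite c0.
have [|y [y0 y1 y2]] := h2 c m; first by rewrite c0.
exists y; split => //; apply: le_trans y1 _.
by rewrite mulrA [D * _]mulrC ler_wpM2l// mulr_ge0// ltW.
Qed.

(** Covers coinciding points with zero Dirichlet integral: the energy, multiplied by [D = 0],
    disappears for every [c] and [m], so distinctness of the points is never invoked. *)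
Lemma mean_error_le_modulus : D = 0 ->
  `|n%:R^-1 * (\sum_k phi (Z k)) - (\int[mu]_z phi z)%R| <= w.
Proof.
move=> D_0; rewrite -subr_le0 -(pmulr_rle0 _ p2).
suff h0 : 2 * pi * (`|n%:R^-1 * (\sum_k phi (Z k)) - (\int[mu]_z phi z)%R| - w) <=
    Num.sqrt (0 * 0) by rewrite mul0r sqrtr0 in h0.
apply: limit_bound_arith => // e e0.
have [d d0 h] :=
  deviation_le cE muE Z n0 r0 cphi phi_support phi_partials phi_acl phiD phiw e0.
have [|y [y0 y1 y2]] := h (d / 2) 0%N; first by apply/andP; split; lra.
by exists y; split => //; rewrite mul0r; apply: le_trans y1 _; rewrite {}D_0 mul0r.
Qed.

End real_estimate.

Lemma sum_offdiag (R : realType) (n : nat) (F : 'I_n -> 'I_n -> R) :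
  (forall k l, F k l = F l k) ->
  \sum_k \sum_(l | l != k) F k l = 2 * \sum_(k < n) \sum_(l < n | (k < l)%N) F k l.
Proof.
move=> FC.
have -> : \sum_k \sum_(l | l != k) F k l =
    \sum_(k < n) (\sum_(l < n | (k < l)%N) F k l + \sum_(l < n | (l < k)%N) F k l).
  apply: eq_bigr => k _; rewrite (bigID (fun l : 'I_n => (k < l)%N))/=; congr (_ + _);
    apply: eq_bigl => l; rewrite -val_eqE neq_ltn; case: ltngtP => //.
rewrite big_split/= [X in _ + X](exchange_big_dep predT)//=.
rewrite [X in _ + X](_ : _ = \sum_(k < n) \sum_(l < n | (k < l)%N) F k l).
  by rewrite mulr_natl mulr2n.
by apply: eq_bigr => k _; apply: eq_bigr => l _; exact: FC.
Qed.

(** * Finiteness of the terms of the statement and conclusion *)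

Section discrete_energies.
Variables (R : realType) (n : nat) (Z : 'I_n -> R * R).
Hypothesis n2 : (2 <= n)%N.

Let n_gt0 : 0 < n%:R :> R. Proof. by rewrite ltr0n (leq_trans _ n2). Qed.
Let n_gt1 : 0 < n%:R - 1 :> R. Proof. by rewrite subr_gt0 ltr1n. Qed.

Lemma discrete_energy_injective : injective Z ->
  (((n%:R - 1) / n%:R)%:E * discrete_energy Z)%E =
  (n%:R^-1 * (n%:R^-1 * \sum_k \sum_(l | l != k) - ln (cdist (Z k) (Z l))))%:E.
Proof.
move=> injZ; rewrite /discrete_energy.
have -> : (\sum_(j < n) \sum_(k < n | (j < k)%N) log_kernel (Z j) (Z k) =
    (\sum_(j < n) \sum_(k < n | (j < k)%N) - ln (cdist (Z j) (Z k)))%:E)%E.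
  rewrite -sumEFin; apply: eq_bigr => j _; rewrite -sumEFin; apply: eq_bigr => k jk.
  by rewrite log_kernelE//; apply: contraTneq jk => /injZ ->; rewrite ltnn.
rewrite sum_offdiag; last by move=> k l; rewrite cdistC.
rewrite -!EFinM; congr EFin; field.
by rewrite !gt_eqF.
Qed.

Lemma discrete_energy_coincide : ~ injective Z -> discrete_energy Z = +oo%E.
Proof.
move=> /injectiveP/injectivePn[j [k jk Zjk]].
wlog ltjk : j k jk Zjk / (j < k)%N.
  move=> H; case: (ltngtP j k) => [|h|/val_inj h]; first exact: H.
    by apply: (H k j) => //; rewrite eq_sym.
  by rewrite h eqxx in jk.
have lkN (i l : 'I_n) : log_kernel (Z i) (Z l) != -oo%E.
  by have [->|h] := eqVneq (Z i) (Z l); rewrite ?log_kernel_diag ?log_kernelE.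
rewrite /discrete_energy.
rewrite [X in (_ * X)%E](_ : _ = +oo%E).
  by rewrite gt0_muley// lte_fin divr_gt0// mulr_gt0.
apply/eqP; rewrite esum_eqy => [|i _]; last first.
  by apply/eqP => /esum_eqNyP[l [_ _ /eqP]]; exact/negP/lkN.
apply/exists_inP; exists j => //; rewrite esum_eqy//.
by apply/exists_inP; exists k => //; rewrite Zjk log_kernel_diag.
Qed.

End discrete_energies.

Section equilibrium.
Variables (R : realType) (E : set (R * R)) (mu : probability (R * R)%type R).
Hypotheses (cE : compact E) (capE : (0 < capacity E)%E)
  (eqE : is_equilibrium_measure E mu).

(** Positive capacity excludes the value +oo; the finite smooth energy of [mu], which bounds the
    energy from below, excludes -oo. *)
Lemma robin_constant_fin : exists V : R, robin_constant E = V%:E.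
Proof.
have [muE muR] := eqE.
have := smooth_energy_le cE muE (@ltr01 R); rewrite muR.
move: capE; rewrite /capacity; case: (robin_constant E) => [V| |] //.
  by exists V.
by rewrite /= ltxx.
Qed.

Lemma equilibrium_support_nonempty : E !=set0.
Proof.
have [muE _] := eqE; apply/set0P/eqP => E0.
move: muE; rewrite /supported_on E0 setC0.
have /= -> := @probability_setT _ _ _ mu.
by move/eqP; rewrite onee_eq0.
Qed.

(** Frostman's inequality holds at every point, and smooth potentials bound the potential from
    below, so it is real-valued on the whole plane, even on [E]. *)
Lemma equilibrium_potential : exists u : R * R -> R, exists V : R,
  [/\ robin_constant E = V%:E, log_energy mu = V%:E,
    forall z, log_potential mu z = (u z)%:E & forall z, u z <= V].
Proof.
have [muE muR] := eqE; have [V VE] := robin_constant_fin.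
have muV : log_energy mu = V%:E by rewrite muR.
have minE lam : supported_on E lam -> (V%:E <= log_energy lam)%E.
  by move=> lamE; rewrite -VE; apply: ereal_inf_lbound; exists lam.
have [C C0 EC] := log_kernel_ge cE.
have hU z := log_potential_le_robin cE muE muV minE C0 EC z.
have uE z : log_potential mu z = (fine (log_potential mu z))%:E.
  have := hU z; have := smooth_potential_le cE muE z (@ltr01 R).
  by case: (log_potential mu z).
exists (fun z => fine (log_potential mu z)), V; split => // z.
by rewrite -lee_fin -uE.
Qed.

(** [M] is nonnegative because points of [E] belong to the set and the Green function is
    nonnegative; it is finite because the smooth potential of parameter 1 bounds the potential from
    below on a bounded set. *)
Lemma max_green_fin (u : R * R -> R) (V s : R) : robin_constant E = V%:E ->
  (forall z, log_potential mu z = (u z)%:E) -> (forall z, u z <= V) -> 0 <= s ->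
  exists M : R, [/\ max_green E mu s = M%:E, 0 <= M &
    forall z, dist_to E z <= s -> V - M <= u z].
Proof.
move=> VE uE uV s0; have [muE muR] := eqE; have E0 := equilibrium_support_nonempty.
have gE z : green E mu z = (V - u z)%:E by rewrite /green VE uE.
have [b _ Kb] := compact_bounded_plane (@dist_to_compact _ _ cE E0 s).
have [C C0 UC] := smooth_potential_bounded cE muE b (@ltr01 R).
have ub z : dist_to E z <= s -> (green E mu z <= max_green E mu s)%E.
  by move=> zs; apply: ereal_sup_ubound; exists z.
have M1 : (max_green E mu s <= (V + C)%:E)%E.
  apply: ub_ereal_sup => _ [z zs <-]; rewrite gE lee_fin lerD2l lerNl.
  have := smooth_potential_le cE muE z (@ltr01 R); rewrite uE lee_fin; apply: le_trans.
  by have := UC z (Kb z zs); rewrite ler_norml => /andP[].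
have [t Et] := E0.
have M0 : (0 <= max_green E mu s)%E.
  by apply: le_trans (ub t _); rewrite ?gE ?lee_fin ?subr_ge0// dist_to_in.
exists (fine (max_green E mu s)).
have ME : max_green E mu s = (fine (max_green E mu s))%:E.
  by move: M0 M1; case: (max_green E mu s).
split => // [|z zs]; first by rewrite fine_ge0.
by have := ub z zs; rewrite gE ME lee_fin lerBlDr addrC -lerBlDr.
Qed.

End equilibrium.

Lemma m_green_fin (R : realType) (E : set (R * R)) (mu : probability (R * R)%type R)
    (u : R * R -> R) (V : R) (n : nat) (Z : 'I_n -> R * R) :
  robin_constant E = V%:E -> (forall z, log_potential mu z = (u z)%:E) ->
  m_green E mu Z = (n%:R^-1 * \sum_k (if Z k \in Omega E then V - u (Z k) else 0))%:E.
Proof.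
move=> VE uE; rewrite /m_green EFinM -sumEFin big_mkcond/=; congr (_ * _)%E.
by apply: eq_bigr => k _; case: ifP => // _; rewrite /green VE uE.
Qed.

Lemma modulus_of_continuity_fin (R : realType) (phi : R * R -> R) (r M : R) : 0 <= r ->
  (forall z, `|phi z| <= M) -> exists w : R, modulus_of_continuity phi r = w%:E /\
    forall z z', cdist z z' <= r -> `|phi z - phi z'| <= w.
Proof.
move=> r0 phiM; pose A : \bar R := modulus_of_continuity phi r.
have ub z z' : cdist z z' <= r -> (`|phi z - phi z'|%:E <= A)%E.
  by move=> zr; apply: ereal_sup_ubound; exists (z, z').
have A1 : (A <= (M + M)%:E)%E.
  apply: ub_ereal_sup => _ [[z z'] _ <-]; rewrite lee_fin.
  by apply: le_trans (ler_normB _ _) _; rewrite lerD.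
have A0 : (0 <= A)%E.
  apply: le_trans (ub (0, 0) (0, 0) _); rewrite ?lee_fin//.
  by rewrite (le_trans _ r0)// leNgt cdist_gt0 eqxx.
have AE : A = (fine A)%:E by move: A0 A1; case: A {ub}.
exists (fine A); split => // z z' zr.
by rewrite -lee_fin -AE; exact: ub.
Qed.

Theorem theorem2p1 (R : realType) (E : set (R * R))
    (mu_E : probability (R * R)%type R)
    (phi : R * R -> R) (n : nat) (Z : 'I_n -> R * R) (r : R)
    (E_compact : compact E)
    (E_capacity : (0 < capacity E)%E)
    (mu_E_eq : is_equilibrium_measure E mu_E)
    (phi_continuous : continuous phi)
    (phi_support : compact (closure [set z | phi z != 0]))
    (phi_partials : partials_exist_ae phi)
    (phi_acl : absolutely_continuous_on_lines phi)
    (phi_dirichlet : (dirichlet_integral phi < +oo)%E)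
    (n_ge2 : (2 <= n)%N)
    (r_gt0 : 0 < r) :
  let I : \bar R :=
    (2%:E * m_green E mu_E Z
     + ((n%:R - 1) / n%:R)%:E * discrete_energy Z
     - robin_constant E
     - (ln r / n%:R)%:E
     + 2%:E * max_green E mu_E (2 * r))%E in
  (`| (n%:R^-1 * \sum_(k < n) phi (Z k))%:E - \int[mu_E]_z (phi z)%:E |
   <= modulus_of_continuity phi r
      + sqrte (dirichlet_integral phi * ((2 * pi)^-1)%:E) * sqrte I)%E.
Proof.
cbv zeta; set I := (X in (sqrte _ * sqrte X)%E).
have [muE _] := mu_E_eq; have E0 := equilibrium_support_nonempty mu_E_eq.
have n0 : (0 < n)%N by rewrite (leq_trans _ n_ge2).
have [u [V [VE muV uE uV]]] := equilibrium_potential E_compact E_capacity mu_E_eq.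
have r20 : 0 <= 2 * r by rewrite mulr_ge0// ltW.
have [M [ME M0 uM]] := max_green_fin E_compact mu_E_eq VE uE uV r20.
have uO z : ~ Omega E z -> V - M <= u z.
  move=> Oz; rewrite -lee_fin -uE.
  apply: (log_potential_outside_Omega E_compact muE E0 (s := 2 * r)) Oz => [|w wr].
    by rewrite mulr_gt0.
  by rewrite uE lee_fin uM.
have [Mp phiM] := compact_support_bounded phi_continuous phi_support.
have [w [wE phiw]] := modulus_of_continuity_fin (ltW r_gt0) phiM.
have D0 : (0 <= dirichlet_integral phi)%E.
  by apply: integral_ge0 => p _; rewrite lee_fin addr_ge0// sqr_ge0.
have [D DE] : exists D : R, dirichlet_integral phi = D%:E.
  exists (fine (dirichlet_integral phi)).
  by move: D0 phi_dirichlet; case: (dirichlet_integral phi).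
rewrite DE lee_fin in D0; have phiD : (dirichlet_integral phi <= D%:E)%E by rewrite DE.
have bphi := bounded_measurable_test phi_continuous phi_support.
have -> : (\int[mu_E]_z (phi z)%:E)%E = ((\int[mu_E]_z phi z)%R)%:E.
  by apply/esym; exact: EFin_expectation.
rewrite wE DE -EFinB -EFinM.
have [injZ|nZ] := pselect (injective Z).
  have -> : I = (energy_bound E r V M u Z)%:E.
    by rewrite /I (m_green_fin Z VE uE) VE ME discrete_energy_injective.
  rewrite lee_fin; exact: (mean_error_le E_compact muE E0 r_gt0 uE uV M0 uM uO muV n0
    phi_continuous phi_support phi_partials phi_acl D0 phiD phiw injZ).
have -> : I = +oo%E.
  rewrite /I discrete_energy_coincide// gt0_muley; last first.
    by rewrite lte_fin divr_gt0 ?subr_gt0 ?ltr1n ?ltr0n.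
  by rewrite (m_green_fin Z VE uE) VE ME.
(* For [D = 0] the product of 0 and +oo is 0, so the bound by the modulus of continuity alone
   remains to be proved; otherwise the right-hand side is +oo. *)
have [D_0|D_n0] := eqVneq D 0.
  rewrite D_0 mul0r /= sqrtr0 mul0e adde0 lee_fin.
  exact: (mean_error_le_modulus E_compact muE r_gt0 Z n0
    phi_continuous phi_support phi_partials phi_acl phiD phiw D_0).
rewrite gt0_muley ?addey ?leey//.
rewrite /= lte_fin sqrtr_gt0 divr_gt0 ?mulr_gt0 ?pi_gt0//.
by rewrite lt_neqAle eq_sym D_n0.
Qed.
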